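(* The variety $\mathrm{Gr}_0(3,8)$ over $\mathbb{C}$ is schön; that is, for every $w\in \mathrm{TGr}_0(3,8)$ the initial degeneration $\mathrm{in}_w\mathrm{Gr}_0(3,8)$ is smooth over $\mathbb{C}$.
   Context: Everything is over $\mathbb{C}$. $\mathrm{Gr}(r,n)\subset \mathbb{P}^{\binom{n}{r}-1}$ is the Grassmannian of $r$-dimensional linear subspaces of $\mathbb{C}^n$ in its Plücker embedding, with Plücker coordinates $\zeta_\lambda$ indexed by $\lambda\in\binom{[n]}{r}$ (the $r$-element subsets of $[n]=\{1,\dots,n\}$). $\mathrm{Gr}_0(r,n)$ is the open locus where all Plücker coordinates are nonzero; it is a closed subvariety of the torus $T=\mathbb{G}_m^{\binom{[n]}{r}}/\mathbb{G}_m$, whose cocharacter lattice is $N=\mathbb{Z}^{\binom{[n]}{r}}/\mathbb{Z}(1,\dots,1)$ and whose character lattice is $M=\mathrm{Hom}(N,\mathbb{Z})$. Let $X\subset T=\mathrm{Spec}\,\mathbb{C}[M]$ be a closed subvariety of a torus, defined by a prime ideal $I\subset\mathbb{C}[M]$. For $w\in N_{\mathbb{R}}=N\otimes\mathbb{R}$ and $f=\sum_u c_u x^u\in\mathbb{C}[M]$, the initial form $\mathrm{in}_w f$ is the sum of those terms $c_ux^u$ with $c_u\neq 0$ for which $\langle u,w\rangle$ is minimal; $\mathrm{in}_wI=\langle \mathrm{in}_wf: f\in I\rangle$; $\mathrm{Trop}(X)=\{w\in N_{\mathbb{R}}: \mathrm{in}_wI\neq\langle 1\rangle\}$; and for $w\in\mathrm{Trop}(X)$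 the initial degeneration $\mathrm{in}_wX$ is the closed subscheme of $T$ defined by $\mathrm{in}_wI$. $X$ is schön if all its initial degenerations $\mathrm{in}_wX$, $w\in \mathrm{Trop}(X)$, are smooth. We write $\mathrm{TGr}_0(r,n)=\mathrm{Trop}(\mathrm{Gr}_0(r,n))$. *)

(* Defs.v *)
From HB Require Import structures.
From mathcomp Require Import all_boot all_order all_algebra.
From mathcomp Require Import finmap.
From mathcomp Require Import boolp classical_sets reals.
From mathcomp Require Import complex.
From mathcomp Require Import monalg.
From mathcomp Require mpoly.
Import (canonicals) mpoly.

Set Implicit Arguments.
Unset Strict Implicit.
Unset Printing Implicit Defensive.

Import GRing.Theory Num.Theory.

Local Open Scope classical_set_scope.
Local Open Scope fset_scope.
Local Open Scope ring_scope.

(* The group algebra k[M] of an additive group M. The ring structure of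
   [malg] requires monomials without nontrivial units, which excludes groups,
   so the convolution product is defined here on an alias. *)
Definition grpalg (k : comNzRingType) (M : zmodType) := {malg k[M]}.

Section GroupAlgebra.
Context (k : comNzRingType) (M : zmodType).
Local Notation A := (grpalg k M).
Implicit Types (f g h : A) (d : {fset M}).

HB.instance Definition _ := GRing.Lmodule.on A.

Definition gaone : A := << 1 *g 0%R >>.

Definition gamul f g : A :=
  \sum_(u <- msupp f) \sum_(v <- msupp g) << f@_u * g@_v *g (u + v)%R >>.

Lemma gamulw d1 d2 f g : msupp f `<=` d1 -> msupp g `<=` d2 ->
  gamul f g = \sum_(u <- d1) \sum_(v <- d2) << f@_u * g@_v *g (u + v)%R >>.
Proof.
move=> le_d1 le_d2; rewrite /gamul (big_fset_incl _ le_d1) /=.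
  apply/eq_bigr=> k1 _; apply/big_fset_incl => // l _ /mcoeff_outdom ->.
  by rewrite mulr0 monalgU0.
move=> l _ /mcoeff_outdom g1k.
by rewrite big1 => // k' _; rewrite g1k mul0r monalgU0.
Qed.

Lemma gamulC : commutative gamul.
Proof.
move=> f g; rewrite /gamul exchange_big /=.
by apply/eq_bigr=> u _; apply/eq_bigr=> v _; rewrite mulrC [(u + v)%R]addrC.
Qed.

Lemma gamul0g : left_zero 0 gamul.
Proof. by move=> g; rewrite /gamul msupp0 big_seq_fset0. Qed.

Lemma gamulUU c1 c2 u v :
  gamul << c1 *g u >> << c2 *g v >> = << c1 * c2 *g (u + v)%R >>.
Proof. by rewrite (gamulw msuppU_le msuppU_le) !big_seq_fset1 !mcoeffUU. Qed.

Lemma gamulDl : left_distributive gamul +%R.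
Proof.
move=> f g h.
rewrite (gamulw (msuppD_le f g) (fsubset_refl (msupp h))).
rewrite (gamulw (fsubsetUl (msupp f) (msupp g)) (fsubset_refl (msupp h))).
rewrite (gamulw (fsubsetUr (msupp f) (msupp g)) (fsubset_refl (msupp h))).
rewrite -big_split /=; apply/eq_bigr=> u _.
rewrite -big_split /=; apply/eq_bigr=> v _.
by rewrite mcoeffD mulrDl monalgUD.
Qed.

Lemma gamul1g : left_id gaone gamul.
Proof.
move=> g; rewrite (gamulw msuppU_le (fsubset_refl _)) big_seq_fset1.
rewrite [RHS]monalgE; apply/eq_bigr=> u _.
by rewrite mcoeffUU mul1r add0r.
Qed.

Lemma gamul_suml (I : Type) (r : seq I) (F : I -> A) g :
  gamul (\sum_(i <- r) F i) g = \sum_(i <- r) gamul (F i) g.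
Proof.
exact: (big_morph (gamul^~ g) (fun _ _ => gamulDl _ _ _) (gamul0g _)).
Qed.

Lemma gamul_sumr (I : Type) (r : seq I) (F : I -> A) g :
  gamul g (\sum_(i <- r) F i) = \sum_(i <- r) gamul g (F i).
Proof.
by rewrite gamulC gamul_suml; apply/eq_bigr=> i _; rewrite gamulC.
Qed.

Lemma gaE f : f = \sum_(u <- msupp f) (<< f@_u *g u >> : A).
Proof. exact: monalgE. Qed.

Lemma gamulA : associative gamul.
Proof.
move=> f g h; rewrite [f]gaE !(gamul_suml (msupp f)).
apply/eq_bigr=> u _.
rewrite [g]gaE gamul_suml !gamul_sumr gamul_suml; apply/eq_bigr=> v _.
rewrite [h]gaE !gamul_sumr; apply/eq_bigr=> w _.
by rewrite !gamulUU mulrA addrA.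
Qed.

Lemma gaone_neq0 : gaone != 0.
Proof. by rewrite monalgU_eq0 oner_eq0. Qed.

HB.instance Definition _ := GRing.Zmodule_isComNzRing.Build A
  gamulA gamulC gamul1g gamulDl gaone_neq0.

Lemma gascaleAl (c : k) f g : c *: (f * g) = (c *: f) * g.
Proof.
have mulE a b : a * b = gamul a b by [].
have scaleE (l : A) : c *: l = gamul << c *g 0%R >> l.
  rewrite malgZ_def /gamul (big_fset_incl _ (msuppU_le (x := c))) /=.
    rewrite big_seq_fset1 mcoeffUU.
    by apply/eq_bigr => u _; rewrite add0r.
  move=> u _ /mcoeff_outdom uE.
  by rewrite big1 // => v _; rewrite uE mul0r monalgU0.
by rewrite !scaleE !mulE gamulA.
Qed.

HB.instance Definition _ := GRing.Lmodule_isLalgebra.Build k A gascaleAl.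
HB.instance Definition _ := GRing.Lalgebra_isComAlgebra.Build k A.

End GroupAlgebra.

Definition ideal_gen (A : comNzRingType) (S : set A) : set A :=
  [set f | exists n (a s : 'I_n -> A),
    (forall i, S (s i)) /\ f = \sum_(i < n) a i * s i].

Section IdealGen.
Context (A : comNzRingType) (S : set A).

Lemma ideal_gen1 : ideal_gen [set 1 : A] = setT.
Proof.
apply/seteqP; split => // f _; exists 1%N, (fun=> f), (fun=> 1); split => //.
by rewrite big_ord1 mulr1.
Qed.

Lemma ideal_gen0 : ideal_gen S 0.
Proof.
exists 0%N, (fun=> 0), (fun=> 0); split; first by case.
by rewrite big_ord0.
Qed.

Lemma ideal_genMD a f g : ideal_gen S f -> ideal_gen S g ->
  ideal_gen S (a * f + g).
Proof.
move=> [m [b [s [Ss ->]]]] [n [c [t [St ->]]]].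
exists (m + n)%N, (fun i => match split i with inl j => a * b j | inr j => c j end),
  (fun i => match split i with inl j => s j | inr j => t j end); split.
  by move=> i; case: split => j.
rewrite big_split_ord mulr_sumr; congr (_ + _); apply: eq_bigr => i _.
  by rewrite -[lshift _ _]/(unsplit (inl i)) unsplitK mulrA.
by rewrite -[rshift _ _]/(unsplit (inr i)) unsplitK.
Qed.

Lemma ideal_gen_proper : ideal_gen S <> ideal_gen [set 1] -> ~ ideal_gen S 1.
Proof.
move=> neq1 S1; apply: neq1; rewrite ideal_gen1; apply/seteqP; split => // f _.
by rewrite -[f]mulr1 -[_ * _]addr0; apply: ideal_genMD S1 ideal_gen0.
Qed.

Lemma ideal_gen_closed : ideal_gen S <> ideal_gen [set 1] ->
  idealr_closed (fun f => `[< ideal_gen S f >] : bool).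
Proof.
move=> /ideal_gen_proper S1; split; rewrite ?unfold_in /=.
- exact/asboolP/ideal_gen0.
- exact/asboolPn.
- move=> a f g /asboolP Sf /asboolP Sg; apply/asboolP.
  exact: ideal_genMD.
Qed.

Definition ideal_of (S1 : ideal_gen S <> ideal_gen [set 1]) : idealr A :=
  HB.pack (fun f => `[< ideal_gen S f >] : bool)
    (isIdealr.Build A _ (ideal_gen_closed S1)).

End IdealGen.

Section QuotientAlgebra.
Local Open Scope quotient_scope.
Context (k : comNzRingType) (A : comAlgType k) (I : idealr A).
Local Notation Q := {ideal_quot I}.

Definition qscale (c : k) (q : Q) : Q := \pi_Q (c%:A) * q.

Lemma qscaleA a b q : qscale a (qscale b q) = qscale (a * b) q.
Proof. by rewrite /qscale mulrA -rmorphM /= -scalerAl mul1r scalerA. Qed.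

Lemma qscale1 : left_id 1 qscale.
Proof. by move=> q; rewrite /qscale scale1r rmorph1 mul1r. Qed.

Lemma qscaleDr : right_distributive qscale +%R.
Proof. by move=> a p q; rewrite /qscale mulrDr. Qed.

Lemma qscaleDl q : {morph qscale^~ q : a b / a + b}.
Proof. by move=> a b; rewrite /qscale scalerDl rmorphD mulrDl. Qed.

HB.instance Definition _ := GRing.Zmodule_isLmodule.Build k (Quotient.quot I)
  qscaleA qscale1 qscaleDr qscaleDl.

Lemma qscaleAl a (p q : Q) : a *: (p * q) = (a *: p) * q.
Proof. exact: mulrA. Qed.

HB.instance Definition _ :=
  GRing.Lmodule_isLalgebra.Build k (Quotient.quot I) qscaleAl.
HB.instance Definition _ :=
  GRing.Lalgebra_isComAlgebra.Build k (Quotient.quot I).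

End QuotientAlgebra.

(* Smoothness of Spec A over k in the sense of EGA IV, 17.1.1 and 17.3.1:
   finite presentation and infinitesimal lifting. The algebra structures used
   exclude the zero ring as a test object; this loses nothing, since a
   square-zero extension of the zero ring is zero. *)
Section Smooth.
Context (k : comNzRingType).

Definition finitely_presented (A : comAlgType k) : Prop :=
  exists n (p : {lrmorphism mpoly.mpoly n k -> A}),
    (forall y, exists x, p x = y) /\
    exists m (r : 'I_m -> mpoly.mpoly n k),
      [set f | p f = 0] = ideal_gen (range r).

Definition formally_smooth (A : comAlgType k) : Prop :=
  forall (B B' : comAlgType k) (p : {lrmorphism B -> B'}),
    (forall y, exists x, p x = y) ->
    (forall x y, p x = 0 -> p y = 0 -> x * y = 0) ->
    forall f : {lrmorphism A -> B'},
    exists g : {lrmorphism A -> B}, forall a, p (g a) = f a.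

Definition smooth (A : comAlgType k) : Prop :=
  finitely_presented A /\ formally_smooth A.

End Smooth.

(* The character lattice M of G_m^L / G_m: a homomorphism from
   N = Z^L / Z(1, ..., 1) to Z is a vector of integers with zero sum. *)
Section Characters.
Context (L : finType).

Definition deg0 : {pred {ffun L -> int}} := fun u => \sum_i u i == 0.

Lemma deg0_zmod : zmod_closed deg0.
Proof.
split=> [|u v]; rewrite !unfold_in.
  by rewrite big1 // => i _; rewrite ffunE.
move=> /eqP u0 /eqP v0.
under eq_bigr do rewrite !ffunE.
by rewrite sumrB u0 v0 subr0.
Qed.

HB.instance Definition _ := GRing.isZmodClosed.Build _ deg0 deg0_zmod.

Record character := Character {
  char_val :> {ffun L -> int};
  _ : char_val \in deg0
}.

HB.instance Definition _ := [isSub for char_val].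
HB.instance Definition _ := [Choice of character by <:].
HB.instance Definition _ := [SubChoice_isSubZmodule of character by <:].

End Characters.

(* A vector w : L -> R stands for its class in N_R = R^L / R(1, ..., 1). *)
Definition pairing (L : finType) (R : realType) (u : character L)
  (w : L -> R) : R := \sum_i (u i)%:~R * w i.

Lemma pairing_shift (L : finType) (R : realType) (u : character L)
  (w : L -> R) (c : R) : pairing u (fun i => w i + c) = pairing u w.
Proof.
rewrite /pairing; under eq_bigr do rewrite mulrDr.
rewrite big_split /= -mulr_suml -rmorph_sum.
by have /eqP -> := valP u; rewrite mul0r addr0.
Qed.

Section Torus.
Context (L : finType) (R : realType).
Local Notation C := (complex R).
Local Notation CM := (grpalg C (character L)).

(* A closed point of T is given by homogeneous coordinates z, all nonzero;
   the value is independent of the choice of z since the u i sum to 0. *)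
Definition evalT (f : CM) (z : L -> C) : C :=
  \sum_(u <- msupp f) f@_u * \prod_i z i ^ (u i).

(* The ideal of a closed subvariety of T, given by its set of closed points. *)
Definition vanishing_ideal (X : set (L -> C)) : set CM :=
  [set f | forall z, X z -> evalT f z = 0].

Definition init_form (w : L -> R) (f : CM) : CM :=
  [malg u in [fset u in msupp f |
      all (fun v => pairing u w <= pairing v w) (msupp f)] => f@_u].

Definition init_ideal (w : L -> R) (I : set CM) : set CM :=
  ideal_gen [set init_form w f | f in I].

Definition Trop (X : set (L -> C)) : set (L -> R) :=
  [set w | init_ideal w (vanishing_ideal X) <> ideal_gen [set 1]].

(* The coordinate ring C[M] / in_w I of in_w X. *)
Definition init_degen (X : set (L -> C)) (w : L -> R) (Xw : Trop X w) :
  comAlgType C := {ideal_quot (ideal_of Xw)}.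

Definition schon (X : set (L -> C)) : Prop :=
  forall (w : L -> R) (Xw : Trop X w), smooth (init_degen Xw).

End Torus.

Section Grassmannian.
Context (r n : nat).

Definition rsubset := {S : {set 'I_n} | #|S| == r}.

(* The j-th smallest element of S. *)
Definition rsubset_nth (S : rsubset) (j : 'I_r) : 'I_n :=
  enum_val (cast_ord (esym (eqP (valP S))) j).

Definition plucker (k : fieldType) (A : 'M[k]_(r, n)) (S : rsubset) : k :=
  \det (colsub (rsubset_nth S) A).

(* Homogeneous coordinate vectors of the points of Gr(r, n): the rows of A
   form a basis of the subspace. *)
Definition Gr (k : fieldType) : set (rsubset -> k) :=
  [set z | exists2 A : 'M[k]_(r, n), row_free A &
           exists2 c : k, c != 0 & z = (fun S => c * plucker A S)].

Definition Gr0 (k : fieldType) : set (rsubset -> k) :=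
  [set z | Gr z /\ forall S, z S != 0].

End Grassmannian.

(* Main.v *)
Require Import Defs.
From mathcomp Require Import all_boot all_algebra.
From mathcomp Require Import reals.
From mathcomp Require Import complex.
From HB Require Import structures.
From mathcomp Require Import all_order perm finmap boolp classical_sets monalg.
From mathcomp Require mpoly.
From mathcomp Require Import lra ring zify.
Import (canonicals) mpoly.

(* Write [I] for the ideal of [X = Gr_0(3,8)] and let [x] be a closed point of
   [in_w X]. Take [F_1, ..., F_r] in [I] of weight [0] and with
   [r >= dim T - dim X], and suppose that the logarithmic Jacobian of their
   initial forms [f_i] has a nonzero minor [Delta] at [x]. The differentials of
   [I] have rank at most [r] along [X], so the bordered minors
   [g |-> det (dF, dg)] are derivations preserving [I], and their leading parts
   [g |-> det (df, dg)] preserve [in_w I]. Combined with the Euler field at [x],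
   they form a derivation that multiplies the [N]-th power of the maximal ideal
   by [N Delta] modulo higher order and [(f)]; hence [in_w I] lies in
   [(f) + m^N] for all [N], and by Krull the [f_i] generate [in_w I] near [x].
   Infinitesimal lifting then follows from the Jacobian, and closed points
   suffice by the Nullstellensatz.

   For the Jacobian only three-term Pluecker relations are used. Let [q] run over
   the terms of their initial forms at [x]. One has to show that a solution [v]
   of [sum q_(i;abcd) (v_iab + v_icd) = 0] is determined by [16] coordinates.
   Delete a point [j]: the solutions supported on the triples through [j] are
   determined by three coordinates, which allows an induction on the number of
   points, unless there are three disjoint minimal supports among the remaining
   points. A two-point support [a, b] makes the triple [j, a, b] free, and free
   triples share at most one point. When every [j] is an obstruction, seven points
   would form a Fano plane, which is impossible in characteristic not [2], and
   eight points form a Moebius-Kantor configuration [8_3], where the system is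
   solved by hand. *)

Set Implicit Arguments.
Unset Strict Implicit.
Unset Printing Implicit Defensive.

Import Order.TTheory GRing.Theory Num.Theory.

Local Open Scope ring_scope.

(** * Linearised initial forms of the three-term relations *)

(** The obstacle is that [in_w I] is defined through all of [I]: the initial forms of the known
    relations might generate a smaller ideal, so their Jacobian alone says nothing about [in_w X].
    What passes from [X] to [in_w X] is the rank bound, because it can be stated as determinants
    lying in [I], and leading parts of elements of [I] lie in [in_w I]. All coordinates are kept, 56
    of them, instead of the 55 of the torus. The scaling direction therefore counts as a tangent
    vector, and the target is 16 = 3 * 5 + 1, the dimension of the affine cone over Gr(3,8).
    Deleting a point lowers this dimension by 3, which is why the solutions through a deleted point
    have to be determined by three coordinates. The delicate obstruction on eight points is the one
    whose three disjoint supports have sizes 2, 2, 3. It is excluded by comparing the obstruction at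
    [j] with those at the points of its three-point support; only the sizes 2, 2, 2 with one point
    left over survive, and they lead to the configuration. Smallness of the characteristic enters
    twice, through a factor 2 on seven points and a factor 3 on eight. *)

Ltac distinct :=
  rewrite /= ?inE ?negb_or ?andbT; repeat (apply/andP; split);
  solve [done | assumption | rewrite eq_sym; assumption].

Lemma sum3_le6 (a b c n : nat) : (1 < a -> 1 < b -> 1 < c ->
  a + b + c <= n -> n <= 6 -> n = 6 /\ a = 2 /\ b = 2 /\ c = 2)%N.
Proof. by move=> *; lia. Qed.

Lemma sum3_le7 (a b c : nat) : (1 < a -> 1 < b -> 1 < c -> a + b + c <= 7 ->
  a = 2 /\ b = 2 \/ a = 2 /\ c = 2 \/ b = 2 /\ c = 2)%N.
Proof. by move=> *; lia. Qed.

Section ThreeTermSystem.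
Import fintype boot.finset.
Variables (F : numFieldType) (R : realFieldType) (T : finType).
Variables (x : T -> T -> T -> F) (w : T -> T -> T -> R).

Definition min_term i a b c d :=
  (w i a b + w i c d <= w i a c + w i d b) &&
  (w i a b + w i c d <= w i a d + w i b c).

(** A term of the relation at [i] when it survives in the initial form, and zero otherwise. As in
    the four-point condition for trees, a vanishing term means that its sum of weights strictly
    exceeds the two others, which are then equal: the quartet splits as [ab|cd], with cherries [ab]
    and [cd]. *)
Definition init_term i a b c d : F :=
  if min_term i a b c d then x i a b * x i c d else 0.
Local Notation q := init_term.

Record init_plucker : Prop := InitPlucker {
  ip_x12 : forall a b c, x b a c = - x a b c;
  ip_x23 : forall a b c, x a c b = - x a b c;
  ip_w12 : forall a b c, w b a c = w a b c;
  ip_w23 : forall a b c, w a c b = w a b c;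
  ip_neq0 : forall a b c, uniq [:: a; b; c] -> x a b c != 0;
  ip_rel : forall i a b c d, uniq [:: i; a; b; c; d] ->
    q i a b c d + q i a c d b + q i a d b c = 0 }.

Hypothesis hp : init_plucker.

Lemma xcyc a b c : x b c a = x a b c.
Proof. by rewrite (ip_x23 hp) (ip_x12 hp) opprK. Qed.

Lemma init_termC12 i a b c d : q i b a c d = - q i a b c d.
Proof.
rewrite /q /min_term (ip_x23 hp i a b) (ip_w23 hp i a b) (ip_w23 hp i a d).
rewrite (ip_w23 hp i d b) (addrC (w i b c)) (addrC (w i d b)) andbC mulNr.
by case: ifP; rewrite ?oppr0.
Qed.

Lemma init_termC34 i a b c d : q i a b d c = - q i a b c d.
Proof.
rewrite /q /min_term (ip_x23 hp i c d) (ip_w23 hp i c d) (ip_w23 hp i b c) (ip_w23 hp i d b).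
by rewrite andbC mulrN; case: ifP; rewrite ?oppr0.
Qed.

Lemma init_termCC i a b c d : q i c d a b = q i a b c d.
Proof.
rewrite /q /min_term (mulrC (x i c d)) (addrC (w i c d)).
rewrite (ip_w23 hp i a c) (ip_w23 hp i d b) (addrC (w i c b)) (ip_w23 hp i b c).
by rewrite (ip_w23 hp i a d) .
Qed.

Lemma min_term_neq0 i a b c d : q i a b c d != 0 -> min_term i a b c d.
Proof. by rewrite /q; case: ifP; rewrite ?eqxx. Qed.

(** Some term attains the minimum, and it is nonzero since the entries of [x] are. The three terms
    sum to zero, so at least two of them survive. *)
Lemma init_term_eq0_or i a b c d : uniq [:: i; a; b; c; d] ->
  q i a b c d = 0 -> q i a c d b != 0.
Proof.
move=> U q0; have := ip_rel hp U; rewrite q0 add0r => q1.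
apply/eqP => q2; move: q1; rewrite q2 add0r => q3.
have nz e f : e \in [:: a; b; c; d] -> f \in [:: a; b; c; d] -> e != f ->
    x i e f != 0.
  move=> eI fI ef; apply: (ip_neq0 hp) => /=; rewrite !inE ef /= !andbT.
  case/andP: U => iN _; rewrite negb_or.
  by apply/andP; split; apply: contraNneq iN => ->.
have mf e f g h : q i e f g h = 0 -> uniq [:: e; f; g; h] ->
    {subset [:: e; f; g; h] <= [:: a; b; c; d]} -> min_term i e f g h = false.
  rewrite /q; case: ifP => // _ /eqP; rewrite mulf_eq0 /= !inE !negb_or.
  move=> H /and4P[/and3P[? ? ?] /andP[? ?] ? _] S; move: H.
  by rewrite !(negPf (nz _ _ _ _ _)) //; apply: S; rewrite !inE eqxx ?orbT.
move: U; rewrite /= !inE !negb_or => /and5P[_ /and3P[? ? ?] /andP[? ?] ? _].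
have m1 : min_term i a b c d = false.
  by apply: (mf) => //; distinct.
have m2 : min_term i a c d b = false.
  apply: mf => //; first by distinct.
  by move=> y; rewrite !inE; case/or4P=> ->; rewrite ?orbT.
have m3 : min_term i a d b c = false.
  apply: mf => //; first by distinct.
  by move=> y; rewrite !inE; case/or4P=> ->; rewrite ?orbT.
move: m1 m2 m3; rewrite /min_term.
set A := w i a b + w i c d; set B := w i a c + w i d b; set C := w i a d + _.
by case: (lerP A B); case: (lerP A C); case: (lerP B C); case: (lerP B A);
  case: (lerP C A); case: (lerP C B) => //=; lra.
Qed.

Lemma init_term_zero2 i a b c d : uniq [:: i; a; b; c; d] ->
  q i a b c d = 0 -> q i a d b c = 0 -> False.
Proof.
move=> U q0 q1; have U' : uniq [:: i; a; d; b; c].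
  move: U; rewrite /= !inE !negb_or => /and5P[/and4P[? ? ? ?]] /and3P[? ? ?].
  by case/andP=> ? ? ? _; distinct.
by move/eqP: (init_term_eq0_or U' q1); rewrite q0.
Qed.

(* The cherries at [a] and [b] force the cherry at [c]: the relation at [k]
   would otherwise have a unique minimal term. *)
Lemma init_term_cherry a b c k l : uniq [:: a; b; c; k; l] ->
  q a b c k l = 0 -> q b a c k l = 0 -> q c a b k l = 0.
Proof.
move=> U qa qb; rewrite /q; case: ifP => // mc; exfalso; move: U.
rewrite /= !inE !negb_or.
move=> /and5P[/and4P[? ? ? ?] /and3P[? ? ?] /andP[? ?] ? _].
have mf i e f g h : uniq [:: i; e; f; g; h] -> q i e f g h = 0 ->
    min_term i e f g h = false.
  rewrite /q; case: ifP => // _ + /eqP; rewrite mulf_eq0 /= !inE !negb_or.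
  move=> /and5P[/and4P[? ? ? ?] /and3P[? ? ?] /andP[? ?] ? _].
  by rewrite !(negPf (ip_neq0 hp _)) //; distinct.
have mt i e f g h : uniq [:: i; e; f; g; h] -> q i e f g h = 0 ->
    [/\ w i e f + w i g h > w i e g + w i h f
      & w i e g + w i h f = w i e h + w i f g].
  move=> U q0; have m := mf _ _ _ _ _ U q0.
  have q1 := init_term_eq0_or U q0.
  have q2 : q i e h f g != 0 by apply/eqP => /(init_term_zero2 U q0).
  move/negbT: m; rewrite /min_term negb_and -!ltNge.
  have /andP[] := min_term_neq0 q1; have /andP[] := min_term_neq0 q2.
  by move=> ? ? ? ? /orP[] ?; split; lra.
case: (mt a b c k l) => //; first by distinct.
case: (mt b a c k l) => //; first by distinct.
clear qa qb.
move: mc; rewrite /min_term => /andP[].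
have Uk : uniq [:: k; a; c; l; b] by distinct.
have := init_term_eq0_or Uk; rewrite {1}/q /min_term => H.
have {H} : (w k a c + w k l b <= w k a l + w k b c) &&
   (w k a c + w k l b <= w k a b + w k c l) = false -> min_term k a l b c.
  by move=> H'; apply/min_term_neq0/H; rewrite H'.
rewrite /min_term.
have w12 := ip_w12 hp; have w23 := ip_w23 hp.
have e1 : w k a b = w a b k by rewrite w12 w23.
have e2 : w k a c = w a c k by rewrite w12 w23.
have e3 : w k a l = w a k l by rewrite w12.
have e4 : w k b c = w b c k by rewrite w12 w23.
have e5 : w k l b = w b k l by rewrite w23 w12.
have e6 : w k c l = w c k l by rewrite w12.
have e7 : w k l c = w c k l by rewrite w23 w12.
have e8 : w k b a = w a b k by rewrite w23 w12 w23.
rewrite ?e1 ?e2 ?e3 ?e4 ?e5 ?e6 ?e7 ?e8.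
have f1 : w b a c = w a b c by rewrite w12.
have f2 : w c a b = w a b c by rewrite w12 w23.
have f3 : w b a k = w a b k by rewrite w12.
have f4 : w c a k = w a c k by rewrite w12.
have f5 : w a l c = w a c l by rewrite w23.
have f6 : w b l c = w b c l by rewrite w23.
have f7 : w c l b = w b c l by rewrite w23 w12.
have f8 : w c b k = w b c k by rewrite w12.
have f9 : w b a l = w a b l by rewrite w12.
have f10 : w c a l = w a c l by rewrite w12.
have f11 : w a c k = w a c k by [].
have f12 : w k c b = w b c k by rewrite w23 w12 w23.
rewrite ?f1 ?f2 ?f3 ?f4 ?f5 ?f6 ?f7 ?f8 ?f9 ?f10 ?f12.
move=> H h1 h2 [h3 h4] [h5 h6].
have g1 : w a b c + w c k l <= w a b k + w b c l by lra.
have /H /andP[h7 h8] : (w a c k + w b k l <= w a k l + w b c k) &&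
   (w a c k + w b k l <= w a b k + w c k l) = false.
  by apply/negbTE/negP => /andP[? ?]; lra.
lra.
Qed.

(** [v] holds logarithmic derivatives of the coordinates, hence the factor [v i a b + v i c d] on a
    product of two coordinates. It is symmetric although [x] alternates, because a sign does not
    affect a logarithmic derivative. *)
Record plucker_tangent (S : {set T}) (v : T -> T -> T -> F) : Prop :=
  PluckerTangent {
  pt_12 : forall a b c, v b a c = v a b c;
  pt_23 : forall a b c, v a c b = v a b c;
  pt_rel : forall i a b c d, uniq [:: i; a; b; c; d] ->
    {subset [:: i; a; b; c; d] <= S} ->
    q i a b c d * (v i a b + v i c d) + q i a c d b * (v i a c + v i d b)
    + q i a d b c * (v i a d + v i b c) = 0 }.

(** * Tangent vectors supported on the triples through one point *)

Section Deletion.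
Variables (V : {set T}) (j : T).
Hypothesis jV : j \notin V.

(* [u k l] stands for the value at the triple [j, k, l] of a tangent vector
   supported on the triples containing [j]. *)
Record link_tangent (u : T -> T -> F) : Prop := LinkTangent {
  lt_sym : forall k l, u l k = u k l;
  lt_supp : forall k l, u k l != 0 -> [/\ k \in V, l \in V & k != l];
  lt_row : forall i k l m, uniq [:: i; k; l; m] ->
    {subset [:: i; k; l; m] <= V} ->
    q i j k l m * u i k + q i j l m k * u i l + q i j m k l * u i m = 0;
  lt_star : forall k l m n, uniq [:: k; l; m; n] ->
    {subset [:: k; l; m; n] <= V} ->
    q j k l m n * (u k l + u m n) + q j k m n l * (u k m + u n l)
    + q j k n l m * (u k n + u l m) = 0 }.

Definition link_supp (u : T -> T -> F) : {set T} :=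
  [set k | [exists l, u k l != 0]].

Lemma link_suppP u k : reflect (exists l, u k l != 0) (k \in link_supp u).
Proof. by rewrite inE; apply: existsP. Qed.

Lemma link_supp0 u k l : k \notin link_supp u -> u k l = 0.
Proof.
by rewrite inE negb_exists => /forallP/(_ l); rewrite negbK => /eqP.
Qed.

Lemma link_supp_sub u : link_tangent u -> link_supp u \subset V.
Proof.
by move=> hu; apply/subsetP => k /link_suppP[l /(lt_supp hu)[]].
Qed.

Lemma link_tangent_lin c u1 u2 : link_tangent u1 -> link_tangent u2 ->
  link_tangent (fun k l => u2 k l + c * u1 k l).
Proof.
move=> h1 h2; split.
- by move=> k l; rewrite (lt_sym h1) (lt_sym h2).
- move=> k l; case: (eqVneq (u1 k l) 0) => [->|/(lt_supp h1)//].
  by rewrite mulr0 addr0 => /(lt_supp h2).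
- move=> i k l m U S; have := lt_row h1 U S; have := lt_row h2 U S.
  set a := q _ _ _ _ _; set b := q _ _ _ _ _; set d := q _ _ _ _ _ => e2 e1.
  by transitivity ((a * u2 i k + b * u2 i l + d * u2 i m) +
    c * (a * u1 i k + b * u1 i l + d * u1 i m)); [ring|rewrite e1 e2 mulr0 addr0].
- move=> k l m n U S; have := lt_star h1 U S; have := lt_star h2 U S.
  set a := q _ _ _ _ _; set b := q _ _ _ _ _; set d := q _ _ _ _ _ => e2 e1.
  transitivity ((a * (u2 k l + u2 m n) + b * (u2 k m + u2 n l) +
      d * (u2 k n + u2 l m)) +
    c * (a * (u1 k l + u1 m n) + b * (u1 k m + u1 n l) + d * (u1 k n + u1 l m))).
    by ring.
  by rewrite e1 e2 mulr0 addr0.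
Qed.

Lemma uniq_cons_j s : {subset s <= V} -> uniq s -> uniq (j :: s).
Proof. by move=> S /= ->; rewrite andbT; apply: contra jV => /S. Qed.

Lemma link_row0 u i k l m : link_tangent u -> uniq [:: i; k; l; m] ->
  {subset [:: i; k; l; m] <= V} -> u i l = 0 -> u i m = 0 -> u i k != 0 ->
  q i j k l m = 0.
Proof.
move=> hu U S ul um uk; have := lt_row hu U S.
by rewrite ul um !mulr0 !addr0 => /eqP; rewrite mulf_eq0 (negPf uk) orbF => /eqP.
Qed.

(** The rows at [k] and at [l] each reduce to the single unknown [u k l], which gives two cherries
    on the points [j, k, l, m, n]; [init_term_cherry] transports them to [j]. *)
Lemma link_cherry u k l m n : link_tangent u -> uniq [:: k; l; m; n] ->
  {subset [:: k; l; m; n] <= V} -> u k l != 0 ->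
  u k m = 0 -> u k n = 0 -> u l m = 0 -> u l n = 0 -> q j k l m n = 0.
Proof.
move=> hu U S ukl ukm ukn ulm uln.
have Uj := uniq_cons_j S U.
have q1 := link_row0 hu U S ukm ukn ukl.
have U' : uniq [:: l; k; m; n].
  by move: U; rewrite /= !inE !negb_or => /and4P[/and3P[? ? ?] /andP[? ?] ? _]; distinct.
have S' : {subset [:: l; k; m; n] <= V}.
  by move=> y yI; apply: S; move: yI; rewrite !inE => /or4P[]->; rewrite ?orbT.
have ulk : u l k != 0 by rewrite (lt_sym hu).
have q2 := link_row0 hu U' S' ulm uln ulk.
have q1' : q k l j m n = 0 by rewrite init_termC12 q1 oppr0.
have q2' : q l k j m n = 0 by rewrite init_termC12 q2 oppr0.
apply: (@init_term_cherry k l j m n) => //.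
move: Uj; rewrite /= !inE !negb_or.
by move=> /and5P[/and4P[? ? ? ?] /and3P[? ? ?] /andP[? ?] ? _]; distinct.
Qed.

Definition restrict_link (S : {set T}) (u : T -> T -> F) k l :=
  if (k \in S) && (l \in S) then u k l else 0.

(** With [u] seen as a weighted graph, [S] is a union of connected components. A row relation stays
    inside one component. In a star relation the only terms mixing the two sides pair an edge inside
    [S] with one outside, and their coefficient vanishes on nonzero edges by [link_cherry]. *)
Lemma link_tangent_restrict (S : {set T}) u : link_tangent u ->
  (forall k l, k \in S -> u k l != 0 -> l \in S) ->
  link_tangent (restrict_link S u).
Proof.
move=> hu cl; rewrite /restrict_link.
have z k l : k \in S -> l \notin S -> u k l = 0.
  by move=> kS lS; apply: contraNeq lS; apply: cl.
have z' k l : k \in S -> l \notin S -> u l k = 0.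
  by move=> kS lS; rewrite (lt_sym hu) z.
split.
- by move=> k l; rewrite andbC (lt_sym hu).
- by move=> k l; case: ifP => _; rewrite ?eqxx // => /(lt_supp hu).
- move=> i k l m U Sb; case: (boolP (i \in S)) => /= [iS|_]; last by rewrite !mulr0 !addr0.
  have e y : (if y \in S then u i y else 0) = u i y.
    by case: ifPn => // yS; rewrite z.
  by rewrite !e (lt_row hu).
- move=> k l m n U Sb.
  have ch a b c d : uniq [:: a; b; c; d] -> {subset [:: a; b; c; d] <= V} ->
     a \in S -> b \in S -> c \notin S -> d \notin S -> q j a b c d * u a b = 0.
    move=> U' S' aS bS cS dS; have [->|ab] := eqVneq (u a b) 0; first by rewrite mulr0.
    by rewrite (link_cherry hu U' S' ab) ?mul0r //; apply: z.
  move: U; rewrite /= !inE !negb_or => /and4P[/and3P[? ? ?] /andP[? ?] ? _].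
  have sb s : {subset s <= [:: k; l; m; n]} -> {subset s <= V}.
    by move=> h y /h /Sb.
  have s1 : {subset [:: k; m; n; l] <= V}.
    by apply: sb => y; rewrite !inE => /or4P[]->; rewrite ?orbT.
  have s2 : {subset [:: k; n; l; m] <= V}.
    by apply: sb => y; rewrite !inE => /or4P[]->; rewrite ?orbT.
  have s3 : {subset [:: m; n; k; l] <= V}.
    by apply: sb => y; rewrite !inE => /or4P[]->; rewrite ?orbT.
  have s4 : {subset [:: n; l; k; m] <= V}.
    by apply: sb => y; rewrite !inE => /or4P[]->; rewrite ?orbT.
  have s5 : {subset [:: l; m; k; n] <= V}.
    by apply: sb => y; rewrite !inE => /or4P[]->; rewrite ?orbT.
  have c1 := @ch k l m n ltac:(distinct) Sb.
  have c2 := @ch k m n l ltac:(distinct) s1.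
  have c3 := @ch k n l m ltac:(distinct) s2.
  have c4 := @ch m n k l ltac:(distinct) s3; rewrite init_termCC in c4.
  have c5 := @ch n l k m ltac:(distinct) s4; rewrite init_termCC in c5.
  have c6 := @ch l m k n ltac:(distinct) s5; rewrite init_termCC in c6.
  have e a b : u a b = if (a \in S) == (b \in S) then u a b else 0.
    case: ifPn => // ab; case: (boolP (a \in S)) ab => [aS|aS].
      by move=> bS; rewrite z //; apply: contra bS => ->.
    by rewrite eq_sym eqbF_neg negbK => bS; rewrite z'.
  have U' : uniq [:: k; l; m; n] by distinct.
  have := lt_star hu U' Sb.
  rewrite (e k l) (e m n) (e k m) (e n l) (e k n) (e l m).
  case: (boolP (k \in S)) c1 c2 c3 c4 c5 c6 => kS;
  case: (boolP (l \in S)) => lS; case: (boolP (m \in S)) => mS;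
  case: (boolP (n \in S)) => nS //= c1 c2 c3 c4 c5 c6;
  rewrite ?addr0 ?mulr0 ?add0r ?addr0 //;
  by first [rewrite c1 | rewrite c2 | rewrite c3 | rewrite c4 | rewrite c5 | rewrite c6].
Qed.

(** Minimality refers to the set of vertices met by [u], not to its set of edges. *)
Definition min_link (u : T -> T -> F) : Prop :=
  [/\ link_tangent u, link_supp u != set0 &
     forall u', link_tangent u' -> link_supp u' != set0 ->
       link_supp u' \subset link_supp u -> link_supp u' = link_supp u].

Lemma min_link_exists u : link_tangent u -> link_supp u != set0 ->
  exists2 u', min_link u' & link_supp u' \subset link_supp u.
Proof.
have [n] := ubnP #|link_supp u|; elim: n u => // n IH u le hu u0.
have [mu|nmu] := pselect (min_link u); first by exists u.
have [u' [hu' u'0 sub ne]] : exists u', [/\ link_tangent u',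
    link_supp u' != set0, link_supp u' \subset link_supp u &
    link_supp u' != link_supp u].
  apply: contrapT => H; apply: nmu; split=> // u' hu' u'0 sub.
  by apply/eqP; apply: contrapT => /negP ne; apply: H; exists u'.
have lt : (#|link_supp u'| < #|link_supp u|)%N.
  by apply: proper_card; rewrite properEneq ne.
case: (IH u') => // [|u'' mu'' sub'']; first exact: leq_trans lt _.
by exists u'' => //; apply: subset_trans sub'' sub.
Qed.

(** Connectedness of the graph of a minimal solution: restricting to a component would otherwise
    shrink the support. *)
Lemma min_link_closed u (S : {set T}) : min_link u -> S \subset link_supp u ->
  S != set0 -> (forall k l, k \in S -> u k l != 0 -> l \in S) ->
  S = link_supp u.
Proof.
move=> [hu _ mu] Su /set0Pn[k kS] cl.
have hr := link_tangent_restrict hu cl.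
have sr : link_supp (restrict_link S u) = S.
  apply/setP => y; apply/link_suppP/idP => [[l]|yS].
    by rewrite /restrict_link; case: ifP => [/andP[]|]; rewrite ?eqxx.
  have /link_suppP[l ul] := subsetP Su y yS.
  by exists l; rewrite /restrict_link yS (cl y l) .
rewrite -sr; apply: mu => //; rewrite sr //.
by apply/set0Pn; exists k.
Qed.

(* A row of a tangent vector that vanishes at some [i] is determined up to a
   scalar. *)
Lemma link_row_unique u1 u2 i k l m : link_tangent u1 -> link_tangent u2 ->
  i \in V -> k != i -> u1 k i = 0 -> u1 k l != 0 -> u2 k i = 0 -> u2 k l = 0 ->
  u2 k m = 0.
Proof.
move=> h1 h2 iV ki u1i u1l u2i u2l.
have [//|u2m] := eqVneq (u2 k m) 0.
have [kV lV kl] := lt_supp h1 u1l; have [_ mV km] := lt_supp h2 u2m.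
have li : l != i by apply: contraNneq u1l => ->; rewrite u1i.
have mi : m != i by apply: contraNneq u2m => ->; rewrite u2i.
have ml : m != l by apply: contraNneq u2m => ->; rewrite u2l.
have U : uniq [:: k; i; l; m] by distinct.
have S : {subset [:: k; i; l; m] <= V}.
  by move=> y; rewrite !inE => /or4P[]/eqP->.
have := lt_row h2 U S; rewrite u2i u2l !mulr0 !add0r => /eqP.
rewrite mulf_eq0 (negPf u2m) orbF => /eqP q0.
have := lt_row h1 U S; rewrite u1i q0 mul0r mulr0 add0r addr0 => /eqP.
rewrite mulf_eq0 (negPf u1l) orbF => /eqP q1.
have Uj : uniq [:: k; j; l; m; i].
  have := uniq_cons_j S U; rewrite /= !inE !negb_or.
  by move=> /and5P[/and4P[? ? ? ?] _ _ _ _]; distinct.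
by move/eqP: (init_term_eq0_or Uj q1); rewrite q0.
Qed.

(** Both vectors vanish at [i], so where [u2] is zero on an edge of [u], row uniqueness kills the
    whole row of [u2]. The vertices of [u] missed by [u2] are thus closed under adjacency, and [u]
    is connected. *)
Lemma min_link_disjoint u u2 i k l : min_link u -> link_tangent u2 ->
  i \in V -> i \notin link_supp u -> (forall m, u2 i m = 0) ->
  u k l != 0 -> u2 k l = 0 -> [disjoint link_supp u & link_supp u2].
Proof.
move=> mu h2 iV iu u2i ukl u2kl; have [hu _ _] := mu.
have ui m : u m i = 0 by rewrite (lt_sym hu) link_supp0.
have u2i' m : u2 m i = 0 by rewrite (lt_sym h2).
pose S := link_supp u :\: link_supp u2.
have key k' l' : u k' l' != 0 -> u2 k' l' = 0 -> k' \in S.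
  move=> un u2n; rewrite inE; apply/andP; split; last by apply/link_suppP; exists l'.
  apply/negP => /link_suppP[m]; apply/negP; rewrite negbK.
  have k'i : k' != i by apply: contraNneq un => ->; rewrite link_supp0.
  by rewrite (link_row_unique m hu h2 iV k'i (ui k') un).
suff <- : S = link_supp u by rewrite disjoint_sym disjoints_subset setCD subsetUr.
apply: min_link_closed => //; first exact: subsetDl.
  by apply/set0Pn; exists k; apply: key ukl u2kl.
move=> k' l'; rewrite inE => /andP[k2 _] un.
apply: (@key _ k'); first by rewrite (lt_sym hu).
by rewrite (lt_sym h2) link_supp0.
Qed.

Definition determined3 := exists e1 e2 e3 : T * T,
  forall u, link_tangent u -> u e1.1 e1.2 = 0 -> u e2.1 e2.2 = 0 ->
    u e3.1 e3.2 = 0 -> forall k l, u k l = 0.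

(** If some solution [u0] takes different values at [ik] and [il], these two coordinates suffice: a
    row vanishing there but not at [im] makes the coefficient of [im] zero, the two other
    coefficients are then opposite, and [u0] would agree at [ik] and [il]. Otherwise every row at
    [i] is constant off the diagonal and one coordinate is enough. *)
Lemma link_row_determined i : i \in V -> exists e1 e2 : T * T,
  forall u, link_tangent u -> u e1.1 e1.2 = 0 -> u e2.1 e2.2 = 0 ->
    forall m, u i m = 0.
Proof.
move=> iV.
have mem k l m : k \in V -> l \in V -> m \in V -> {subset [:: i; k; l; m] <= V}.
  by move=> ? ? ? y; rewrite !inE => /or4P[]/eqP->.
have [[k [l [u0 [h0 [[kV lV ki li kl] u0kl]]]]]|H] := pselect (exists k l u0,
   link_tangent u0 /\ [/\ k \in V, l \in V, i != k, i != l & k != l] /\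
   u0 i k != u0 i l).
  exists (i, k), (i, l) => u hu /= uk ul m; apply/eqP; apply: contrapT => /negP um.
  have [_ mV im] := lt_supp hu um.
  have mk : m != k by apply: contraNneq um => ->; rewrite uk.
  have ml : m != l by apply: contraNneq um => ->; rewrite ul.
  have U : uniq [:: i; m; k; l] by distinct.
  have S := mem m k l mV kV lV.
  have q0 := link_row0 hu U S uk ul um.
  have := lt_row h0 U S; rewrite q0 mul0r add0r.
  have Uj : uniq [:: i; j; m; k; l].
    have := uniq_cons_j S U; rewrite /= !inE !negb_or.
    by move=> /and5P[/and4P[? ? ? ?] _ _ _ _]; distinct.
  have := ip_rel hp Uj; rewrite q0 add0r => /eqP; rewrite addr_eq0 => /eqP qe.
  have := init_term_eq0_or Uj q0; rewrite qe oppr_eq0 => qn.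
  rewrite mulNr addrC -mulrBr => /eqP; rewrite mulf_eq0 (negPf qn) /= subr_eq0.
  by rewrite eq_sym (negPf u0kl).
case: (pickP [pred k | (k \in V) && (k != i)]) => [k /andP[kV ki]|V0].
  exists (i, k), (i, k) => u hu /= uk _ m; apply/eqP; apply: contrapT => /negP um.
  have [_ mV im] := lt_supp hu um.
  apply: H; exists k, m, u; split=> //; split; last by rewrite uk eq_sym.
  split=> //; first by rewrite eq_sym.
  by apply: contraNneq um => <-; rewrite uk.
exists (i, i), (i, i) => u hu _ _ m; apply/eqP; apply: contrapT => /negP um.
by have [_ mV im] := lt_supp hu um; have := V0 m; rewrite /= mV eq_sym im.
Qed.

Lemma nonzero_supp u k l : u k l != 0 -> link_supp u != set0.
Proof. by move=> ukl; apply/set0Pn; exists k; apply/link_suppP; exists l. Qed.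

(** Two of the three coordinates are spent on the row at [i]; the third may be imposed at any
    [e]. *)
Lemma not_determined3 (nd : ~ determined3) i (e : T * T) : i \in V ->
  exists u, [/\ link_tangent u, link_supp u != set0, i \notin link_supp u &
    u e.1 e.2 = 0].
Proof.
move=> iV; have [e1 [e2 det]] := link_row_determined iV.
apply: contrapT => H; apply: nd; exists e1, e2, e => u hu u1 u2 u3 k l.
apply/eqP; apply: contrapT => /negP ukl; apply: H; exists u.
split=> //; first exact: nonzero_supp ukl.
by apply/negP => /link_suppP[m]; rewrite det // eqxx.
Qed.

(** [uB] comes from a solution that avoids [i], as [uA] does, and vanishes on an edge of [uA]; [uC]
    from one that avoids a vertex [i'] of [uA] and vanishes on an edge of [uB]. Thus
    [min_link_disjoint] separates [uA] from [uB] and [uB] from [uC]; the pair [uA], [uC] needs an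
    elimination. *)
Lemma disjoint_min_links : ~ determined3 ->
  exists uA uB uC, [/\ min_link uA, min_link uB & min_link uC] /\
    [/\ [disjoint link_supp uA & link_supp uB],
        [disjoint link_supp uA & link_supp uC] &
        [disjoint link_supp uB & link_supp uC]].
Proof.
move=> nd.
have dsub (A B B' : {set T}) : [disjoint A & B] -> B' \subset B -> [disjoint A & B'].
  by move=> d s; apply: disjointWr s d.
have edge u : min_link u -> exists e : T * T, u e.1 e.2 != 0.
  by move=> [_ /set0Pn[k /link_suppP[l ukl]] _]; exists (k, l).
have [i iV] : exists i, i \in V.
  apply: contrapT => H; apply: nd.
  have V0 : forall i, i \in V -> False by move=> i iV; apply: H; exists i.
  exists (j, j), (j, j), (j, j) => u hu _ _ _ k l; apply/eqP.
  by apply: contrapT => /negP /(lt_supp hu)[/V0].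
have row0 u k m : k \notin link_supp u -> u k m = 0 by move=> /link_supp0->.
have [u1 [h1 n1 i1 _]] := not_determined3 nd (i, i) iV.
have [uA mA sA] := min_link_exists h1 n1.
have iA : i \notin link_supp uA by apply: contra i1; apply: (subsetP sA).
have [eA neA] := edge _ mA.
have [u2 [h2 n2 i2 z2]] := not_determined3 nd eA iV.
have dA2 := min_link_disjoint mA h2 iV iA (row0 u2 i ^~ i2) neA z2.
have [uB mB sB] := min_link_exists h2 n2.
have dAB := dsub _ _ _ dA2 sB.
have [hA /set0Pn[i' i'A] minA] := mA.
have i'V : i' \in V by apply: (subsetP (link_supp_sub hA)).
have i'B : i' \notin link_supp uB by rewrite (disjointFr dAB).
have [eB neB] := edge _ mB.
have [u3 [h3 n3 i3 z3]] := not_determined3 nd eB i'V.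
have dB3 := min_link_disjoint mB h3 i'V i'B (row0 u3 i' ^~ i3) neB z3.
have [uC mC sC] := min_link_exists h3 n3.
have dBC := dsub _ _ _ dB3 sC.
have i'C : i' \notin link_supp uC by apply: contra i3; apply: (subsetP sC).
exists uA, uB, uC; split=> //; split=> //.
have [hB /set0Pn[b bB] _] := mB.
have bV : b \in V by apply: (subsetP (link_supp_sub hB)).
have bA : b \notin link_supp uA by rewrite (disjointFl dAB).
have bC : b \notin link_supp uC by rewrite (disjointFr dBC).
apply/negbNE/negP => /pred0Pn[k /= /andP[kA kC]].
have [l kl] := link_suppP _ _ kA.
have [hC nC minC] := mC.
(* At a common vertex [k], an edge [kl] of [uA] is cancelled. The combination [uD] still avoids [b],
   hence is disjoint from [uA]. If it is zero, [uC] is a multiple of [uA], although it avoids [i'];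
   if not, its support lies in that of [uC] and misses [k], against minimality. *)
pose c := - (uC k l / uA k l).
have hD := link_tangent_lin c hA hC.
set uD := fun k l => _ in hD.
have D0 : uD k l = 0 by rewrite /uD /c mulNr divfK ?subrr.
have bD m : uD b m = 0 by rewrite /uD !row0 // mulr0 addr0.
have dAD := min_link_disjoint mA hD bV bA bD kl D0.
have [D00|nD] := eqVneq (link_supp uD) set0.
  have uDz y m : uD y m = 0 by rewrite row0 // D00 inE.
  have [m i'm] := link_suppP _ _ i'A.
  have := uDz i' m; rewrite /uD row0 // add0r => /eqP.
  rewrite mulf_eq0 (negPf i'm) orbF => /eqP c0.
  have [m' km'] := link_suppP _ _ kC.
  have := uDz k m'; rewrite /uD c0 mul0r addr0 => e.
  by rewrite e eqxx in km'.
have subD : link_supp uD \subset link_supp uC.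
  apply/subsetP => y yD; have yA : y \notin link_supp uA by rewrite (disjointFl dAD).
  have [m ym] := link_suppP _ _ yD; apply/link_suppP; exists m.
  by apply: contraNneq ym => e; rewrite /uD e add0r row0 ?mulr0.
have := minC _ hD nD subD => eD.
by have := disjointFr dAD kA; rewrite eD kC.
Qed.

End Deletion.

(** These are the coefficients with which the unknown at [abc] enters the linearised relations on
    [S]; when they all vanish, that unknown is unconstrained. *)
Definition free_triple (S : {set T}) a b c : Prop :=
  forall k l, k \in S -> l \in S -> uniq [:: a; b; c; k; l] ->
    [/\ q a b c k l = 0, q b a c k l = 0 & q c a b k l = 0].

Lemma free12 (S : {set T}) a b c : free_triple S a b c -> free_triple S b a c.
Proof.
move=> h k l kS lS U; have [] := h k l kS lS.
  move: U; rewrite /= !inE !negb_or.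
  by move=> /and5P[/and4P[? ? ? ?] /and3P[? ? ?] /andP[? ?] ? _]; distinct.
by move=> -> -> e; split=> //; rewrite init_termC12 e oppr0.
Qed.

Lemma free23 (S : {set T}) a b c : free_triple S a b c -> free_triple S a c b.
Proof.
move=> h k l kS lS U; have [] := h k l kS lS.
  move: U; rewrite /= !inE !negb_or.
  by move=> /and5P[/and4P[? ? ? ?] /and3P[? ? ?] /andP[? ?] ? _]; distinct.
by move=> e e' e''; split=> //; rewrite init_termC12 ?e ?e' ?e'' oppr0.
Qed.

Lemma free_rot (S : {set T}) a b c : free_triple S a b c -> free_triple S b c a.
Proof. by move=> h; apply/free23/free12. Qed.

(** With a fifth point [k], the relation at [a] on [b, c, d, k] would lose the terms [bc|dk] and
    [bd|ck], whereas at least two terms survive. *)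
Lemma free_share (S : {set T}) a b c d : (4 < #|S|)%N -> uniq [:: a; b; c; d] ->
  c \in S -> d \in S ->
  free_triple S a b c -> free_triple S a b d -> False.
Proof.
move=> S4 U cS dS h1 h2.
have [k kS kn] : exists2 k, k \in S & k \notin [:: a; b; c; d].
  apply: contrapT => H; move: S4; rewrite ltnNge => /negP; apply.
  apply: leq_trans (card_size [:: a; b; c; d]); apply: subset_leq_card.
  by apply/subsetP => y yS; apply: contrapT => /negP yn; apply: H; exists y.
move: U kn; rewrite /= !inE !negb_or.
move=> /and4P[/and3P[? ? ?] /andP[? ?] ? _] /and4P[? ? ? ?].
have [e1 _ _] := h1 d k dS kS ltac:(distinct).
have [e2 _ _] := h2 c k cS kS ltac:(distinct).
have := @init_term_eq0_or a b c d k ltac:(distinct) e1.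
by rewrite init_termC34 e2 oppr0 eqxx.
Qed.

(** Losing the term [bc|kl], the initial form at [a] becomes a binomial. [free_binomial] is its
    multiplicative form at the point [x], and [free_tangent] its logarithmic derivative, whose
    coefficients are integers independent of [x]. *)
Lemma free_min_term (S : {set T}) a b c k l : k \in S -> l \in S ->
  uniq [:: a; b; c; k; l] -> free_triple S a b c ->
  q a b k l c + q a b l c k = 0 /\ q a b k l c != 0.
Proof.
move=> kS lS U h; have [e _ _] := h k l kS lS U.
by have := ip_rel hp U; rewrite e add0r => e'; split=> //; apply: init_term_eq0_or.
Qed.

Lemma free_binomial (S : {set T}) a b c k l : k \in S -> l \in S ->
  uniq [:: a; b; c; k; l] -> free_triple S a b c ->
  x a b k * x a c l = x a b l * x a c k.
Proof.
move=> kS lS U h; have [e n] := free_min_term kS lS U h.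
have n' : q a b l c k != 0.
  by apply: contraNneq n => e'; rewrite e' addr0 in e; rewrite e.
move: e; rewrite /q (min_term_neq0 n) (min_term_neq0 n') (ip_x23 hp a c l) => /eqP.
by rewrite mulrN addrC subr_eq0 => /eqP.
Qed.

Lemma free_tangent (S : {set T}) v a b c k l : plucker_tangent S v ->
  a \in S -> b \in S -> c \in S -> k \in S -> l \in S ->
  uniq [:: a; b; c; k; l] -> free_triple S a b c ->
  v a b k + v a c l = v a b l + v a c k.
Proof.
move=> hv aS bS cS kS lS U h; have [e n] := free_min_term kS lS U h.
have [e0 _ _] := h k l kS lS U.
have /(pt_rel hv U) : {subset [:: a; b; c; k; l] <= S}.
  by move=> y; rewrite !inE => /orP[/eqP->//|/or4P[]/eqP->].
rewrite e0 mul0r add0r; move/eqP: e; rewrite addrC addr_eq0 => /eqP ->.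
rewrite mulNr -mulrBr => /eqP; rewrite mulf_eq0 (negPf n) /= subr_eq0 => /eqP.
by rewrite (pt_23 hv a c l).
Qed.

(** * Two-point supports, free triples and partners *)

Section FreePairs.
Variables (V : {set T}) (j : T).
Hypothesis jV : j \notin V.
Local Notation S := (j |: V).

(** In each relation through the edge [ab] the value [u a b] is the only nonzero unknown, so its
    coefficient is zero. *)
Lemma free_of_link u a b : link_tangent V j u -> link_supp u = [set a; b] ->
  a != b -> free_triple S j a b.
Proof.
move=> hu su ab.
have z y m : y \notin [set a; b] -> u y m = 0 by rewrite -su => /link_supp0.
have z' y m : y \notin [set a; b] -> u m y = 0 by move=> yn; rewrite (lt_sym hu) z.
have uab : u a b != 0.
  have : a \in link_supp u by rewrite su !inE eqxx.
  move/link_suppP=> [y uy]; have : y \in [set a; b].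
    by apply: contraNT uy => yn; rewrite z'.
  rewrite !inE => /orP[]/eqP e; move: uy; rewrite e //.
  by have := lt_supp hu (k := a) (l := a); rewrite eqxx; case: eqP => // _ /(_ isT)[].
have [aV bV _] := lt_supp hu uab.
move=> k l; rewrite !inE => kS lS; rewrite /= !inE !negb_or.
move=> /and5P[/and4P[? ? ? ?] /and3P[? ? ?] /andP[? ?] ? _].
have kj : k != j by distinct.
have lj : l != j by distinct.
rewrite (negPf kj) in kS; rewrite (negPf lj) in lS.
have mem c d : c \in V -> d \in V -> {subset [:: c; d; k; l] <= V}.
  by move=> ? ? y; rewrite !inE => /or4P[]/eqP->.
have kn : k \notin [set a; b] by rewrite !inE negb_or; distinct.
have ln : l \notin [set a; b] by rewrite !inE negb_or; distinct.
split.
- by apply: (link_cherry jV hu _ (mem _ _ aV bV) uab) => //;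
    first [distinct | rewrite z'].
- by apply: (link_row0 hu _ (mem _ _ aV bV)) => //; first [distinct | rewrite z'].
- apply: (link_row0 hu _ (mem _ _ bV aV)) => //;
    by first [distinct | rewrite (lt_sym hu) // uab | rewrite z'].
Qed.

Definition pair_link a b : T -> T -> F :=
  fun k l => (((k == a) && (l == b)) || ((k == b) && (l == a)))%:R.

Lemma pair_linkP a b k l : reflect ((k = a /\ l = b) \/ (k = b /\ l = a))
  (pair_link a b k l != 0).
Proof.
rewrite pnatr_eq0 eqb0 negbK.
by apply: (iffP orP) => -[/andP[/eqP-> /eqP->]|/andP[/eqP-> /eqP->]]
  || (apply: (iffP orP) => [[/andP[/eqP-> /eqP->]|/andP[/eqP-> /eqP->]]|
   [[-> ->]|[-> ->]]]; rewrite ?eqxx; auto).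
Qed.

(** Converse of [free_of_link]. It serves to show that no pair inside a larger minimal support is
    free. *)
Lemma pair_link_tangent a b : a \in V -> b \in V -> a != b ->
  free_triple S j a b -> link_tangent V j (pair_link a b).
Proof.
move=> aV bV ab h.
have row i k l m : uniq [:: i; k; l; m] -> {subset [:: i; k; l; m] <= V} ->
    q i j k l m * pair_link a b i k = 0.
  move=> U Sb; have lS : l \in S by rewrite inE Sb ?orbT // !inE eqxx !orbT.
  have mS : m \in S by rewrite inE Sb ?orbT // !inE eqxx !orbT.
  have := uniq_cons_j jV Sb U; rewrite /= !inE !negb_or.
  move=> /and5P[/and4P[? ? ? ?] /and3P[? ? ?] /andP[? ?] ? _].
  have [->|/pair_linkP[] [? ?]] := eqVneq (pair_link a b i k) 0; first by rewrite mulr0.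
    by subst; have [_ -> _] := h l m lS mS ltac:(distinct); rewrite mul0r.
  by subst; have [_ _ ->] := h l m lS mS ltac:(distinct); rewrite mul0r.
have star k l m n : uniq [:: k; l; m; n] -> {subset [:: k; l; m; n] <= V} ->
    q j k l m n * pair_link a b k l = 0.
  move=> U Sb; have lS : m \in S by rewrite inE Sb ?orbT // !inE eqxx !orbT.
  have mS : n \in S by rewrite inE Sb ?orbT // !inE eqxx !orbT.
  have := uniq_cons_j jV Sb U; rewrite /= !inE !negb_or.
  move=> /and5P[/and4P[? ? ? ?] /and3P[? ? ?] /andP[? ?] ? _].
  have [->|/pair_linkP[] [? ?]] := eqVneq (pair_link a b k l) 0; first by rewrite mulr0.
    by subst; have [-> _ _] := h m n lS mS ltac:(distinct); rewrite mul0r.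
  subst; have [e _ _] := h m n lS mS ltac:(distinct).
  by rewrite init_termC12 e oppr0 mul0r.
split.
- by move=> k l; rewrite /pair_link orbC (andbC (l == b)) (andbC (l == a)).
- by move=> k l /pair_linkP[] [-> ->]; split=> //; rewrite eq_sym.
- move=> i k l m U Sb; move: (U); rewrite /= !inE !negb_or.
  move=> /and4P[/and3P[? ? ?] /andP[? ?] ? _].
  rewrite !row ?addr0 //; try distinct;
  by move=> y yI; apply: Sb; move: yI; rewrite !inE => /or4P[]->; rewrite ?orbT.
- move=> k l m n U Sb; move: (U); rewrite /= !inE !negb_or.
  move=> /and4P[/and3P[? ? ?] /andP[? ?] ? _].
  rewrite !mulrDr star // -(init_termCC j k l) star; try distinct.
  rewrite star; try distinct.
  rewrite -(init_termCC j k m) star; try distinct.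
  rewrite star; try distinct.
  rewrite -(init_termCC j k n) star; try distinct.
  by rewrite !addr0.
  all: by move=> y yI; apply: Sb; move: yI; rewrite !inE => /or4P[]->; rewrite ?orbT.
Qed.

Lemma card_link_supp u : link_tangent V j u -> link_supp u != set0 ->
  (1 < #|link_supp u|)%N.
Proof.
move=> hu /set0Pn[k kU]; have [l ukl] := link_suppP _ _ kU.
have [_ _ kl] := lt_supp hu ukl.
rewrite (cardsD1 k) kU ltnS; apply/card_gt0P; exists l.
by rewrite in_setD1 eq_sym kl; apply/link_suppP; exists k; rewrite (lt_sym hu).
Qed.

Lemma link_partner u y : link_tangent V j u -> #|link_supp u| = 2%N ->
  y \in link_supp u ->
  exists2 y', y' \in link_supp u :\ y & free_triple S j y y'.
Proof.
move=> hu c2 yU; move: c2; rewrite (cardsD1 y) yU => -[] /eqP /cards1P[y' e].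
exists y'; first by rewrite e set11.
apply: (free_of_link hu); first by rewrite -(setD1K yU) e.
by have := set11 y'; rewrite -e in_setD1 eq_sym => /andP[].
Qed.

Lemma card_disjointU3 (A B C : {set T}) : [disjoint A & B] ->
  [disjoint A & C] -> [disjoint B & C] ->
  #|A :|: B :|: C| = (#|A| + #|B| + #|C|)%N.
Proof.
rewrite -!setI_eq0 => /eqP AB /eqP AC /eqP BC.
by rewrite !cardsU AB setIUl AC BC setU0 cards0 !subn0.
Qed.

(** A support contains both ends of an edge, so three disjoint ones require six points. *)
Lemma determined3_small : (#|V| <= 5)%N -> determined3 V j.
Proof.
move=> V5; apply: contrapT => /(disjoint_min_links jV).
move=> [uA [uB [uC [[[hA nA _] [hB nB _] [hC nC _]] [dAB dAC dBC]]]]].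
have cA := card_link_supp hA nA; have cB := card_link_supp hB nB.
have cC := card_link_supp hC nC.
have : (#|link_supp uA :|: link_supp uB :|: link_supp uC| <= 5)%N.
  by apply: leq_trans (subset_leq_card _) V5; rewrite !subUset !(link_supp_sub (j := j)).
by rewrite card_disjointU3 // => /(sum3_le6 cA cB cC)/(_ isT)[].
Qed.

(** Six points leave room only for three pairs, and these partition [V]. *)
Lemma determined3_partner6 : #|V| = 6%N -> ~ determined3 V j ->
  forall y, y \in V -> exists2 y', y' \in V :\ y & free_triple S j y y'.
Proof.
move=> V6 /(disjoint_min_links jV).
move=> [uA [uB [uC [[[hA nA _] [hB nB _] [hC nC _]] [dAB dAC dBC]]]]] y yV.
have cA := card_link_supp hA nA; have cB := card_link_supp hB nB.
have cC := card_link_supp hC nC.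
have sA := link_supp_sub hA; have sB := link_supp_sub hB; have sC := link_supp_sub hC.
set U := link_supp uA :|: link_supp uB :|: link_supp uC.
have UV : U \subset V by rewrite !subUset sA sB.
have cU : #|U| = (#|link_supp uA| + #|link_supp uB| + #|link_supp uC|)%N.
  exact: card_disjointU3.
have leU := subset_leq_card UV.
rewrite V6 cU in leU; have [_ [a2 [b2 c2]]] := sum3_le6 cA cB cC leU isT.
have eU : U = V by apply/eqP; rewrite eqEcard UV V6 cU a2 b2 c2.
have fin u : link_tangent V j u -> link_supp u \subset V -> #|link_supp u| = 2%N ->
    y \in link_supp u -> exists2 y', y' \in V :\ y & free_triple S j y y'.
  move=> hu su cu yu; have [y' y'u fy] := link_partner hu cu yu.
  exists y' => //.
  by move: y'u; rewrite !in_setD1 => /andP[-> /(subsetP su) ->].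
have : y \in U by rewrite eU.
move=> /setUP[/setUP[]|] yI.
- by apply: (fin uA).
- by apply: (fin uB).
- by apply: (fin uC).
Qed.

(** The three disjoint supports have sizes 2, 2, 2, leaving one point [z] over, or 2, 2, 3,
    exhausting [V]. *)
Lemma determined3_partner7 : #|V| = 7%N -> ~ determined3 V j ->
  (exists2 z, z \in V & forall y, y \in V :\ z ->
     exists2 y', y' \in V :\ z :\ y & free_triple S j y y') \/
  (exists u, [/\ min_link V j u, #|link_supp u| = 3%N & forall y,
     y \in V :\: link_supp u ->
     exists2 y', y' \in (V :\: link_supp u) :\ y & free_triple S j y y']).
Proof.
move=> V7 /(disjoint_min_links jV).
move=> [uA [uB [uC [[mA mB mC] [dAB dAC dBC]]]]].
(* At least two of the three supports are pairs, by [sum3_le7]; they are put first. *)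
wlog cC' : uA uB uC mA mB mC dAB dAC dBC /
    (#|link_supp uA| = 2)%N /\ (#|link_supp uB| = 2)%N.
  move=> H; have [hA nA _] := mA; have [hB nB _] := mB; have [hC nC _] := mC.
  have cA := card_link_supp hA nA; have cB := card_link_supp hB nB.
  have cC := card_link_supp hC nC.
  have sA := link_supp_sub hA; have sB := link_supp_sub hB; have sC := link_supp_sub hC.
  set U := link_supp uA :|: link_supp uB :|: link_supp uC.
  have UV : U \subset V by rewrite !subUset sA sB.
  have cU : #|U| = (#|link_supp uA| + #|link_supp uB| + #|link_supp uC|)%N.
    exact: card_disjointU3.
  have leU := subset_leq_card UV.
  rewrite V7 cU in leU; have [[a2 b2]|[[a2 c2]|[b2 c2]]] := sum3_le7 cA cB cC leU.
  - exact: (H uA uB uC).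
  - by apply: (H uA uC uB) => //; rewrite disjoint_sym.
  - by apply: (H uB uC uA) => //; rewrite disjoint_sym.
have [c2A c2B] := cC'.
have [hA nA _] := mA; have [hB nB _] := mB; have [hC nC _] := mC.
have cC := card_link_supp hC nC.
have sA := link_supp_sub hA; have sB := link_supp_sub hB; have sC := link_supp_sub hC.
set U := link_supp uA :|: link_supp uB :|: link_supp uC.
have UV : U \subset V by rewrite !subUset sA sB.
have cU : #|U| = (2 + 2 + #|link_supp uC|)%N.
  by rewrite card_disjointU3 // c2A c2B.
have leU := subset_leq_card UV.
have fin u (W : {set T}) y : link_tangent V j u -> link_supp u \subset W ->
    #|link_supp u| = 2%N -> y \in link_supp u ->
    exists2 y', y' \in W :\ y & free_triple S j y y'.
  move=> hu su cu yu; have [y' y'u fy] := link_partner hu cu yu.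
  exists y' => //.
  by move: y'u; rewrite !in_setD1 => /andP[-> /(subsetP su) ->].
rewrite V7 cU in leU.
have [c3|c3] := eqVneq #|link_supp uC| 3%N.
  have eU : U = V by apply/eqP; rewrite eqEcard UV V7 cU c3.
  right; exists uC; split=> // y /setDP[yV yC].
  have : y \in U by rewrite eU.
  move=> /setUP[/setUP[]|] yI; last by rewrite yI in yC.
    by apply: (fin uA) => //; rewrite subsetD sA.
  by apply: (fin uB) => //; rewrite subsetD sB.
have cC2 : #|link_supp uC| = 2%N.
  by apply/eqP; rewrite eqn_leq cC andbT -ltnS ltn_neqAle c3.
have : #|V :\: U| = 1%N by rewrite cardsD (setIidPr UV) V7 cU cC2.
move/eqP/cards1P=> [z ez].
have Vz : V :\ z = U by rewrite -ez setDDr setDv set0U; apply/setIidPr.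
left; exists z; first by have := set11 z; rewrite -ez => /setDP[].
rewrite Vz => y /setUP[/setUP[]|] yI.
- by apply: (fin uA) => //; rewrite /U -setUA subsetUl.
- by apply: (fin uB) => //; rewrite /U setUAC subsetUr.
- by apply: (fin uC) => //; rewrite /U subsetUr.
Qed.

End FreePairs.

Lemma x321 a b c : x c b a = - x a b c.
Proof. by rewrite (ip_x12 hp) xcyc. Qed.

Lemma xcyc2 a b c : x c a b = x a b c.
Proof. by rewrite -(xcyc a b c) -(xcyc b c a). Qed.

Lemma exists_notin (S : {set T}) (s : seq T) : (size s < #|S|)%N ->
  exists2 y, y \in S & y \notin s.
Proof.
move=> S4; apply: contrapT => H; move: S4; rewrite ltnNge => /negP; apply.
apply: leq_trans (card_size s); apply: subset_leq_card.
by apply/subsetP => y yS; apply: contrapT => /negP yn; apply: H; exists y.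
Qed.

Lemma mem_all_of_card (S : {set T}) (s : seq T) y : uniq s ->
  {subset s <= S} -> (#|S| <= size s)%N -> y \in S -> y \in s.
Proof.
move=> U sub le; have ss : [set z in s] \subset S by apply/subsetP => z; rewrite inE => /sub.
have := geq_leqif (subset_leqif_cards ss).
rewrite cardsE (card_uniqP U) le => /esym/eqP <-.
by rewrite inE.
Qed.

Ltac mem_tac := solve [assumption | rewrite inE; done].
Ltac share_with S4 A B := solve [apply: (free_share S4 _ _ _ A B); first [mem_tac | distinct]].
Ltac share_pair S4 A B :=
  let tA := type of A in let tB := type of B in
  match tA with free_triple _ ?a ?b _ =>
    match tB with
    | free_triple _ a b _ => share_with S4 A B
    | free_triple _ b a _ => share_with S4 A (free12 B)
    | free_triple _ a _ b => share_with S4 A (free23 B)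
    | free_triple _ b _ a => share_with S4 A (free_rot (free_rot B))
    | free_triple _ _ a b => share_with S4 A (free_rot B)
    | free_triple _ _ b a => share_with S4 A (free12 (free_rot B))
    end end.
(** Tries the rotations of the first triple until its leading two points are found in the second, in
    any position, and concludes by [free_share]. *)
Ltac share S4 H1 H2 :=
  exfalso; first [ share_pair S4 H1 H2 | share_pair S4 (free_rot H1) H2
                 | share_pair S4 (free_rot (free_rot H1)) H2 ].
Ltac share_any S4 H := match goal with f : free_triple _ _ _ _ |- _ => share S4 H f end.

(** * Seven points: the Fano plane *)

Section Seven.
Variable (S : {set T}).
Hypothesis S7 : #|S| = 7%N.
Let S4 : (4 < #|S|)%N. Proof. by rewrite S7. Qed.

(* The seven three-term binomials of a Fano configuration multiply to the
   relation [m = - m]. *)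
Lemma no_fano j a a' b b' c c' : uniq [:: j; a; a'; b; b'; c; c'] ->
  {subset [:: j; a; a'; b; b'; c; c'] <= S} ->
  free_triple S j a a' -> free_triple S j b b' -> free_triple S j c c' ->
  free_triple S a b c -> free_triple S a b' c' -> free_triple S a' b c' ->
  free_triple S a' b' c -> False.
Proof.
move=> U sub f1 f2 f3 f4 f5 f6 f7.
have mem y : y \in [:: j; a; a'; b; b'; c; c'] -> y \in S by exact: sub.
have [jS aS a'S] : [/\ j \in S, a \in S & a' \in S].
  by split; apply: mem; rewrite !inE eqxx ?orbT.
have [bS b'S] : b \in S /\ b' \in S by split; apply: mem; rewrite !inE eqxx ?orbT.
have [cS c'S] : c \in S /\ c' \in S by split; apply: mem; rewrite !inE eqxx ?orbT.
move: U; rewrite /= !inE !negb_or => /and5P[/and5P[? ? ? ? /andP[? ?]]].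
move=> /and5P[? ? ? ? ?] /and4P[? ? ? ?] /and3P[? ? ?] /and3P[/andP[? ?] ? _].
have e0 : x j a b * x j a' b' = x j a b' * x j a' b.
  by apply: (free_binomial _ _ _ f1) => //; distinct.
have e1 : x j a b * x j a' c = x j a c * x j a' b.
  by apply: (free_binomial _ _ _ f1) => //; distinct.
have e2 : x j c a * x j c' b = x j c b * x j c' a.
  by apply: (free_binomial _ _ _ f3) => //; distinct.
have e3 : x a b' j * x a c' b = x a b' b * x a c' j.
  by apply: (free_binomial _ _ _ f5) => //; distinct.
have e4 : x a' b' j * x a' c b = x a' b' b * x a' c j.
  by apply: (free_binomial _ _ _ f7) => //; distinct.
have e5 : x b j a * x b b' a' = x b j a' * x b b' a.
  by apply: (free_binomial _ _ _ (free12 f2)) => //; distinct.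
have e6 : x b c j * x b a a' = x b c a' * x b a j.
  by apply: (free_binomial _ _ _ (free_rot f4)) => //; distinct.
have e7 : x b a' j * x b c' a = x b a' a * x b c' j.
  by apply: (free_binomial _ _ _ (free12 f6)) => //; distinct.
rewrite ?(ip_x23 hp j a c) ?(ip_x23 hp j b c) ?(ip_x23 hp j a c') ?(ip_x23 hp j b c') ?(xcyc j a b') ?(ip_x23 hp a b b') ?(xcyc j a c') ?(ip_x23 hp a b c') ?(xcyc j a' b') ?(ip_x23 hp a' b b') ?(xcyc j a' c) ?(ip_x23 hp a' b c) ?(xcyc2 j a b) ?(xcyc2 j a' b) ?(x321 j a b) ?(xcyc2 a a' b) ?(x321 j a' b) ?(x321 a a' b) ?(xcyc a b b') ?(xcyc a' b b') ?(xcyc j b c) ?(xcyc a' b c) ?(xcyc j b c') ?(xcyc a b c') in e0 e1 e2 e3 e4 e5 e6 e7.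
(* Once the indices are sorted, the product of the eight equations, with [e0] and [e3] reversed, has
   these sixteen factors on both sides and opposite signs. *)
set m := x j a b' * x j a' b * x j a' b * x j a b * x j a b * x j a' c * x j a c * x j b c' * x a b b' * x j a c' * x j a' b' * x a' b c * x a' b b' * x j b c * x a a' b * x a b c'.
have m0 : m != 0.
  by rewrite /m; repeat apply: mulf_neq0; apply: (ip_neq0 hp); distinct.
have := f_equal2 *%R (esym e0) (f_equal2 *%R e1 (f_equal2 *%R e2
  (f_equal2 *%R (esym e3) (f_equal2 *%R e4 (f_equal2 *%R e5
  (f_equal2 *%R e6 e7)))))).
move/eqP; rewrite -subr_eq0 => /eqP E.
have : m *+ 2 = 0 by rewrite -oppr0 -E /m; ring.
by move/eqP; rewrite mulrn_eq0 (negPf m0).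
Qed.

Hypothesis H : forall j y, j \in S -> y \in S -> y != j ->
  exists y', [/\ y' \in S, y' != j, y' != y & free_triple S j y y'].

(** By [H] each of the pairs [ab'], [a'b], [a'b'] extends to a free triple. Every candidate third
    point but one would produce two free triples with two common points, so the three missing lines
    are forced. *)
Lemma fano_of_partners j a a' b b' c c' : uniq [:: j; a; a'; b; b'; c; c'] ->
  {subset [:: j; a; a'; b; b'; c; c'] <= S} ->
  free_triple S j a a' -> free_triple S j b b' -> free_triple S j c c' ->
  free_triple S a b c -> False.
Proof.
move=> U sub f1 f2 f3 f4.
have all y : y \in S -> y \in [:: j; a; a'; b; b'; c; c'].
  by apply: mem_all_of_card; rewrite ?S7.
have mem y : y \in [:: j; a; a'; b; b'; c; c'] -> y \in S by exact: sub.
have [jS aS a'S] : [/\ j \in S, a \in S & a' \in S].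
  by split; apply: mem; rewrite !inE eqxx ?orbT.
have [bS b'S] : b \in S /\ b' \in S by split; apply: mem; rewrite !inE eqxx ?orbT.
have [cS c'S] : c \in S /\ c' \in S by split; apply: mem; rewrite !inE eqxx ?orbT.
move: (U); rewrite /= !inE !negb_or => /and5P[/and5P[? ? ? ? /andP[? ?]]].
move=> /and5P[? ? ? ? ?] /and4P[? ? ? ?] /and3P[? ? ?] /and3P[/andP[? ?] ? _].
have nz y z : y != y \/ z != z -> False by rewrite !eqxx; case.
have f5 : free_triple S a b' c'.
  have [p [/all pI p1 p2 fp]] := H aS b'S ltac:(distinct).
  move: pI p1 p2 fp; rewrite !inE.
  by case/or4P=> [|||/or4P[]] /eqP-> p1 p2 fp; rewrite ?eqxx // in p1 p2; share_any S4 fp.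
have f6 : free_triple S a' b c'.
  have [p [/all pI p1 p2 fp]] := H a'S bS ltac:(distinct).
  move: pI p1 p2 fp; rewrite !inE.
  by case/or4P=> [|||/or4P[]] /eqP-> p1 p2 fp; rewrite ?eqxx // in p1 p2; share_any S4 fp.
have f7 : free_triple S a' b' c.
  have [p [/all pI p1 p2 fp]] := H a'S b'S ltac:(distinct).
  move: pI p1 p2 fp; rewrite !inE.
  by case/or4P=> [|||/or4P[]] /eqP-> p1 p2 fp; rewrite ?eqxx // in p1 p2; share_any S4 fp.
exact: no_fano f1 f2 f3 f4 f5 f6 f7.
Qed.

(** The three free triples through [j] exhaust the points. The third point of the triple on [a, b]
    can only be [c] or [c'], and exchanging these two names reduces to one case. *)
Lemma no_partners7 : False.
Proof.
have [j jS _] : exists2 j, j \in S & j \notin [::] by apply: exists_notin; rewrite S7.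
have [a aS] : exists2 a, a \in S & a \notin [:: j] by apply: exists_notin; rewrite S7.
rewrite inE => aj; have [a' [a'S a'j a'a f1]] := H jS aS aj.
have [b bS] : exists2 y, y \in S & y \notin [:: j; a; a'].
  by apply: exists_notin; rewrite S7.
rewrite !inE !negb_or => /and3P[bj ba ba'].
have [b' [b'S b'j b'b f2]] := H jS bS bj.
have b'a : b' != a by apply/eqP => e; move: f2; rewrite e => f2; share S4 f1 f2.
have b'a' : b' != a' by apply/eqP => e; move: f2; rewrite e => f2; share S4 f1 f2.
have [c cS] : exists2 y, y \in S & y \notin [:: j; a; a'; b; b'].
  by apply: exists_notin; rewrite S7.
rewrite !inE !negb_or => /and5P[cj ca ca' cb cb'].
have [c' [c'S c'j c'c f3]] := H jS cS cj.
have c'a : c' != a by apply/eqP => e; move: f3; rewrite e => f3; share S4 f1 f3.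
have c'a' : c' != a' by apply/eqP => e; move: f3; rewrite e => f3; share S4 f1 f3.
have c'b : c' != b by apply/eqP => e; move: f3; rewrite e => f3; share S4 f2 f3.
have c'b' : c' != b' by apply/eqP => e; move: f3; rewrite e => f3; share S4 f2 f3.
have U : uniq [:: j; a; a'; b; b'; c; c'] by distinct.
have sub : {subset [:: j; a; a'; b; b'; c; c'] <= S}.
  by move=> y; rewrite !inE => /or4P[/eqP->|/eqP->|/eqP->|/or4P[]/eqP->].
have [p [pS p1 p2 fp]] := H aS bS ba.
have := mem_all_of_card U sub _ pS; rewrite S7 => /(_ isT).
move: pS p1 p2 fp; rewrite !inE => pS p1 p2 fp.
case/or4P=> [|||/or4P[]] /eqP e; subst p; rewrite ?eqxx // in p1 p2;
  try by share_any S4 fp.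
- exact: fano_of_partners U sub f1 f2 f3 fp.
- apply: (@fano_of_partners j a a' b b' c' c) => //; try by apply: free23.
    by distinct.
  by move=> y yI; apply: sub; move: yI; rewrite !inE => /or4P[->|->|->|/or4P[]->]; rewrite ?orbT.
Qed.

End Seven.

(** * Eight points: excluding three-point supports *)

Section Eight.
Hypothesis T8 : #|T| = 8%N.
Local Notation free := (free_triple [set: T]).
Local Notation V j := [set~ j].
Let T4 : (4 < #|[set: T]|)%N. Proof. by rewrite cardsT T8. Qed.

Lemma all_labels s (y : T) : uniq s -> size s = 8%N -> y \in s.
Proof.
move=> U s8; apply: (@mem_all_of_card [set: T]) => //.
  by move=> z _; rewrite inE.
by rewrite cardsT T8 s8.
Qed.

(** The obstruction of sizes 2, 2, 2 at [j], with [z] left over; [flagged] is the one of sizes 2, 2,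
    3. *)
Definition paired j : Prop := exists2 z, z != j & forall y, y != j -> y != z ->
  exists y', [/\ y' != j, y' != z, y' != y & free j y y'].

Definition flagged j u : Prop := [/\ min_link (V j) j u, #|link_supp u| = 3%N &
  forall y, y != j -> y \notin link_supp u ->
  exists y', [/\ y' != j, y' \notin link_supp u, y' != y & free j y y']].

Lemma paired_or_flagged j : ~ determined3 (V j) j ->
  paired j \/ exists u, flagged j u.
Proof.
have jV : j \notin V j by rewrite !inE eqxx.
have V7 : #|V j| = 7%N by rewrite cardsC1 T8.
case/(determined3_partner7 jV V7) => [[z zV h]|[u [mu u3 h]]]; rewrite setUCr in h.
- left; exists z; first by move: zV; rewrite !inE.
  move=> y yj yz; have [|y' y'I fy] := h y; first by rewrite !inE yj yz.
  by exists y'; move: y'I; rewrite !inE => /and3P[].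
- right; exists u; split=> // y yj yu; have [|y' y'I fy] := h y.
    by rewrite in_setD yu !inE.
  exists y'; move: y'I; rewrite in_setD1 in_setD => /and3P[? ?].
  by rewrite in_setC1 => ?; split.
Qed.

Lemma link_diag (W : {set T}) i u k : link_tangent W i u -> u k k = 0.
Proof.
move=> hu; apply/eqP; apply: contraT => /(lt_supp hu)[_ _].
by rewrite eqxx.
Qed.

Section Flag.
Variables (j : T) (u : T -> T -> F).
Hypothesis mu : min_link (V j) j u.
Let hu : link_tangent (V j) j u. Proof. by case: mu. Qed.
Let jV : j \notin V j. Proof. by rewrite !inE eqxx. Qed.

(** Otherwise [pair_link c d] would be a nonzero solution with strictly smaller support than the
    minimal [u]. *)
Lemma flag_not_free c d e : uniq [:: j; c; d; e] ->
  link_supp u = [set c; d; e] -> free c j d -> False.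
Proof.
rewrite /= !inE !negb_or => /and4P[/and3P[? ? ?] /andP[? ?] ? _] su f.
have f' : free_triple (j |: V j) j c d by rewrite setUCr; apply: free12.
have cd : c != d by [].
have cV : c \in V j by rewrite !inE eq_sym.
have dV : d \in V j by rewrite !inE eq_sym.
have hp' := pair_link_tangent jV cV dV cd f'.
have sp : link_supp (pair_link c d) = [set c; d].
  apply/setP => y; apply/link_suppP/set2P => [[l /pair_linkP[][-> _]]|[]->]; auto.
    by exists d; apply/pair_linkP; left.
  by exists c; apply/pair_linkP; right.
have [_ _ /(_ _ hp')] := mu; rewrite sp su => H.
have : e \in [set c; d; e] by rewrite !inE eqxx orbT.
have ec : e != c by distinct.
have ed : e != d by distinct.
rewrite -H; first by rewrite !inE (negPf ec) (negPf ed).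
  by apply/set0Pn; exists c; rewrite !inE eqxx.
by apply/subsetP => y; rewrite !inE => ->.
Qed.

(** As [r] and [k] lie outside the support, a nonzero [u c d] would kill the term [jd|rk] of the
    relation at [c]. Freeness of [c d r] already kills [dr|jk], and two terms cannot both vanish. *)
Lemma flag_edge c d e r k : uniq [:: j; c; d; e; r; k] ->
  link_supp u = [set c; d; e] -> free c d r -> u c d = 0.
Proof.
rewrite /= !inE !negb_or.
move=> /and5P[/and5P[? ? ? ? ?] /and4P[? ? ? ?] /and3P[? ? ?] /andP[? ?] /andP[? _]].
move=> su f; apply/eqP; apply: contraT => ucd; exfalso.
have z y m : y \notin [set c; d; e] -> u m y = 0.
  by rewrite -su => yn; rewrite (lt_sym hu) link_supp0.
have mem : {subset [:: c; d; r; k] <= V j}.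
  by move=> y; rewrite !inE => /or4P[]/eqP->; rewrite eq_sym.
have q1 : q c j d r k = 0.
  apply: (link_row0 hu _ mem) => //; first by distinct.
    by rewrite z // !inE !negb_or; distinct.
  by rewrite z // !inE !negb_or; distinct.
have [q2 _ _] := f j k (in_setT _) (in_setT _) ltac:(distinct).
apply: (@init_term_zero2 c j d r k) => //; first by distinct.
by rewrite init_termCC.
Qed.

Section Match.
Variables (c d e a a' b b' : T).
Hypothesis U : uniq [:: j; c; d; e; a; a'; b; b'].
Hypothesis su : link_supp u = [set c; d; e].
Hypothesis fa : free j a a'.
Hypothesis fb : free j b b'.

Let uz y m : y \notin [set c; d; e] -> u m y = 0.
Proof. by rewrite -su => yn; rewrite (lt_sym hu) link_supp0. Qed.

Let nj1 y : y != j -> y != c -> free c j y -> False.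
Proof.
move: (U); rewrite /= !inE !negb_or.
move=> /and5P[/and5P[? ? ? ? /and3P[? ? ?]] /and5P[? ? ? ? /andP[? ?]] /and5P[? ? ? ? ?] /and4P[? ? ? ?]].
move=> /and4P[/and3P[? ? ?] /andP[? ?] ? _] yj yc f.
have := all_labels y U erefl; rewrite !inE (negPf yj) (negPf yc) /=.
case/or4P=> [|||/or3P[]] /eqP ey; subst y.
- by apply: (@flag_not_free c d e) => //; distinct.
- apply: (@flag_not_free c e d) => //; first by distinct.
  by rewrite su setUAC.
- by share T4 f fa.
- by share T4 f fa.
- by share T4 f fb.
- by share T4 f fb.
Qed.

Let ucd_or : u c d = 0 -> u c e = 0 -> False.
Proof.
move=> cd ce; have : c \in link_supp u by rewrite su !inE eqxx.
move/link_suppP => [y uy]; case: (boolP (y \in [set c; d; e])) => yI.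
  by move: yI uy; rewrite !inE => /orP[/orP[]|]/eqP->; rewrite ?cd ?ce ?(link_diag _ hu) eqxx.
by rewrite uz ?eqxx in uy.
Qed.

Lemma flag_edge_d r : r \in [:: a; a'; b; b'] -> free c d r -> u c d = 0.
Proof.
move: (U); rewrite /= !inE !negb_or.
move=> /and5P[/and5P[? ? ? ? /and3P[? ? ?]] /and5P[? ? ? ? /andP[? ?]] /and5P[? ? ? ? ?] /and4P[? ? ? ?]].
move=> /and4P[/and3P[? ? ?] /andP[? ?] ? _].
case/or4P=> /eqP-> f.
- by apply: (@flag_edge c d e a b) => //; distinct.
- by apply: (@flag_edge c d e a' b) => //; distinct.
- by apply: (@flag_edge c d e b a) => //; distinct.
- by apply: (@flag_edge c d e b' a) => //; distinct.
Qed.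

Lemma flag_edge_e r : r \in [:: a; a'; b; b'] -> free c e r -> u c e = 0.
Proof.
move: (U); rewrite /= !inE !negb_or.
move=> /and5P[/and5P[? ? ? ? /and3P[? ? ?]] /and5P[? ? ? ? /andP[? ?]] /and5P[? ? ? ? ?] /and4P[? ? ? ?]].
move=> /and4P[/and3P[? ? ?] /andP[? ?] ? _].
have su' : link_supp u = [set c; e; d] by rewrite su setUAC.
case/or4P=> /eqP-> f.
- by apply: (@flag_edge c e d a b) => //; distinct.
- by apply: (@flag_edge c e d a' b) => //; distinct.
- by apply: (@flag_edge c e d b a) => //; distinct.
- by apply: (@flag_edge c e d b' a) => //; distinct.
Qed.

(** The two ways of pairing off [a, a', b, b'] other than [aa'|bb'], which is taken by [j]. With
    only two ways available, three points of a support cannot all use different ones. *)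
Definition matched y := (free y a b /\ free y a' b') \/ (free y a b' /\ free y a' b).

Lemma matched_of_partners :
  (exists2 p, p \in [:: a; a'; b; b'] & free c a p /\ p != a) ->
  (exists2 p, p \in [:: a; a'; b; b'] & free c a' p /\ p != a') -> matched c.
Proof.
move: (U); rewrite /= !inE !negb_or.
move=> /and5P[/and5P[? ? ? ? /and3P[? ? ?]] /and5P[? ? ? ? /andP[? ?]] /and5P[? ? ? ? ?] /and4P[? ? ? ?]].
move=> /and4P[/and3P[? ? ?] /andP[? ?] ? _].
have w1 p (h : p != a) : free c a p -> p = a' -> False.
  by move=> f e1; move: f; rewrite e1 => f; share T4 f fa.
have w2 p (h : p != a') : free c a' p -> p = a -> False.
  by move=> f e1; move: f; rewrite e1 => f; share T4 f fa.
move=> [p]; rewrite !inE => pI [f pa] [p']; rewrite !inE => pI' [f' pa'].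
move: pI; rewrite (negPf pa) /=; case/or3P=> /eqP ep; first by case: (w1 _ pa f ep).
- move: pI'; rewrite (negPf pa') /= => /orP[|/orP[]]/eqP ep'; first by case: (w2 _ pa' f' ep').
    by move: f f'; rewrite ep ep' => f f'; share T4 f f'.
  by left; rewrite -ep -{1}ep'.
- move: pI'; rewrite (negPf pa') /= => /orP[|/orP[]]/eqP ep'; first by case: (w2 _ pa' f' ep').
    by right; rewrite -ep -{1}ep'.
  by move: f f'; rewrite ep ep' => f f'; share T4 f f'.
Qed.

(** No free triple contains [c] and [j], so [j] is the point left over at [c]. If [d] and [e] were
    not partners at [c], [flag_edge] would annihilate both [u c d] and [u c e], although [c] lies in
    the support. The other four points are then matched among themselves. *)
Lemma matched_paired : paired c -> matched c.
Proof.
move: (U); rewrite /= !inE !negb_or.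
move=> /and5P[/and5P[? ? ? ? /and3P[? ? ?]] /and5P[? ? ? ? /andP[? ?]] /and5P[? ? ? ? ?] /and4P[? ? ? ?]].
move=> /and4P[/and3P[? ? ?] /andP[? ?] ? _].
move=> [z zc h].
have jz : j = z.
  apply/eqP; apply: contraT => jz; have [y [yc yz yj f]] := h j ltac:(distinct) jz.
  by case: (nj1 yj yc f).
have part y : y != c -> y != j -> exists p, [/\ p != c, p != j, p != y & free c y p].
  by move=> yc yj; rewrite jz in yj *; apply: h.
have fde : free c d e.
  have [p [pc pj pd f]] := part d ltac:(distinct) ltac:(distinct).
  have := all_labels p U erefl; rewrite !inE (negPf pj) (negPf pc) (negPf pd) /=.
  case/orP=> [/eqP <-//|pR]; have cd0 : u c d = 0.
    by apply: (flag_edge_d (r := p)) => //; rewrite !inE.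
  have [p' [pc' pj' pd' f']] := part e ltac:(distinct) ltac:(distinct).
  have := all_labels p' U erefl; rewrite !inE (negPf pj') (negPf pc') (negPf pd') /=.
  case/orP=> [/eqP e'|pR'].
    by move: f' pR; rewrite e' => f' /or4P[]/eqP e''; move: f; rewrite e'' => f; share T4 f f'.
  by case: (ucd_or cd0); apply: (flag_edge_e (r := p')) => //; rewrite !inE.
apply: matched_of_partners.
  have [p [pc pj pa f]] := part a ltac:(distinct) ltac:(distinct).
  exists p => //; have := all_labels p U erefl.
  rewrite !inE (negPf pj) (negPf pc) /=; case/orP=> [/eqP e1|/orP[/eqP e1|//]].
    by move: f; rewrite e1 => f; share T4 f fde.
  by move: f; rewrite e1 => f; share T4 f fde.
have [p [pc pj pa f]] := part a' ltac:(distinct) ltac:(distinct).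
exists p => //; have := all_labels p U erefl.
rewrite !inE (negPf pj) (negPf pc) /=; case/orP=> [/eqP e1|/orP[/eqP e1|//]].
  by move: f; rewrite e1 => f; share T4 f fde.
by move: f; rewrite e1 => f; share T4 f fde.
Qed.

Section Flagged.
Variable u2 : T -> T -> F.
Hypothesis hu2 : link_tangent (V c) c u2.

(* A triple of the support of [u2] through [j] and [r] is killed by the free
   triple [j, r, r']. *)
Lemma flag_link_free r r' m : uniq [:: j; c; r; r'; m] -> free j r r' ->
  u2 j r' = 0 -> u2 j m = 0 -> u2 j r = 0.
Proof.
rewrite /= !inE !negb_or => /and5P[/and4P[? ? ? ?] /and3P[? ? ?] /andP[? ?] ? _].
move=> f z1 z2; apply/eqP; apply: contraT => ujr; exfalso.
have mem : {subset [:: j; r; r'; m] <= V c}.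
  by move=> y; rewrite !inE => /or4P[]/eqP->; first [done | rewrite eq_sym].
have q1 := @link_row0 (V c) c u2 j r r' m hu2 ltac:(distinct) mem z1 z2 ujr.
have [q2 _ _] := f c m (in_setT _) (in_setT _) ltac:(distinct).
apply: (@init_term_zero2 j c r r' m) => //; first by distinct.
by rewrite init_termCC.
Qed.

(** The values [u2 j d'] and [u d' e'] are shown to be nonzero. In the relation at [j] on
    [c, d', e', r'] the first kills the term [cd'|e'r'] and the second the term [cr'|d'e'], one too
    many. *)
Lemma flag_mixed_support d' e' r r' : uniq [:: j; c; d'; e'; r; r'] ->
  link_supp u2 = [set j; d'; r] -> link_supp u = [set c; d'; e'] ->
  u c e' = 0 -> free j r r' -> False.
Proof.
rewrite /= !inE !negb_or.
move=> /and5P[/and5P[? ? ? ? ?] /and4P[? ? ? ?] /and3P[? ? ?] /andP[? ?] /andP[? _]].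
move=> su2 su' uce f.
have z2 y m : y \notin [set j; d'; r] -> u2 m y = 0.
  by rewrite -su2 => yn; rewrite (lt_sym hu2) link_supp0.
have z y m : y \notin [set c; d'; e'] -> u m y = 0.
  by rewrite -su' => yn; rewrite (lt_sym hu) link_supp0.
have zr' : u2 j r' = 0 by rewrite z2 // !inE !negb_or; distinct.
have ze : u2 j e' = 0 by rewrite z2 // !inE !negb_or; distinct.
have zr : u2 j r = 0.
  by apply: (flag_link_free _ f zr' ze); distinct.
have ujd : u2 j d' != 0.
  have : j \in link_supp u2 by rewrite su2 !inE eqxx.
  move/link_suppP => [y uy]; case: (boolP (y \in [set j; d'; r])) => yI.
    move: yI uy; rewrite !inE => /orP[/orP[]|]/eqP-> //; rewrite ?zr ?(link_diag _ hu2) ?eqxx //.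
  by rewrite z2 ?eqxx in uy.
have ude : u d' e' != 0.
  have : e' \in link_supp u by rewrite su' !inE eqxx ?orbT.
  move/link_suppP => [y uy]; case: (boolP (y \in [set c; d'; e'])) => yI.
    move: yI uy; rewrite !inE => /orP[/orP[]|]/eqP->.
    - by rewrite (lt_sym hu) uce eqxx.
    - by rewrite (lt_sym hu).
    - by rewrite (link_diag _ hu) eqxx.
  by rewrite z ?eqxx in uy.
have mem : {subset [:: j; d'; e'; r'] <= V c}.
  by move=> y; rewrite !inE => /or4P[]/eqP->; first [done | rewrite eq_sym].
have q1 := @link_row0 (V c) c u2 j d' e' r' hu2 ltac:(distinct) mem ze zr' ujd.
have mem' : {subset [:: c; d'; e'; r'] <= V j}.
  by move=> y; rewrite !inE => /or4P[]/eqP->; first [done | rewrite eq_sym].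
have := @lt_star (V j) j u hu c d' e' r' ltac:(distinct) mem'.
have r'n : r' \notin [set c; d'; e'] by rewrite !inE !negb_or; distinct.
rewrite q1 mul0r add0r uce (z r' c r'n) (lt_sym hu d' r') (z r' d' r'n) !add0r.
rewrite mulr0 add0r => /eqP; rewrite mulf_eq0 (negPf ude) orbF => /eqP q2.
by apply: (@init_term_zero2 j c d' e' r') => //; distinct.
Qed.

End Flagged.

(** Having no partner at [c], the point [j] lies in the support of [u2]. If [d] and [e] do too, the
    other four points are matched. If exactly one does, [flag_mixed_support] applies. If neither
    does, the support is [j] with one of the pairs [aa'], [bb']; the points of the other pair then
    have [d] or [e] as partners at [c], and either two free triples share two points or [u c d] and
    [u c e] both vanish. *)
Lemma matched_flagged u2 : flagged c u2 -> matched c.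
Proof.
move: (U); rewrite /= !inE !negb_or.
move=> /and5P[/and5P[? ? ? ? /and3P[? ? ?]] /and5P[? ? ? ? /andP[? ?]] /and5P[? ? ? ? ?] /and4P[? ? ? ?]].
move=> /and4P[/and3P[? ? ?] /andP[? ?] ? _] [[hu2 _ _] c3 part].
have jC : j \in link_supp u2.
  apply: contraT => jC; have [y [yc yC yj f]] := part j ltac:(distinct) jC.
  by case: (nj1 yj yc f).
have cC : c \notin link_supp u2.
  by apply/negP => /(subsetP (link_supp_sub hu2)); rewrite !inE eqxx.
have z2 y m : y \notin link_supp u2 -> u2 m y = 0.
  by move=> yn; rewrite (lt_sym hu2) link_supp0.
have partR p s : p \notin link_supp u2 -> s \in link_supp u2 -> p != s.
  by move=> pn; apply: contraTneq => <-.
have third p : p \in link_supp u2 -> p != j ->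
    exists r, [/\ r != j, r != p & link_supp u2 = [set j; p; r]].
  move=> pC pj; have pD : p \in link_supp u2 :\ j by rewrite in_setD1 pj.
  have : #|link_supp u2 :\ j :\ p| = 1%N.
    by move: c3; rewrite (cardsD1 j) jC (cardsD1 p (_ :\ j)) pD => -[].
  move/eqP/cards1P=> [r er]; have := set11 r; rewrite -er !in_setD1 => /and3P[rp rj _].
  by exists r; split=> //; rewrite -{1}(setD1K jC) -(setD1K pD) er setUA.
have lab p : p != c -> p != j -> p \in [:: d; e; a; a'; b; b'].
  by move=> pc pj; have := all_labels p U erefl; rewrite in_cons (negPf pj) in_cons (negPf pc).
have labR p : p != c -> p != j -> p != d -> p != e -> p \in [:: a; a'; b; b'].
  by move=> pc pj pd pe; have := lab p pc pj; rewrite in_cons (negPf pd) in_cons (negPf pe).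
case: (boolP (d \in link_supp u2)) => dC; case: (boolP (e \in link_supp u2)) => eC.
- have [r [rj rd er]] := third d dC ltac:(distinct).
  have re : e = r.
    have ej : e != j by distinct.
    have ed : e != d by distinct.
    by apply/eqP; move: eC; rewrite er !inE (negPf ej) (negPf ed).
  subst r.
  have pR y : y \notin link_supp u2 -> y != c ->
      exists2 p, p \in [:: a; a'; b; b'] & free c y p /\ p != y.
    move=> yC yc; have [p [pc pC py f]] := part y yc yC; exists p => //.
    by apply: labR => //; apply: partR.
  by apply: matched_of_partners; apply: pR; first [distinct
    | rewrite er !inE !negb_or; distinct].
- exfalso; have [r [rj rd er]] := third d dC ltac:(distinct).
  have rC : r \in link_supp u2 by rewrite er !inE eqxx ?orbT.
  have rc : r != c by apply: contraNneq cC => <-.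
  have re : r != e by apply: contraNneq eC => <-.
  have [p [pc pC pe f]] := part e ltac:(distinct) eC.
  have uce : u c e = 0.
    by apply: (flag_edge_e (r := p)) => //; apply: labR => //; apply: partR.
  have := labR r rc rj rd re; rewrite !inE => /or4P[]/eqP er'; subst r.
  + by apply: (flag_mixed_support hu2 _ er su uce fa); distinct.
  + by apply: (flag_mixed_support hu2 _ er su uce (free23 fa)); distinct.
  + by apply: (flag_mixed_support hu2 _ er su uce fb); distinct.
  + by apply: (flag_mixed_support hu2 _ er su uce (free23 fb)); distinct.
- exfalso; have [r [rj rd er]] := third e eC ltac:(distinct).
  have rC : r \in link_supp u2 by rewrite er !inE eqxx ?orbT.
  have rc : r != c by apply: contraNneq cC => <-.
  have re : r != d by apply: contraNneq dC => <-.
  have [p [pc pC pe f]] := part d ltac:(distinct) dC.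
  have ucd : u c d = 0.
    by apply: (flag_edge_d (r := p)) => //; apply: labR => //; apply: partR.
  have su' : link_supp u = [set c; e; d] by rewrite su setUAC.
  have := labR r rc rj re rd; rewrite !inE => /or4P[]/eqP er'; subst r.
  + by apply: (flag_mixed_support hu2 _ er su' ucd fa); distinct.
  + by apply: (flag_mixed_support hu2 _ er su' ucd (free23 fa)); distinct.
  + by apply: (flag_mixed_support hu2 _ er su' ucd fb); distinct.
  + by apply: (flag_mixed_support hu2 _ er su' ucd (free23 fb)); distinct.
exfalso.
have fin s s' : s \in [:: a; a'; b; b'] -> s' \in [:: a; a'; b; b'] -> s != s' ->
    (forall p, p \in [:: a; a'; b; b'] -> p \notin link_supp u2 -> p = s \/ p = s') ->
    s \notin link_supp u2 -> s' \notin link_supp u2 -> free j s s' ->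
    uniq [:: j; c; d; e; s; s'] -> False.
  move=> sR s'R ss' only sC s'C f; rewrite /= !inE !negb_or.
  move=> /and5P[/and5P[? ? ? ? ?] /and4P[? ? ? ?] /and3P[? ? ?] /andP[? ?] /andP[? _]].
  have [p [pc pC ps fp]] := part s ltac:(distinct) sC.
  have [p' [pc' pC' ps' fp']] := part s' ltac:(distinct) s'C.
  have pI : p = d \/ p = e.
    have := lab p pc (partR _ _ pC jC); rewrite in_cons in_cons.
    case/or3P=> [/eqP|/eqP|]; [by left|by right|] => /only/(_ pC)[e1|e1].
      by rewrite e1 eqxx in ps.
    by move: fp; rewrite e1 => fp; share T4 f fp.
  have pI' : p' = d \/ p' = e.
    have := lab p' pc' (partR _ _ pC' jC); rewrite in_cons in_cons.
    case/or3P=> [/eqP|/eqP|]; [by left|by right|] => /only/(_ pC')[e1|e1].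
      by move: fp'; rewrite e1 => fp'; share T4 f fp'.
    by rewrite e1 eqxx in ps'.
  case: pI pI' => e1 [] e2; move: fp fp'; rewrite e1 e2 => fp fp'.
  - by share T4 fp fp'.
  - apply: ucd_or; first by apply: (flag_edge_d (r := s)) => //; apply: free23.
    by apply: (flag_edge_e (r := s')) => //; apply: free23.
  - apply: ucd_or; first by apply: (flag_edge_d (r := s')) => //; apply: free23.
    by apply: (flag_edge_e (r := s)) => //; apply: free23.
  - by share T4 fp fp'.
have /link_suppP[y uy] := jC.
have yC : y \in link_supp u2 by apply: contraNT uy => yC; rewrite z2.
have yj : y != j by apply: contraNneq uy => ->; rewrite (link_diag _ hu2).
have yR : y \in [:: a; a'; b; b'].
  apply: labR => //.
  - by apply: contraNneq cC => <-.
  - by apply: contraNneq dC => <-.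
  - by apply: contraNneq eC => <-.
have [r [rj ry er]] := third y yC yj.
have ue : u2 j e = 0 by rewrite z2.
have key s s' : y = s -> free j s s' -> uniq [:: j; c; s; s'; e] ->
    link_supp u2 = [set j; s; s'].
  move=> ys f Us; subst s; rewrite er; congr (_ :|: [set _]).
  apply/eqP; apply: contraT => rs.
  have s'C : s' \notin link_supp u2.
    move: Us; rewrite er /= !inE !negb_or.
    by move=> /and5P[/and4P[? ? ? ?] /and3P[? ? ?] /andP[? ?] ? _]; distinct.
  by move: uy; rewrite (flag_link_free hu2 Us f (z2 _ _ s'C) ue) eqxx.
have close s s' t t' : y = s -> free j s s' -> free j t t' ->
    t \in [:: a; a'; b; b'] -> t' \in [:: a; a'; b; b'] ->
    (forall p, p \in [:: a; a'; b; b'] -> p \in [:: s; s'; t; t']) ->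
    uniq [:: j; c; d; e; s; s'; t; t'] -> False.
  move=> ys f f' tR t'R all4; rewrite /= !inE !negb_or.
  move=> /and5P[/and5P[? ? ? ? /and3P[? ? ?]] /and5P[? ? ? ? /andP[? ?]] /and5P[? ? ? ? ?] /and4P[? ? ? ?]].
  move=> /and4P[/and3P[? ? ?] /andP[? ?] ? _].
  have es := key s s' ys f ltac:(distinct).
  apply: (fin t t') => //; try distinct.
  - move=> p /all4; rewrite es !inE !negb_or => /or4P[]/eqP-> //; rewrite ?eqxx ?andbF //.
      by left.
    by right.
  - by rewrite es !inE !negb_or; distinct.
  - by rewrite es !inE !negb_or; distinct.
move: yR; rewrite !inE => /or4P[]/eqP ey.
- by apply: (close a a' b b') => //; rewrite ?inE ?eqxx ?orbT //; distinct.
- apply: (close a' a b b') => //; rewrite ?inE ?eqxx ?orbT //; first exact: free23.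
    by move=> p; rewrite !inE => /or4P[]->; rewrite ?orbT.
  by distinct.
- apply: (close b b' a a') => //; rewrite ?inE ?eqxx ?orbT //.
    by move=> p; rewrite !inE => /or4P[]->; rewrite ?orbT.
  by distinct.
- apply: (close b' b a a') => //; rewrite ?inE ?eqxx ?orbT //; first exact: free23.
    by move=> p; rewrite !inE => /or4P[]->; rewrite ?orbT.
  by distinct.
Qed.

End Match.
End Flag.
End Eight.

Definition determined (S : {set T}) (r : nat) : Prop :=
  exists2 E : seq (T * T * T), (size E <= r)%N &
    forall v, plucker_tangent S v ->
      (forall a b c, (a, b, c) \in E -> v a b c = 0) ->
      forall a b c, a \in S -> b \in S -> c \in S -> uniq [:: a; b; c] ->
      v a b c = 0.

(** Propagation through an equation of [free_tangent]: three known integer multiples of [s] give the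
    fourth. *)
Lemma linear_step (s A B C D : F) (k l m : int) : A + B = C + D ->
  B = k%:~R * s -> C = l%:~R * s -> D = m%:~R * s -> A = (l + m - k)%:~R * s.
Proof.
move=> e eB eC eD; rewrite -[LHS](addrK B) e eB eC eD rmorphB rmorphD /=; ring.
Qed.

Lemma linear_step2 (s A B C D : F) (k l m : int) : B + A = C + D ->
  B = k%:~R * s -> C = l%:~R * s -> D = m%:~R * s -> A = (l + m - k)%:~R * s.
Proof. by rewrite addrC; apply: linear_step. Qed.

Lemma symmetric3_sorted (P : F -> Prop) (v : T -> T -> T -> F) (t : seq T) y0 :
  (forall a b c, v b a c = v a b c) -> (forall a b c, v a c b = v a b c) ->
  (forall i k l, (i < k)%N -> (k < l)%N -> (l < size t)%N ->
     P (v (nth y0 t i) (nth y0 t k) (nth y0 t l))) ->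
  forall a b c, a \in t -> b \in t -> c \in t -> uniq [:: a; b; c] -> P (v a b c).
Proof.
move=> v12 v23 h a b c aI bI cI U.
have h' i k l : (i < size t)%N -> (k < size t)%N -> (l < size t)%N ->
    i != k -> i != l -> k != l -> P (v (nth y0 t i) (nth y0 t k) (nth y0 t l)).
  move=> it kt lt.
  wlog ik : i k l it kt lt / (i < k)%N.
    move=> H ik il kl; have [lik|lki|/eqP] := ltngtP i k; first exact: H.
      by rewrite v12; apply: H => //; rewrite eq_sym.
    by rewrite (negPf ik).
  move=> _ il kl; have [lkl|llk|/eqP] := ltngtP k l; first exact: h.
    rewrite v23; have [lil|lli|/eqP] := ltngtP i l; first exact: h.
      by rewrite v12; apply: h.
    by rewrite (negPf il).
  by rewrite (negPf kl).
move: U; rewrite /= !inE !negb_or -(nth_index y0 aI) -(nth_index y0 bI) -(nth_index y0 cI).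
move=> /and3P[/andP[ab ac] bc _]; apply: h'; rewrite ?index_mem //.
- by apply: contraNneq ab => ->.
- by apply: contraNneq ac => ->.
- by apply: contraNneq bc => ->.
Qed.

(** * The Moebius-Kantor configuration *)

Section MoebiusKantor.
Hypothesis T8 : #|T| = 8%N.
Local Notation free := (free_triple [set: T]).

(* In a Moebius-Kantor configuration the free triples give a binomial linear
   system whose solutions are, away from the eight free coordinates, the
   torus weights.  After fixing eight further coordinates every value is an
   integer multiple of [v j a' c], and the last relation kills it. *)
Lemma moebius_kantor_determined j a a' b b' c c' e :
  uniq [:: j; a; a'; b; b'; c; c'; e] ->
  free j a a' -> free j b b' -> free j c c' -> free e a b -> free e a' c ->
  free e b' c' -> free a b' c -> free a' b c' -> determined [set: T] 16.
Proof.
move=> U f1 f2 f3 f4 f5 f6 f7 f8.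
have all y : y \in [:: j; a; a'; b; b'; c; c'; e] by apply: all_labels.
exists [:: (j, a, a'); (j, b, b'); (j, c, c'); (e, a, b); (e, a', c); (e, b', c');
  (a, b', c); (a', b, c'); (j, a', b); (b, b', c'); (j, b', c); (j, a', b');
  (b, b', c); (b, c', e); (b, c, c'); (a, a', b')] => // v hv v0.
have iT y : y \in [set: T] by rewrite inE.
have ft i p q r t := @free_tangent _ v i p q r t hv (iT i) (iT p) (iT q) (iT r) (iT t).
have vcyc p q r : v q r p = v p q r by rewrite (pt_23 hv) (pt_12 hv).
have vcyc2 p q r : v r p q = v p q r by rewrite -(vcyc p q r) -(vcyc q r p).
have v321 p q r : v r q p = v p q r by rewrite (pt_12 hv) vcyc.
move: (U); rewrite /= !inE !negb_or.
move=> /and5P[/and5P[? ? ? ? /and3P[? ? ?]] /and5P[? ? ? ? /andP[? ?]] /and5P[? ? ? ? ?] /and4P[? ? ? ?]].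
move=> /and4P[/and3P[? ? ?] /andP[? ?] ? _].
pose s := v j a' c.
have hjAc : v j a' c = 1%:~R * s by rewrite mul1r.
have hjAb : v j a' b = 0%:~R * s by rewrite mul0r; apply: v0; rewrite !inE eqxx ?orbT.
have hbBC : v b b' c' = 0%:~R * s by rewrite mul0r; apply: v0; rewrite !inE eqxx ?orbT.
have hjBc : v j b' c = 0%:~R * s by rewrite mul0r; apply: v0; rewrite !inE eqxx ?orbT.
have hjAB : v j a' b' = 0%:~R * s by rewrite mul0r; apply: v0; rewrite !inE eqxx ?orbT.
have hbBc : v b b' c = 0%:~R * s by rewrite mul0r; apply: v0; rewrite !inE eqxx ?orbT.
have hbCe : v b c' e = 0%:~R * s by rewrite mul0r; apply: v0; rewrite !inE eqxx ?orbT.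
have hbcC : v b c c' = 0%:~R * s by rewrite mul0r; apply: v0; rewrite !inE eqxx ?orbT.
have haAB : v a a' b' = 0%:~R * s by rewrite mul0r; apply: v0; rewrite !inE eqxx ?orbT.
have hjaA : v j a a' = 0%:~R * s by rewrite mul0r; apply: v0; rewrite !inE eqxx ?orbT.
have hjbB : v j b b' = 0%:~R * s by rewrite mul0r; apply: v0; rewrite !inE eqxx ?orbT.
have hjcC : v j c c' = 0%:~R * s by rewrite mul0r; apply: v0; rewrite !inE eqxx ?orbT.
have habe : v a b e = 0%:~R * s.
  by rewrite mul0r -(vcyc2 a b e); apply: v0; rewrite !inE eqxx ?orbT.
have hAce : v a' c e = 0%:~R * s.
  by rewrite mul0r -(vcyc2 a' c e); apply: v0; rewrite !inE eqxx ?orbT.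
have hBCe : v b' c' e = 0%:~R * s.
  by rewrite mul0r -(vcyc2 b' c' e); apply: v0; rewrite !inE eqxx ?orbT.
have haBc : v a b' c = 0%:~R * s by rewrite mul0r; apply: v0; rewrite !inE eqxx ?orbT.
have hAbC : v a' b c' = 0%:~R * s by rewrite mul0r; apply: v0; rewrite !inE eqxx ?orbT.
have E : v j a' b + v j b' c = v j b c + v j a' b'.
  by have := ft j b b' a' c ltac:(distinct) f2;
    rewrite (pt_23 hv j a' b) (pt_23 hv j a' b').
have hjbc : v j b c = 0%:~R * s.
  by rewrite (linear_step (esym E) hjAB hjAb hjBc).
have {}E : v j a' b + v a a' b' = v j a' b' + v a a' b.
  by have := ft a' j a b b' ltac:(distinct) (free_rot (free_rot f1));
    rewrite (pt_12 hv j a' b) (pt_12 hv a a' b') (pt_12 hv j a' b') (pt_12 hv a a' b).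
have haAb : v a a' b = 0%:~R * s.
  by rewrite (linear_step2 (esym E) hjAB hjAb haAB).
have {}E : v j a' b + v a a' c = v j a' c + v a a' b.
  by have := ft a' j a b c ltac:(distinct) (free_rot (free_rot f1));
    rewrite (pt_12 hv j a' b) (pt_12 hv a a' c) (pt_12 hv j a' c) (pt_12 hv a a' b).
have haAc : v a a' c = 1%:~R * s.
  by rewrite (linear_step2 E hjAb hjAc haAb).
have {}E : v j b c + v a' b b' = v j a' b + v b b' c.
  by have := ft b j b' c a' ltac:(distinct) (free12 f2);
    rewrite (pt_12 hv j b c) (vcyc a' b b') (vcyc2 j a' b).
have hAbB : v a' b b' = 0%:~R * s.
  by rewrite (linear_step2 E hjbc hjAb hbBc).
have {}E : v j b c' + v a' b b' = v j a' b + v b b' c'.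
  by have := ft b j b' c' a' ltac:(distinct) (free12 f2);
    rewrite (pt_12 hv j b c') (vcyc a' b b') (vcyc2 j a' b).
have hjbC : v j b c' = 0%:~R * s.
  by rewrite (linear_step E hAbB hjAb hbBC).
have {}E : v j b c' + v a' b c = v b c c' + v j a' b.
  by have := ft b c' a' j c ltac:(distinct) (free_rot f8);
    rewrite (vcyc j b c') (pt_12 hv a' b c) (pt_23 hv b c c') (v321 j a' b).
have hAbc : v a' b c = 0%:~R * s.
  by rewrite (linear_step2 E hjbC hbcC hjAb).
have {}E : v j a' b + v b c' e = v a' b e + v j b c'.
  by have := ft b a' c' j e ltac:(distinct) (free12 f8);
    rewrite (v321 j a' b) (pt_12 hv a' b e) (vcyc j b c').
have hAbe : v a' b e = 0%:~R * s.
  by rewrite (linear_step (esym E) hjbC hjAb hbCe).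
have {}E : v a b c' + v a' b b' = v b b' c' + v a a' b.
  by have := ft b c' a' a b' ltac:(distinct) (free_rot f8);
    rewrite (vcyc a b c') (pt_12 hv a' b b') (pt_23 hv b b' c') (v321 a a' b).
have habC : v a b c' = 0%:~R * s.
  by rewrite (linear_step E hAbB hbBC haAb).
have {}E : v j b' c' + v a' b b' = v j a' b' + v b b' c'.
  by have := ft b' j b c' a' ltac:(distinct) (free_rot (free_rot f2));
    rewrite (pt_12 hv j b' c') (v321 a' b b') (vcyc2 j a' b') (pt_12 hv b b' c').
have hjBC : v j b' c' = 0%:~R * s.
  by rewrite (linear_step E hAbB hjAB hbBC).
have {}E : v j a' c + v b c c' = v j b c + v a' c c'.
  by have := ft c j c' a' b ltac:(distinct) (free12 f3);
    rewrite (vcyc2 j a' c) (vcyc b c c') (vcyc2 j b c) (vcyc a' c c').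
have hAcC : v a' c c' = 1%:~R * s.
  by rewrite (linear_step2 (esym E) hjbc hjAc hbcC).
have {}E : v j a' c + v b' c c' = v j b' c + v a' c c'.
  by have := ft c j c' a' b' ltac:(distinct) (free12 f3);
    rewrite (vcyc2 j a' c) (vcyc b' c c') (vcyc2 j b' c) (vcyc a' c c').
have hBcC : v b' c c' = 0%:~R * s.
  by rewrite (linear_step2 E hjAc hjBc hAcC).
have {}E : v j a' c' + v b c c' = v j b c' + v a' c c'.
  by have := ft c' j c a' b ltac:(distinct) (free_rot (free_rot f3));
    rewrite (vcyc2 j a' c') (v321 b c c') (vcyc2 j b c') (v321 a' c c').
have hjAC : v j a' c' = 1%:~R * s.
  by rewrite (linear_step E hbcC hjbC hAcC).
have {}E : v j a' c' + v b c' e = v a' c' e + v j b c'.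
  by have := ft c' a' b j e ltac:(distinct) (free_rot (free_rot f8));
    rewrite (v321 j a' c') (pt_12 hv b c' e) (pt_12 hv a' c' e) (v321 j b c').
have hACe : v a' c' e = 1%:~R * s.
  by rewrite (linear_step (esym E) hjbC hjAC hbCe).
have {}E : v j b' c' + v b c' e = v b b' c' + v j c' e.
  by have := ft c' b' e j b ltac:(distinct) (free12 (free_rot f6));
    rewrite (v321 j b' c') (vcyc b c' e) (v321 b b' c') (vcyc j c' e).
have hjCe : v j c' e = 0%:~R * s.
  by rewrite (linear_step2 (esym E) hbBC hjBC hbCe).
have {}E : v j c' e + v b c c' = v j b c' + v c c' e.
  by have := ft c' j c e b ltac:(distinct) (free_rot (free_rot f3));
    rewrite (pt_12 hv j c' e) (v321 b c c') (vcyc2 j b c') (pt_12 hv c c' e).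
have hcCe : v c c' e = 0%:~R * s.
  by rewrite (linear_step2 (esym E) hjbC hjCe hbcC).
have {}E : v a a' c' + v b c c' = v a' c c' + v a b c'.
  by have := ft c' a' b a c ltac:(distinct) (free_rot (free_rot f8));
    rewrite (v321 a a' c') (vcyc2 b c c') (vcyc2 a' c c') (v321 a b c').
have haAC : v a a' c' = 1%:~R * s.
  by rewrite (linear_step E hbcC hAcC habC).
have {}E : v a' b' c' + v b c c' = v a' c c' + v b b' c'.
  by have := ft c' a' b b' c ltac:(distinct) (free_rot (free_rot f8));
    rewrite (vcyc2 a' b' c') (vcyc2 b c c') (vcyc2 a' c c') (vcyc2 b b' c').
have hABC : v a' b' c' = 1%:~R * s.
  by rewrite (linear_step E hbcC hAcC hbBC).
have {}E : v a' c' e + v b c e = v a' b e + v c c' e.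
  by have := ft e a' c c' b ltac:(distinct) f5;
    rewrite (vcyc2 a' c' e) (v321 b c e) (vcyc2 a' b e) (vcyc2 c c' e).
have hbce : v b c e = (-1)%:~R * s.
  by rewrite (linear_step2 E hACe hAbe hcCe).
have {}E : v j a' c + v j c' e = v j c e + v j a' c'.
  by have := ft j c c' a' e ltac:(distinct) f3;
    rewrite (pt_23 hv j a' c) (pt_23 hv j a' c').
have hjce : v j c e = 0%:~R * s.
  by rewrite (linear_step (esym E) hjAC hjAc hjCe).
have {}E : v j a' c + v a' b e = v a' b c + v j a' e.
  by have := ft a' c e j b ltac:(distinct) (free_rot f5);
    rewrite (vcyc j a' c) (pt_23 hv a' b e) (pt_23 hv a' b c) (vcyc j a' e).
have hjAe : v j a' e = 1%:~R * s.
  by rewrite (linear_step2 (esym E) hAbc hjAc hAbe).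
have {}E : v a a' c + v a' b e = v a' b c + v a a' e.
  by have := ft a' c e a b ltac:(distinct) (free_rot f5);
    rewrite (vcyc a a' c) (pt_23 hv a' b e) (pt_23 hv a' b c) (vcyc a a' e).
have haAe : v a a' e = 1%:~R * s.
  by rewrite (linear_step2 (esym E) hAbc haAc hAbe).
have {}E : v a a' b + v b c e = v a b c + v a' b e.
  by have := ft b a e a' c ltac:(distinct) (free12 (free_rot f4));
    rewrite (vcyc2 a a' b) (pt_23 hv b c e) (pt_12 hv a b c) (vcyc a' b e).
have habc : v a b c = (-1)%:~R * s.
  by rewrite (linear_step (esym E) hAbe haAb hbce).
have {}E : v j a' c + v a c e = v a a' c + v j c e.
  by have := ft c a' e j a ltac:(distinct) (free12 (free_rot f5));
    rewrite (v321 j a' c) (vcyc a c e) (v321 a a' c) (vcyc j c e).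
have hace : v a c e = 0%:~R * s.
  by rewrite (linear_step2 E hjAc haAc hjce).
have {}E : v j b' c + v a b c = v b b' c + v j a c.
  by have := ft c b' a j b ltac:(distinct) (free12 (free_rot f7));
    rewrite (v321 j b' c) (vcyc2 a b c) (v321 b b' c) (v321 j a c).
have hjac : v j a c = (-1)%:~R * s.
  by rewrite (linear_step2 (esym E) hbBc hjBc habc).
have {}E : v j a c + v b c c' = v j b c + v a c c'.
  by have := ft c j c' a b ltac:(distinct) (free12 f3);
    rewrite (vcyc2 j a c) (vcyc b c c') (vcyc2 j b c) (vcyc a c c').
have hacC : v a c c' = (-1)%:~R * s.
  by rewrite (linear_step2 (esym E) hjbc hjac hbcC).
have {}E : v j a c + v b' c e = v a c e + v j b' c.
  by have := ft c a b' j e ltac:(distinct) (free_rot (free_rot f7));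
    rewrite (v321 j a c) (pt_12 hv b' c e) (pt_12 hv a c e) (v321 j b' c).
have hBce : v b' c e = 1%:~R * s.
  by rewrite (linear_step2 E hjac hace hjBc).
have {}E : v j c e + v a' b' c = v b' c e + v j a' c.
  by have := ft c e a' j b' ltac:(distinct) (free_rot (free_rot f5));
    rewrite (vcyc j c e) (vcyc2 a' b' c) (vcyc b' c e) (v321 j a' c).
have hABc : v a' b' c = 2%:~R * s.
  by rewrite (linear_step2 E hjce hBce hjAc).
have {}E : v j a c' + v a' c c' = v j a' c' + v a c c'.
  by have := ft c' j c a a' ltac:(distinct) (free_rot (free_rot f3));
    rewrite (vcyc2 j a c') (v321 a' c c') (vcyc2 j a' c') (v321 a c c').
have hjaC : v j a c' = (-1)%:~R * s.
  by rewrite (linear_step E hAcC hjAC hacC).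
have {}E : v j c e + v a' b' e = v b' c e + v j a' e.
  by have := ft e c a' j b' ltac:(distinct) (free23 f5);
    rewrite (v321 j c e) (vcyc2 a' b' e) (v321 b' c e) (v321 j a' e).
have hABe : v a' b' e = 2%:~R * s.
  by rewrite (linear_step2 E hjce hBce hjAe).
have {}E : v j b' e + v a' c' e = v a' b' e + v j c' e.
  by have := ft e b' c' j a' ltac:(distinct) f6;
    rewrite (v321 j b' e) (v321 a' c' e) (v321 a' b' e) (v321 j c' e).
have hjBe : v j b' e = 1%:~R * s.
  by rewrite (linear_step E hACe hABe hjCe).
have {}E : v j b' e + v b c' e = v b b' e + v j c' e.
  by have := ft e b' c' j b ltac:(distinct) f6;
    rewrite (v321 j b' e) (v321 b c' e) (v321 b b' e) (v321 j c' e).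
have hbBe : v b b' e = 1%:~R * s.
  by rewrite (linear_step (esym E) hjCe hjBe hbCe).
have {}E : v a b' e + v a' b e = v a a' e + v b b' e.
  by have := ft e a b b' a' ltac:(distinct) f4;
    rewrite (vcyc2 a b' e) (v321 a' b e) (vcyc2 a a' e) (vcyc2 b b' e).
have haBe : v a b' e = 2%:~R * s.
  by rewrite (linear_step E hAbe haAe hbBe).
have {}E : v a c' e + v a' b e = v a a' e + v b c' e.
  by have := ft e a b c' a' ltac:(distinct) f4;
    rewrite (vcyc2 a c' e) (v321 a' b e) (vcyc2 a a' e) (vcyc2 b c' e).
have haCe : v a c' e = 1%:~R * s.
  by rewrite (linear_step E hAbe haAe hbCe).
have {}E : v j a b + v j a' c = v j a c + v j a' b.
  by have := ft j a a' b c ltac:(distinct) f1.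
have hjab : v j a b = (-2)%:~R * s.
  by rewrite (linear_step E hjAc hjac hjAb).
have {}E : v j a b + v j a' e = v j a e + v j a' b.
  by have := ft j a a' b e ltac:(distinct) f1.
have hjae : v j a e = (-1)%:~R * s.
  by rewrite (linear_step (esym E) hjAb hjab hjAe).
have {}E : v j a b' + v j a' c = v j a c + v j a' b'.
  by have := ft j a a' b' c ltac:(distinct) f1.
have hjaB : v j a b' = (-2)%:~R * s.
  by rewrite (linear_step E hjAc hjac hjAB).
have {}E : v j a b + v j b' e = v j b e + v j a b'.
  by have := ft j b b' a e ltac:(distinct) f2;
    rewrite (pt_23 hv j a b) (pt_23 hv j a b').
have hjbe : v j b e = 1%:~R * s.
  by rewrite (linear_step (esym E) hjaB hjab hjBe).
have {}E : v j a b' + v a b c = v a b b' + v j a c.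
  by have := ft a b' c j b ltac:(distinct) f7;
    rewrite (vcyc j a b') (pt_23 hv a b c) (pt_23 hv a b b') (vcyc j a c).
have habB : v a b b' = (-2)%:~R * s.
  by rewrite (linear_step (esym E) hjac hjaB habc).
have {}E : v j a b' + v a c c' = v a b' c' + v j a c.
  by have := ft a b' c j c' ltac:(distinct) f7;
    rewrite (vcyc j a b') (vcyc j a c).
have haBC : v a b' c' = (-2)%:~R * s.
  by rewrite (linear_step (esym E) hjac hjaB hacC).
have {}E : v j a e + v a b b' = v a b' e + v j a b.
  by have := ft a e b j b' ltac:(distinct) (free12 f4);
    rewrite (vcyc j a e) (pt_23 hv a b' e) (vcyc j a b).
(* All values are now known multiples of [s], and the closing equation reads [-1 - 2 = 2 - 2] times
   [s], that is [3 s = 0]. *)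
rewrite hjae habB haBe hjab in E.
have s0 : s = 0.
  have : s *+ 3 = 0.
    by move/eqP: E; rewrite -subr_eq0 => /eqP E; rewrite -oppr0 -E; ring.
  by move/eqP; rewrite mulrn_eq0 /= => /eqP.
have mult p q r : p \in [set: T] -> q \in [set: T] -> r \in [set: T] ->
    uniq [:: p; q; r] -> exists k : int, v p q r = k%:~R * s.
  move=> _ _ _; apply: (@symmetric3_sorted (fun y => exists k : int, y = k%:~R * s) v
    [:: j; a; a'; b; b'; c; c'; e] j (pt_12 hv) (pt_23 hv)) => // {p q r}.
  move=> [|[|[|[|[|[|[|[|i]]]]]]]] [|[|[|[|[|[|[|[|k]]]]]]]] [|[|[|[|[|[|[|[|l]]]]]]]] //= _ _ _;
    eexists; eassumption.
by move=> p q r pT qT rT Up; have [k ->] := mult p q r pT qT rT Up; rewrite s0 mulr0.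
Qed.

End MoebiusKantor.

(** * From obstructions at all eight points to the configuration *)

Section EightConclusion.
Hypothesis T8 : #|T| = 8%N.
Local Notation free := (free_triple [set: T]).
Local Notation V j := [set~ j].
Let T4 : (4 < #|[set: T]|)%N. Proof. by rewrite cardsT T8. Qed.

Lemma exists_fresh (s : seq T) : (size s < 8)%N -> exists y : T, y \notin s.
Proof.
by move=> s8; have [|y _ ys] := @exists_notin [set: T] s; [rewrite cardsT T8|exists y].
Qed.

(** Each of the three points [c, d, e] of the support is matched with [a, a', b, b'] in one of two
    ways. Two of them use the same way, and their free triples share two points. *)
Lemma no_flagged : (forall j, paired j \/ exists u, flagged j u) ->
  forall j u, ~ flagged j u.
Proof.
move=> H j u [mu u3 part]; have [hu _ _] := mu.
have jn : j \notin link_supp u.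
  by apply/negP => /(subsetP (link_supp_sub hu)); rewrite !inE eqxx.
have := u3; rewrite cardE; have := enum_uniq (link_supp u).
have := mem_enum (link_supp u).
case: (enum _) => [|c [|d [|e []]]] // memE Us _.
have su : link_supp u = [set c; d; e].
  by apply/setP => y; rewrite -memE !inE orbA.
have [a] := @exists_fresh [:: j; c; d; e] isT; rewrite !inE !negb_or.
move=> /and4P[aj ac ad ae].
have au : a \notin link_supp u by rewrite su !inE !negb_or ac ad ae.
have [a' [a'j a'u a'a fa]] := part a aj au.
have [b] := @exists_fresh [:: j; c; d; e; a; a'] isT; rewrite !inE !negb_or.
move=> /and5P[bj bc bd be /andP[ba ba']].
have bu : b \notin link_supp u by rewrite su !inE !negb_or bc bd be.
have [b' [b'j b'u b'b fb]] := part b bj bu.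
have b'a : b' != a by apply/eqP => eb; move: fb; rewrite eb => fb; share T4 fa fb.
have b'a' : b' != a' by apply/eqP => eb; move: fb; rewrite eb => fb; share T4 fa fb.
move: (jn) (a'u) (b'u) (Us); rewrite su /= !inE !negb_or.
move=> /andP[/andP[? ?] ?] /andP[/andP[? ?] ?] /andP[/andP[? ?] ?] /and3P[/andP[? ?] ? _].
have m y y' z : uniq [:: j; y; y'; z; a; a'; b; b'] ->
    link_supp u = [set y; y'; z] -> matched a a' b b' y.
  move=> Uy suy; case: (H y) => [py|[u2 fu2]].
    exact: (matched_paired T8 mu Uy suy fa fb py).
  exact: (matched_flagged T8 mu Uy suy fa fb fu2).
have mc : matched a a' b b' c by apply: (m c d e) => //; distinct.
have md : matched a a' b b' d.
  by apply: (m d c e); [distinct | rewrite su (setUC [set c])].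
have me : matched a a' b b' e.
  by apply: (m e c d); [distinct | rewrite su setUC setUA].
case: mc md me => -[fc fc'] [] [fd fd'] [] [fe fe'];
  first [share T4 fc fd | share T4 fc fe | share T4 fd fe].
Qed.

Section AllPaired.
Hypothesis H : forall j, paired j.

(** Five of the eight lines are given, with [e] the antipode of [j]. The three others are forced:
    any other third point meets a known free triple in two points. *)
Lemma paired_determined3 j a a' b b' c c' e :
  uniq [:: j; a; a'; b; b'; c; c'; e] ->
  free j a a' -> free j b b' -> free j c c' -> free e a b -> free e a' c ->
  (forall y, y != e -> y != j ->
     exists y', [/\ y' != e, y' != j, y' != y & free e y y']) ->
  determined [set: T] 16.
Proof.
move=> U f1 f2 f3 f4 f5 part; move: (U); rewrite /= !inE !negb_or.
move=> /and5P[/and5P[? ? ? ? /and3P[? ? ?]] /and5P[? ? ? ? /andP[? ?]] /and5P[? ? ? ? ?] /and4P[? ? ? ?]].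
move=> /and4P[/and3P[? ? ?] /andP[? ?] ? _].
have all y : y \in [:: j; a; a'; b; b'; c; c'; e] by apply: all_labels.
have f6 : free e b' c'.
  have [p [p1 p2 p3 f]] := part b' ltac:(distinct) ltac:(distinct).
  have := all p; rewrite !inE.
  case/or4P=> [|||/or4P[|||/orP[]]] /eqP ep; subst p; rewrite ?eqxx // in p1 p2 p3;
    share_any T4 f.
have f7 : free a b' c.
  (* A single point is left over at [a]. If it is [b'], the partner of [c] is examined instead. *)
  have [z za part'] := H a; have [ez|bz] := eqVneq b' z.
    have [p [p1 p2 p3 f]] := part' c ltac:(distinct) ltac:(rewrite -ez; distinct).
    rewrite -ez in p2; have := all p; rewrite !inE.
    case/or4P=> [|||/or4P[|||/orP[]]] /eqP ep; subst p; rewrite ?eqxx // in p1 p2 p3;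
      share_any T4 f.
  have [p [p1 _ p3 f]] := part' b' ltac:(distinct) bz.
  have := all p; rewrite !inE.
  case/or4P=> [|||/or4P[|||/orP[]]] /eqP ep; subst p; rewrite ?eqxx // in p1 p3;
    share_any T4 f.
have f8 : free a' b c'.
  have [z za part'] := H a'; have [ez|bz] := eqVneq b z.
    have [p [p1 p2 p3 f]] := part' c' ltac:(distinct) ltac:(rewrite -ez; distinct).
    rewrite -ez in p2; have := all p; rewrite !inE.
    case/or4P=> [|||/or4P[|||/orP[]]] /eqP ep; subst p; rewrite ?eqxx // in p1 p2 p3;
      share_any T4 f.
  have [p [p1 _ p3 f]] := part' b ltac:(distinct) bz.
  have := all p; rewrite !inE.
  case/or4P=> [|||/or4P[|||/orP[]]] /eqP ep; subst p; rewrite ?eqxx // in p1 p3;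
    share_any T4 f.
exact: (moebius_kantor_determined T8 U).
Qed.

Lemma paired_determined2 j a a' b b' c c' e :
  uniq [:: j; a; a'; b; b'; c; c'; e] ->
  free j a a' -> free j b b' -> free j c c' -> free e a b ->
  (forall y, y != e -> y != j ->
     exists y', [/\ y' != e, y' != j, y' != y & free e y y']) ->
  determined [set: T] 16.
Proof.
move=> U f1 f2 f3 f4 part; move: (U); rewrite /= !inE !negb_or.
move=> /and5P[/and5P[? ? ? ? /and3P[? ? ?]] /and5P[? ? ? ? /andP[? ?]] /and5P[? ? ? ? ?] /and4P[? ? ? ?]].
move=> /and4P[/and3P[? ? ?] /andP[? ?] ? _].
have all y : y \in [:: j; a; a'; b; b'; c; c'; e] by apply: all_labels.
have [p [p1 p2 p3 f]] := part a' ltac:(distinct) ltac:(distinct).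
have := all p; rewrite !inE.
case/or4P=> [|||/or4P[|||/orP[]]] /eqP ep; subst p; rewrite ?eqxx // in p1 p2 p3;
  try share_any T4 f.
- have [p [p1' p2' p3' f']] := part c ltac:(distinct) ltac:(distinct).
  have := all p; rewrite !inE.
  case/or4P=> [|||/or4P[|||/orP[]]] /eqP ep; subst p; rewrite ?eqxx // in p1' p2' p3';
    share_any T4 f'.
- exact: (paired_determined3 U f1 f2 f3 f4 f part).
- by apply: (@paired_determined3 j a a' b b' c' c e) => //; [distinct | apply: free23].
Qed.

Lemma all_paired_determined : determined [set: T] 16.
Proof.
have [j _] := @exists_fresh [::] isT; have [e ej part] := H j.
have [a] := @exists_fresh [:: j; e] isT; rewrite !inE !negb_or => /andP[aj ae].
have [a' [a'j a'e a'a f1]] := part a aj ae.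
have [b] := @exists_fresh [:: j; e; a; a'] isT; rewrite !inE !negb_or.
move=> /and4P[bj be ba ba']; have [b' [b'j b'e b'b f2]] := part b bj be.
have b'a : b' != a by apply/eqP => eb; move: f2; rewrite eb => f2; share T4 f1 f2.
have b'a' : b' != a' by apply/eqP => eb; move: f2; rewrite eb => f2; share T4 f1 f2.
have [c] := @exists_fresh [:: j; e; a; a'; b; b'] isT; rewrite !inE !negb_or.
move=> /and5P[cj ce ca ca' /andP[cb cb']]; have [c' [c'j c'e c'c f3]] := part c cj ce.
have c'a : c' != a by apply/eqP => ec; move: f3; rewrite ec => f3; share T4 f1 f3.
have c'a' : c' != a' by apply/eqP => ec; move: f3; rewrite ec => f3; share T4 f1 f3.
have c'b : c' != b by apply/eqP => ec; move: f3; rewrite ec => f3; share T4 f2 f3.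
have c'b' : c' != b' by apply/eqP => ec; move: f3; rewrite ec => f3; share T4 f2 f3.
have U : uniq [:: j; a; a'; b; b'; c; c'; e] by distinct.
have all y : y \in [:: j; a; a'; b; b'; c; c'; e] by apply: all_labels.
have [z ze parte] := H e.
(* Being left over is symmetric: a partner [p] of [j] at [e] would give a free triple [e, j, p]
   sharing [j] and [p] with one of the three through [j]. *)
have jz : j = z.
  apply/eqP; apply: contraT => jz; exfalso.
  have [p [p1 _ p3 f]] := parte j ltac:(distinct) jz.
  have := all p; rewrite !inE.
  case/or4P=> [|||/or4P[|||/orP[]]] /eqP ep; subst p; rewrite ?eqxx // in p1 p3;
    share_any T4 f.
subst z.
have [p [p1 p2 p3 f]] := parte a ltac:(distinct) ltac:(distinct).
have := all p; rewrite !inE.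
case/or4P=> [|||/or4P[|||/orP[]]] /eqP ep; subst p; rewrite ?eqxx // in p1 p2 p3;
  try share_any T4 f.
- exact: (paired_determined2 U f1 f2 f3 f parte).
- by apply: (@paired_determined2 j a a' b' b c c' e) => //; [distinct | apply: free23].
- by apply: (@paired_determined2 j a a' c c' b b' e) => //; distinct.
- by apply: (@paired_determined2 j a a' c' c b b' e) => //; [distinct | apply: free23].
Qed.

End AllPaired.

Lemma eight_points_dichotomy :
  (exists j, determined3 (V j) j) \/ determined [set: T] 16.
Proof.
have [h|h] := pselect (exists j, determined3 (V j) j); [by left|right].
have H j : paired j \/ exists u, flagged j u.
  by apply: (paired_or_flagged T8) => dj; apply: h; exists j.
apply: all_paired_determined => j.
by case: (H j) => // -[u /(no_flagged H)].
Qed.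

End EightConclusion.

(** Once [v] vanishes on the triples inside [V], what remains lives on the triples through [j], and
    its values [v j k l] form a link solution. *)
Lemma determined_add (V : {set T}) (j : T) r : j \notin V ->
  determined V r -> determined3 V j -> determined (j |: V) (r + 3).
Proof.
move=> jV [E Er dE] [e1 [e2 [e3 d3]]].
exists (E ++ [:: (j, e1.1, e1.2); (j, e2.1, e2.2); (j, e3.1, e3.2)]).
  by rewrite size_cat leq_add2r.
move=> v hv v0.
have sub : {subset V <= j |: V} by move=> y yV; rewrite inE yV orbT.
have jS : j \in j |: V by rewrite !inE eqxx.
have hV : plucker_tangent V v.
  split; [exact: pt_12 hv|exact: pt_23 hv|].
  by move=> i a b c d U S; apply: (pt_rel hv U) => y /S /sub.
have vV : forall a b c, a \in V -> b \in V -> c \in V -> uniq [:: a; b; c] -> v a b c = 0.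
  by apply: dE hV _ => a b c abc; apply: v0; rewrite mem_cat abc.
have vcyc p q s : v q s p = v p q s by rewrite (pt_23 hv) (pt_12 hv).
pose u k l := if [&& k \in V, l \in V & k != l] then v j k l else 0.
have uE k l : k \in V -> l \in V -> k != l -> u k l = v j k l.
  by rewrite /u => -> -> ->.
have hu : link_tangent V j u.
  split.
  - by move=> k l; rewrite /u (eq_sym l) andbCA (pt_23 hv).
  - by move=> k l; rewrite /u; case: ifP => [/and3P[]//|]; rewrite eqxx.
  - move=> i k l m U S; have Uj := uniq_cons_j jV S U.
    have iV : i \in V by apply: S; rewrite !inE eqxx.
    have kV : k \in V by apply: S; rewrite !inE eqxx orbT.
    have lV : l \in V by apply: S; rewrite !inE eqxx !orbT.
    have mV : m \in V by apply: S; rewrite !inE eqxx !orbT.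
    move: Uj; rewrite /= !inE !negb_or.
    move=> /and5P[/and4P[? ? ? ?] /and3P[? ? ?] /andP[? ?] ? _].
    rewrite !uE //.
    have /(pt_rel hv (i := i) (a := j) (b := k) (c := l) (d := m) ltac:(distinct)) :
        {subset [:: i; j; k; l; m] <= j |: V}.
      by move=> y; rewrite !inE => /orP[/eqP->|/or4P[]/eqP->]; rewrite ?eqxx ?iV ?kV ?lV ?mV ?orbT.
    rewrite (pt_12 hv j i k) (pt_12 hv j i l) (pt_12 hv j i m).
    by rewrite (vV i l m) ?(vV i m k) ?(vV i k l) ?addr0 //; distinct.
  - move=> k l m n U S; have Uj := uniq_cons_j jV S U.
    have kV : k \in V by apply: S; rewrite !inE eqxx.
    have lV : l \in V by apply: S; rewrite !inE eqxx orbT.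
    have mV : m \in V by apply: S; rewrite !inE eqxx !orbT.
    have nV : n \in V by apply: S; rewrite !inE eqxx !orbT.
    move: (Uj); rewrite /= !inE !negb_or.
    move=> /and5P[/and4P[? ? ? ?] /and3P[? ? ?] /andP[? ?] ? _].
    rewrite !uE //; try by rewrite eq_sym.
    apply: (pt_rel hv Uj).
    by move=> y; rewrite !inE => /orP[/eqP->|/or4P[]/eqP->]; rewrite ?eqxx ?kV ?lV ?mV ?nV ?orbT.
have z e : (j, e.1, e.2) \in E ++ [:: (j, e1.1, e1.2); (j, e2.1, e2.2); (j, e3.1, e3.2)] ->
    u e.1 e.2 = 0.
  by move=> eI; rewrite /u; case: ifP => // _; apply: v0.
have u0 : forall k l, u k l = 0.
  by apply: d3 hu _ _ _; apply: z; rewrite mem_cat !inE eqxx ?orbT.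
have vj k l : k \in V -> l \in V -> k != l -> v j k l = 0.
  by move=> kV lV kl; rewrite -uE.
move=> a b c; rewrite !inE => aS bS cS /= /and3P[]; rewrite !inE negb_or.
move=> /andP[ab ac] bc _.
case/orP: aS => [/eqP ea|aV].
  subst a; apply: vj => //; first by case/orP: bS => // /eqP eb; rewrite eb eqxx in ab.
  by case/orP: cS => // /eqP ec; rewrite ec eqxx in ac.
case/orP: bS => [/eqP eb|bV].
  subst b; rewrite (pt_12 hv); apply: vj => //.
  by case/orP: cS => // /eqP ec; rewrite ec eqxx in bc.
case/orP: cS => [/eqP ec|cV].
  by subst c; rewrite -vcyc -vcyc vj.
by apply: vV => //=; rewrite !inE negb_or ab ac bc.
Qed.

(** [3 * n + 1] is the dimension of the cone over Gr(3, n + 3). Up to six points any point can be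
    deleted; on seven, failure at every point would put each pair in a free triple, which
    [no_partners7] excludes. *)
Lemma determined_subset (n : nat) (S : {set T}) : #|S| = (n + 3)%N -> (n <= 4)%N ->
  determined S (3 * n + 1).
Proof.
elim: n S => [|n IH] S cS n4.
  move: cS; rewrite cardE; have := enum_uniq S; have := mem_enum S.
  case: (enum S) => [|a [|b [|c []]]] // memE U _.
  exists [:: (a, b, c)] => // v hv v0 p q r pS qS rS.
  rewrite -!memE in pS qS rS.
  apply: (@symmetric3_sorted (fun y => y = 0) v [:: a; b; c] a (pt_12 hv) (pt_23 hv)) => //.
  move=> [|[|[|i]]] [|[|[|k]]] [|[|[|l]]] //= _ _ _.
  by apply: v0; rewrite inE.
suff [j jS d3] : exists2 j, j \in S & determined3 (S :\ j) j.
  have jV : j \notin S :\ j by rewrite !inE eqxx.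
  rewrite -(setD1K jS) (_ : (3 * n.+1 + 1 = 3 * n + 1 + 3)%N); last by lia.
  apply: determined_add => //; apply: IH; last exact: ltnW.
  by move: cS; rewrite (cardsD1 j) jS addSn => -[].
have [n3|n3] := leqP n 2.
  have /card_gt0P[j jS] : (0 < #|S|)%N by rewrite cS.
  exists j => //; apply: determined3_small; first by rewrite !inE eqxx.
  by move: cS; rewrite (cardsD1 j) jS addSn add1n => -[->]; rewrite (leq_add2r 3 n 2).
have en : n = 3%N by apply/eqP; rewrite eqn_leq n3 -ltnS n4.
have S7 : #|S| = 7%N by rewrite cS en.
apply: contrapT => nd; apply: (no_partners7 S7) => j y jS yS yj.
have jV : j \notin S :\ j by rewrite !inE eqxx.
have V6 : #|S :\ j| = 6%N by move: S7; rewrite (cardsD1 j) jS => -[].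
have nj : ~ determined3 (S :\ j) j by move=> dj; apply: nd; exists j.
have [|y' y'I f] := @determined3_partner6 (S :\ j) j jV V6 nj y.
  by rewrite !inE yj.
exists y'; move: y'I f; rewrite (setD1K jS) !inE => /and3P[? ? ?] f.
by split.
Qed.

Theorem plucker_tangent_determined : #|T| = 8%N -> determined [set: T] 16.
Proof.
move=> T8; case: (eight_points_dichotomy T8) => // -[j d3].
(* 13 is [3 * 4 + 1], the count for the seven remaining points. *)
rewrite -(setUCr [set j]); apply: (@determined_add _ _ 13) => //.
  by rewrite !inE eqxx.
by apply: (determined_subset (n := 4)) => //; rewrite cardsC1 T8.
Qed.
End ThreeTermSystem.

Local Open Scope classical_set_scope.
Local Open Scope ring_scope.

(** * Ideals of Noetherian rings *)

Section Ideals.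
Variable A : comNzRingType.
Implicit Types (J S : set A).

Record is_ideal J : Prop := IsIdeal {
  ideal0 : J 0;
  idealMD : forall a f g, J f -> J g -> J (a * f + g) }.

Lemma idealM J a f : is_ideal J -> J f -> J (a * f).
Proof. by move=> iJ Jf; rewrite -[_ * _]addr0; apply: idealMD => //; apply: ideal0. Qed.

Lemma idealD J f g : is_ideal J -> J f -> J g -> J (f + g).
Proof. by move=> iJ Jf Jg; rewrite -[f]mul1r; apply: idealMD. Qed.

Lemma idealN J f : is_ideal J -> J f -> J (- f).
Proof. by move=> iJ Jf; rewrite -mulN1r; apply: idealM. Qed.

Lemma idealB J f g : is_ideal J -> J f -> J g -> J (f - g).
Proof. by move=> iJ Jf Jg; apply: idealD => //; apply: idealN. Qed.

Lemma ideal_sum J (I : Type) (r : seq I) (P : pred I) (F : I -> A) :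
  is_ideal J -> (forall i, P i -> J (F i)) -> J (\sum_(i <- r | P i) F i).
Proof.
move=> iJ JF; elim/big_ind: _ => [||i Pi]; [exact: ideal0 | by move=> f g; apply: idealD|].
exact: JF.
Qed.

Lemma ideal_gen_ideal S : is_ideal (ideal_gen S).
Proof. by split; [exact: ideal_gen0|exact: ideal_genMD]. Qed.

Lemma ideal_gen_id S : S `<=` ideal_gen S.
Proof.
move=> f Sf; exists 1%N, (fun=> 1), (fun=> f); split=> //.
by rewrite big_ord1 mul1r.
Qed.

Lemma ideal_gen_min S J : is_ideal J -> S `<=` J -> ideal_gen S `<=` J.
Proof.
move=> iJ SJ f [n [a [s [Ss ->]]]]; apply: ideal_sum => // i _.
by apply: idealM => //; apply: SJ.
Qed.

Lemma ideal_genS S S' : S `<=` S' -> ideal_gen S `<=` ideal_gen S'.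
Proof.
move=> SS'; apply: ideal_gen_min; first exact: ideal_gen_ideal.
by move=> f /SS'; apply: ideal_gen_id.
Qed.

Definition noetherian : Prop := forall J, is_ideal J ->
  exists2 s : seq A, (forall f, f \in s -> J f) & J `<=` ideal_gen [set f | f \in s].

Lemma noetherian_range (nA : noetherian) J : is_ideal J ->
  exists n (g : 'I_n -> A), J = ideal_gen (range g).
Proof.
move=> iJ; have [s sJ Js] := nA J iJ.
exists (size s), (fun i => nth 0 s i); apply/seteqP; split.
  apply: subset_trans Js _; apply: ideal_genS => f /= fs.
  by rewrite -index_mem in fs; exists (Ordinal fs) => //=; rewrite nth_index // -index_mem.
by apply: ideal_gen_min => // _ [i _ <-]; apply: sJ; apply: mem_nth.
Qed.

(** Without a maximal element, dependent choice builds a strictly increasing chain; its union is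
    finitely generated, hence reached at a finite stage. *)
Lemma noetherian_maximal (nA : noetherian) (P : set A -> Prop) J0 :
  is_ideal J0 -> P J0 -> exists J, [/\ is_ideal J, P J, J0 `<=` J &
    forall J', is_ideal J' -> P J' -> J `<=` J' -> J' = J].
Proof.
move=> iJ0 PJ0; apply: contrapT => nmax.
pose Q := {J : set A | is_ideal J /\ P J /\ J0 `<=` J}.
have next (q : Q) : {q' : Q | sval q `<=` sval q' /\ ~ (sval q' `<=` sval q)}.
  apply/cid; case: q => J [iJ [PJ J0J]] /=; apply: contrapT => H; apply: nmax.
  exists J; split=> // J' iJ' PJ' JJ'; apply/seteqP; split=> //.
  apply: contrapT => nJ; apply: H.
  by exists (exist _ J' (conj iJ' (conj PJ' (subset_trans J0J JJ')))).
have q0 : Q by exists J0; split=> //; split=> //; exact: subset_refl.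
pose c n := iter n (fun q => sval (next q)) q0.
have cS n : sval (c n) `<=` sval (c n.+1) /\ ~ (sval (c n.+1) `<=` sval (c n)).
  by rewrite /c /=; case: (next _).
have mono m n : (m <= n)%N -> sval (c m) `<=` sval (c n).
  elim: n => [|n IH]; first by rewrite leqn0 => /eqP->.
  rewrite leq_eqVlt => /orP[/eqP->//|]; rewrite ltnS => /IH.
  by move=> h; apply: subset_trans h (cS n).1.
have ic n : is_ideal (sval (c n)) by case: (svalP (c n)).
pose U := [set f | exists n, sval (c n) f].
have iU : is_ideal U.
  split; first by exists 0%N; apply: ideal0 (ic _).
  move=> a f g [m fm] [n gn]; exists (maxn m n); apply: idealMD.
  - exact: ic.
  - exact: mono (leq_maxl m n) _ fm.
  - exact: mono (leq_maxr m n) _ gn.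
have [s sU Us] := nA U iU.
have [N sN] : exists N, forall f, f \in s -> sval (c N) f.
  elim: s sU {Us} => [|f s IH] sU; first by exists 0%N.
  have [N hN] := IH (fun g gs => sU g (mem_behead (s := f :: s) gs)).
  have [m fm] := sU f (mem_head _ _); exists (maxn m N) => g.
  rewrite inE => /orP[/eqP->|/hN]; first exact: mono (leq_maxl m N) _ fm.
  exact: mono (leq_maxr m N) _.
have [_] := cS N; apply => f fN; have : U f by exists N.+1.
move=> /Us; have : ideal_gen [set f | f \in s] `<=` sval (c N) by apply: ideal_gen_min.
by apply.
Qed.

End Ideals.

Lemma noetherian_surj (A B : comNzRingType) (h : {rmorphism A -> B}) :
  (forall y, exists x, h x = y) -> noetherian A -> noetherian B.
Proof.
move=> surj nA J iJ.
have iJ' : is_ideal [set f | J (h f)].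
  split=> /=; first by rewrite rmorph0; apply: ideal0.
  by move=> a f g Jf Jg; rewrite rmorphD rmorphM; apply: idealMD.
have [s sJ Js] := nA _ iJ'; exists [seq h f | f <- s].
  by move=> _ /mapP[f fs ->]; apply: sJ.
move=> g; have [f <-] := surj g => /Js [n [a [t [ts ->]]]].
rewrite rmorph_sum; apply: ideal_sum => [|i _]; first exact: ideal_gen_ideal.
rewrite rmorphM; apply: idealM; first exact: ideal_gen_ideal.
by apply: ideal_gen_id => /=; apply: map_f; apply: ts.
Qed.

Lemma noetherian_field (k : fieldType) : noetherian k.
Proof.
move=> J iJ; have [[x Jx x0]|nJ] := pselect (exists2 x, J x & x != 0).
  exists [:: x] => [f|f _]; first by rewrite inE => /eqP->.
  rewrite -(divfK x0 f); apply: idealM; first exact: ideal_gen_ideal.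
  by apply: ideal_gen_id; rewrite /= inE.
exists [::] => // f Jf; have [->|f0] := eqVneq f 0; first exact: ideal_gen0.
by case: nJ; exists f.
Qed.

(* Hilbert's basis theorem: generators of the ideals of leading coefficients
   in degree at most [D], where these ideals have become stationary, lift to
   generators. *)
Lemma noetherian_poly (A : comNzRingType) : noetherian A -> noetherian {poly A}.
Proof.
move=> nA J iJ.
pose L (G : set {poly A}) d : set A :=
  [set a | exists p, [/\ G p, (size p <= d.+1)%N & p`_d = a]].
have iL G d : is_ideal G -> is_ideal (L G d).
  move=> iG; split; first by exists 0; rewrite size_poly0 coef0; split=> //; apply: ideal0.
  move=> a _ _ [p [Gp sp <-]] [q [Gq sq <-]]; exists (a%:P * p + q); split.
  - exact: idealMD.
  - rewrite (leq_trans (size_polyD _ _)) // geq_max sq andbT mul_polyC.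
    exact: leq_trans (size_scale_leq _ _) sp.
  - by rewrite coefD coefCM.
have LX G d e : is_ideal G -> (d <= e)%N -> L G d `<=` L G e.
  move=> iG de _ [p [Gp sp <-]]; exists ('X^(e - d) * p); split.
  - exact: idealM.
  - have [->|p0] := eqVneq p 0; first by rewrite mulr0 size_poly0.
    by rewrite size_monicM ?monicXn // size_polyXn; move: sp; lia.
  - by rewrite coefXnM ltnNge leq_subr /= subKn.
pose U := [set a | exists d, L J d a].
have iU : is_ideal U.
  split; first by exists 0%N; apply: ideal0; apply: iL.
  move=> a f g [d fd] [e ge]; exists (maxn d e); apply: idealMD; first exact: iL.
    exact: LX (leq_maxl d e) _ fd.
  exact: LX (leq_maxr d e) _ ge.
have [D UD] : exists D, U `<=` L J D.
  have [s sU Us] := nA _ iU.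
  have [D sD] : exists D, forall f, f \in s -> L J D f.
    elim: s sU {Us} => [|f s IH] sU; first by exists 0%N.
    have [N hN] := IH (fun g gs => sU g (mem_behead (s := f :: s) gs)).
    have [m fm] := sU f (mem_head _ _); exists (maxn m N) => g.
    rewrite inE => /orP[/eqP->|/hN]; first exact: LX (leq_maxl m N) _ fm.
    exact: LX (leq_maxr m N) _.
  by exists D; apply: subset_trans Us _; apply: ideal_gen_min => //; apply: iL.
have [G GJ GL] : exists2 G : seq {poly A}, (forall p, p \in G -> J p) &
    forall d, (d <= D)%N -> L J d `<=` L (ideal_gen [set p | p \in G]) d.
  have [n nD] : exists n, n = D.+1 by exists D.+1.
  suff [G GJ GL] : exists2 G : seq {poly A}, (forall p, p \in G -> J p) &
      forall d, (d < n)%N -> L J d `<=` L (ideal_gen [set p | p \in G]) d.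
    by exists G => // d dD; apply: GL; rewrite nD.
  elim: n {nD} => [|n [G GJ GL]]; first by exists [::].
  have [s sL Ls] := nA _ (iL J n iJ).
  have [t tJ tL] : exists2 t : seq {poly A}, (forall p, p \in t -> J p) &
      forall a, a \in s -> L [set p | p \in t] n a.
    elim: s sL {Ls} => [|f s IH] sL; first by exists [::].
    have [t tJ tL] := IH (fun g gs => sL g (mem_behead (s := f :: s) gs)).
    have [p [Jp sp pf]] := sL f (mem_head _ _); exists (p :: t).
      by move=> q; rewrite inE => /orP[/eqP->//|/tJ].
    move=> a; rewrite inE => /orP[/eqP->|/tL [q [qt sq qa]]].
      by exists p; split=> //=; rewrite mem_head.
    by exists q; split=> //=; rewrite inE qt orbT.
  exists (G ++ t) => [p|d]; first by rewrite mem_cat => /orP[/GJ|/tJ].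
  have mono S S' e : S `<=` S' -> L S e `<=` L S' e.
    by move=> SS' _ [p [Sp sp <-]]; exists p; split=> //; apply: SS'.
  rewrite ltnS leq_eqVlt => /orP[/eqP->|/GL h]; last first.
    apply: subset_trans h _; apply: mono; apply: ideal_genS => p /=.
    by rewrite mem_cat => ->.
  apply: subset_trans Ls _; apply: ideal_gen_min; first exact/iL/ideal_gen_ideal.
  move=> a /tL; apply: mono => p /= pt; apply: ideal_gen_id => /=.
  by rewrite mem_cat pt orbT.
exists G => // p; have [n] := ubnP (size p); elim: n p => // n IH p.
rewrite ltnS leq_eqVlt => /orP[/eqP sp|]; last exact: IH.
move=> Jp; case: n sp IH => [/eqP|n sp IH].
  by rewrite size_poly_eq0 => /eqP-> _; apply: ideal_gen0.
have iG := ideal_gen_ideal [set p | p \in G].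
have : L (ideal_gen [set p | p \in G]) n p`_n.
  have Lp : L J n p`_n by exists p; rewrite sp.
  have [nD|/ltnW Dn] := leqP n D; first exact: GL.
  apply: LX Dn _ _ => //; apply: GL => //; apply: UD; by exists n.
move=> [q [Gq sq qp]]; rewrite -(subrK q p); apply: idealD => //; apply: IH.
  rewrite ltnS; apply/leq_sizeP => i; rewrite leq_eqVlt => /orP[/eqP<-|ni].
    by rewrite coefB qp subrr.
  by rewrite coefB !nth_default ?subrr ?sp //; apply: leq_trans sq _.
by apply: idealB => //; apply: ideal_gen_min Gq => // r; apply: GJ.
Qed.

Lemma image_prod (A B : comNzRingType) (h : {rmorphism A -> B}) (I : Type)
    (r : seq I) (F : I -> B) :
  (forall i, exists x, h x = F i) -> exists x, h x = \prod_(i <- r) F i.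
Proof.
move=> hF; elim: r => [|i r [x xr]]; first by exists 1; rewrite big_nil rmorph1.
by have [y yi] := hF i; exists (y * x); rewrite big_cons rmorphM yi xr.
Qed.

Lemma image_sum (A B : comNzRingType) (h : {rmorphism A -> B}) (I : Type)
    (r : seq I) (F : I -> B) :
  (forall i, exists x, h x = F i) -> exists x, h x = \sum_(i <- r) F i.
Proof.
move=> hF; elim: r => [|i r [x xr]]; first by exists 0; rewrite big_nil rmorph0.
by have [y yi] := hF i; exists (y + x); rewrite big_cons rmorphD yi xr.
Qed.

Lemma noetherian_mpoly (k : fieldType) n : noetherian (mpoly.mpoly n k).
Proof.
elim: n => [|n IH].
  apply: (@noetherian_surj k _ (@mpoly.mpolyC 0 k)) => [p|]; last exact: noetherian_field.
  by exists (mpoly.mcoeff mpoly.mnm0 p); rewrite [RHS]mpoly.nvar0_mpolyC.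
pose h : {rmorphism {poly mpoly.mpoly n k} -> mpoly.mpoly n.+1 k} :=
  horner_eval (mpoly.mpolyX k (mpoly.mnm1 ord_max)) \o map_poly (@mpoly.mwiden n k).
apply: (@noetherian_surj _ _ h) (noetherian_poly IH) => p.
have hC c : h (mpoly.mpolyC n c)%:P = mpoly.mpolyC n.+1 c.
  by rewrite /h /= /horner_eval map_polyC hornerC /= mpoly.mwidenC.
have hX i : exists x, h x = mpoly.mpolyX k (mpoly.mnm1 i).
  have [ni|/negbTE ni] := boolP (i < n)%N.
    exists (mpoly.mpolyX k (mpoly.mnm1 (Ordinal ni)))%:P.
    rewrite /h /= /horner_eval map_polyC hornerC /= mpoly.mwidenX mpoly.mnmwiden1.
    by congr (mpoly.mpolyX k (mpoly.mnm1 _)); apply: val_inj.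
  exists 'X; rewrite /h /= /horner_eval map_polyX hornerX.
  congr (mpoly.mpolyX k (mpoly.mnm1 _)); apply: val_inj => /=.
  by have := ltn_ord i; lia.
rewrite [p]mpoly.mpolyE; apply: image_sum => m.
rewrite -mpoly.mul_mpolyC mpoly.mpolyXE_id.
have [x xm] : exists x, h x = \prod_(i < n.+1) mpoly.mpolyX k (mpoly.mnm1 i) ^+ mpoly.fun_of_multinom m i.
  apply: image_prod => i; have [x <-] := hX i.
  by exists (x ^+ mpoly.fun_of_multinom m i); rewrite rmorphXn.
by exists ((mpoly.mpolyC n (mpoly.mcoeff m p))%:P * x); rewrite rmorphM hC xm.
Qed.

(** * Group algebras, weights and closed points of the torus *)

Section Monomials.
Local Open Scope fset_scope.
Local Open Scope ring_scope.
Variables (k : comNzRingType) (M : zmodType).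
Local Notation A := (grpalg k M).

Definition gaX (u : M) : A := << 1 *g u >>.

Lemma gaX0 : gaX 0 = 1. Proof. by []. Qed.

Lemma gaXD u v : gaX (u + v) = gaX u * gaX v.
Proof. by rewrite /gaX -[RHS]/(gamul _ _) gamulUU mulr1. Qed.

Lemma gaXN u : gaX (- u) * gaX u = 1.
Proof. by rewrite -gaXD addNr gaX0. Qed.

Lemma gaZX c u : c *: gaX u = << c *g u >>.
Proof.
apply/malgP => v; rewrite mcoeffZ !mcoeffU.
by case: eqP; rewrite ?mulr1n ?mulr0n ?mulr1 ?mulr0.
Qed.

Lemma gaXE (f : A) : f = \sum_(u <- msupp f) f@_u *: gaX u.
Proof. by rewrite [LHS]gaE; apply: eq_bigr => u _; rewrite gaZX. Qed.

Lemma ga_ind (P : A -> Prop) : P 0 -> (forall c u f, P f -> P (c *: gaX u + f)) ->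
  forall f, P f.
Proof.
move=> P0 PD f; rewrite [f]gaXE; elim: (X in \sum_(_ <- X) _) => [|u r IH].
  by rewrite big_nil.
by rewrite big_cons; apply: PD.
Qed.

Section Linear.
Variables (V : lmodType k) (phi : M -> V).

Definition galin (f : A) : V := \sum_(u <- msupp f) f@_u *: phi u.

Lemma galinw (d : {fset M}) f : msupp f `<=` d ->
  galin f = \sum_(u <- d) f@_u *: phi u.
Proof.
move=> le; rewrite /galin (big_fset_incl _ le) // => u _ /mcoeff_outdom ->.
by rewrite scale0r.
Qed.

Lemma galinP c f g : galin (c *: f + g) = c *: galin f + galin g.
Proof.
have le : msupp (c *: f + g) `<=` msupp f `|` msupp g.
  apply: fsubset_trans (msuppD_le _ _) _; apply: fsetUSS => //.
  exact: msuppZ_le.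
rewrite (galinw le) (galinw (fsubsetUl (msupp f) (msupp g))).
rewrite (galinw (fsubsetUr (msupp f) (msupp g))) scaler_sumr -big_split /=.
by apply: eq_bigr => u _; rewrite mcoeffD mcoeffZ scalerDl scalerA.
Qed.

Lemma galin0 : galin 0 = 0. Proof. by rewrite /galin msupp0 big_seq_fset0. Qed.

Lemma galinD f g : galin (f + g) = galin f + galin g.
Proof. by rewrite -[f]scale1r galinP !scale1r. Qed.

Lemma galinZ c f : galin (c *: f) = c *: galin f.
Proof. by rewrite -[_ *: _]addr0 galinP galin0 addr0. Qed.

Lemma galin_sum (I : Type) (r : seq I) (F : I -> A) :
  galin (\sum_(i <- r) F i) = \sum_(i <- r) galin (F i).
Proof. exact: (big_morph galin galinD galin0). Qed.

Lemma galinX u : galin (gaX u) = phi u.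
Proof. by rewrite /galin msuppU oner_eq0 big_seq_fset1 mcoeffUU scale1r. Qed.

End Linear.

Section Eval.
Variables (B : comNzRingType) (iota : {rmorphism k -> B}) (chi : M -> B).
Hypothesis chi0 : chi 0 = 1.
Hypothesis chiD : forall u v, chi (u + v) = chi u * chi v.

Definition gaev (f : A) : B := \sum_(u <- msupp f) iota f@_u * chi u.

Lemma gaevw (d : {fset M}) f : msupp f `<=` d ->
  gaev f = \sum_(u <- d) iota f@_u * chi u.
Proof.
move=> le; rewrite /gaev (big_fset_incl _ le) // => u _ /mcoeff_outdom ->.
by rewrite rmorph0 mul0r.
Qed.

Lemma gaevZD c f g : gaev (c *: f + g) = iota c * gaev f + gaev g.
Proof.
have le : msupp (c *: f + g) `<=` msupp f `|` msupp g.
  apply: fsubset_trans (msuppD_le _ _) _; apply: fsetUSS => //.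
  exact: msuppZ_le.
rewrite (gaevw le) (gaevw (fsubsetUl (msupp f) (msupp g))).
rewrite (gaevw (fsubsetUr (msupp f) (msupp g))) mulr_sumr -big_split /=.
by apply: eq_bigr => u _; rewrite mcoeffD mcoeffZ rmorphD rmorphM mulrDl mulrA.
Qed.

Lemma gaevX u : gaev (gaX u) = chi u.
Proof. by rewrite /gaev msuppU oner_eq0 big_seq_fset1 mcoeffUU rmorph1 mul1r. Qed.

Lemma gaev0 : gaev 0 = 0. Proof. by rewrite /gaev msupp0 big_seq_fset0. Qed.

Lemma gaevD f g : gaev (f + g) = gaev f + gaev g.
Proof. by rewrite -[f]scale1r gaevZD rmorph1 mul1r scale1r. Qed.

Lemma gaevZ c f : gaev (c *: f) = iota c * gaev f.
Proof. by rewrite -[_ *: _]addr0 gaevZD gaev0 addr0. Qed.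

Lemma gaev1 : gaev 1 = 1. Proof. by rewrite -gaX0 gaevX. Qed.

Lemma gaevM f g : gaev (f * g) = gaev f * gaev g.
Proof.
elim/ga_ind: f => [|c u f IH]; first by rewrite mul0r gaev0 mul0r.
rewrite mulrDl gaevD IH gaevZD mulrDl; congr (_ + _); rewrite -scalerAl gaevZ.
rewrite -mulrA; congr (_ * _); rewrite gaevX.
elim/ga_ind: g {f IH} => [|d v g IH]; first by rewrite mulr0 gaev0 mulr0.
by rewrite mulrDr gaevD IH -scalerAr -gaXD gaevZ gaevZD !gaevX chiD; ring.
Qed.

Lemma gaevN f : gaev (- f) = - gaev f.
Proof. by apply/eqP; rewrite -addr_eq0 -gaevD addNr gaev0. Qed.

Lemma gaevB f g : gaev (f - g) = gaev f - gaev g.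
Proof. by rewrite gaevD gaevN. Qed.

End Eval.

Section Derivation.
Variable delta : M -> k.
Hypothesis deltaD : forall u v, delta (u + v) = delta u + delta v.

(** The invariant vector field of the torus attached to the additive map [delta]. It is diagonal on
    monomials, so it commutes with taking parts of a given weight. *)
Definition gader : A -> A := galin (fun u => delta u *: gaX u).

Lemma gader0 : gader 0 = 0. Proof. exact: galin0. Qed.
Lemma gaderD f g : gader (f + g) = gader f + gader g. Proof. exact: galinD. Qed.
Lemma gaderZ c f : gader (c *: f) = c *: gader f. Proof. exact: galinZ. Qed.

Lemma gaderX u : gader (gaX u) = delta u *: gaX u.
Proof. exact: galinX. Qed.

Lemma mcoeff_gader f u : (gader f)@_u = delta u * f@_u.
Proof.
elim/ga_ind: f => [|c v f IH]; first by rewrite gader0 !mcoeff0 mulr0.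
rewrite gaderD gaderZ gaderX !(mcoeffD, mcoeffZ) IH mulrDr !mcoeffU.
have [->|_] := eqVneq v u; first by rewrite mulrCA.
by rewrite !mulr0.
Qed.

Lemma gaderM f g : gader (f * g) = gader f * g + f * gader g.
Proof.
elim/ga_ind: f => [|c u f IH]; first by rewrite !(mul0r, gader0) addr0.
rewrite mulrDl gaderD IH gaderD gaderZ !mulrDl addrACA; congr (_ + _).
rewrite -!scalerAl gaderZ -scalerDr; congr (_ *: _); rewrite gaderX.
elim/ga_ind: g {f IH} => [|d v g IH]; first by rewrite !(mulr0, gader0) addr0.
rewrite mulrDr gaderD IH gaderD gaderZ !mulrDr addrACA; congr (_ + _).
rewrite -!scalerAr gaderZ -scalerDr; congr (_ *: _).
by rewrite -gaXD !gaderX deltaD scalerDl -scalerAl -scalerAr gaXD.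
Qed.

End Derivation.

End Monomials.

Section Weights.
Local Open Scope fset_scope.
Local Open Scope ring_scope.
Variables (k : comNzRingType) (M : zmodType) (R : realDomainType) (wt : M -> R).
Hypothesis wtD : forall u v, wt (u + v) = wt u + wt v.
Local Notation A := (grpalg k M).

(** A lower bound in place of the exact minimal weight: bounds add under products and survive
    cancellation in sums. The part of weight [t] is then multiplicative, at the price of being
    possibly zero. *)
Definition weight_ge (t : R) (f : A) : Prop := forall u, f@_u != 0 -> t <= wt u.

Definition weight_part (t : R) : A -> A :=
  galin (fun u => if wt u == t then gaX k u else 0).

Lemma weight_part_0 t : weight_part t 0 = 0. Proof. exact: galin0. Qed.
Lemma weight_partD t f g : weight_part t (f + g) = weight_part t f + weight_part t g.
Proof. exact: galinD. Qed.
Lemma weight_partZ t c f : weight_part t (c *: f) = c *: weight_part t f.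
Proof. exact: galinZ. Qed.
Lemma weight_part_sum t (I : Type) (r : seq I) (F : I -> A) :
  weight_part t (\sum_(i <- r) F i) = \sum_(i <- r) weight_part t (F i).
Proof. exact: galin_sum. Qed.

Lemma weight_partX t u : weight_part t (gaX k u) = if wt u == t then gaX k u else 0.
Proof. exact: galinX. Qed.

Lemma mcoeff_weight_part t f u :
  (weight_part t f)@_u = if wt u == t then f@_u else 0.
Proof.
elim/ga_ind: f => [|c v f IH]; first by rewrite weight_part_0 mcoeff0 if_same.
rewrite weight_partD weight_partZ mcoeffD IH mcoeffZ weight_partX mcoeffD mcoeffZ.
have -> : (if wt v == t then gaX k v else 0)@_u = if wt u == t then (gaX k v)@_u else 0.
  have [->|vu] := eqVneq v u; first by case: ifP; rewrite ?mcoeff0.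
  have vu0 : (gaX k v)@_u = 0 by rewrite mcoeffU (negPf vu).
  by rewrite vu0 if_same; case: ifP; rewrite ?mcoeff0.
by case: ifP; rewrite ?mulr0 ?addr0.
Qed.

Lemma weight_ge_ind t (P : A -> Prop) : P 0 ->
  (forall c u f, t <= wt u -> P f -> P (c *: gaX k u + f)) ->
  forall f, weight_ge t f -> P f.
Proof.
move=> P0 PD f tf; rewrite [f]gaXE.
have : forall u, u \in (msupp f : seq M) -> t <= wt u.
  by move=> u uf; apply: tf; rewrite mcoeff_neq0.
elim: (msupp f : seq M) => [|u r IH] tr; first by rewrite big_nil.
rewrite big_cons; apply: PD; first by apply: tr; rewrite mem_head.
by apply: IH => v vr; apply: tr; rewrite inE vr orbT.
Qed.

Lemma weight_ge0 t : weight_ge t 0.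
Proof. by move=> u; rewrite mcoeff0 eqxx. Qed.

Lemma weight_geD t f g : weight_ge t f -> weight_ge t g -> weight_ge t (f + g).
Proof.
move=> hf hg u; rewrite mcoeffD.
have [->|/hf//] := eqVneq (f@_u) 0; by rewrite add0r => /hg.
Qed.

Lemma weight_geZ t c f : weight_ge t f -> weight_ge t (c *: f).
Proof.
move=> hf u; rewrite mcoeffZ; have [->|/hf//] := eqVneq (f@_u) 0.
by rewrite mulr0 eqxx.
Qed.

Lemma weight_geX t u : t <= wt u -> weight_ge t (gaX k u).
Proof.
move=> tu v; have [<-//|uv] := eqVneq u v.
by rewrite mcoeffU (negPf uv) eqxx.
Qed.

Lemma weight_geM s t f g : weight_ge s f -> weight_ge t g ->
  weight_ge (s + t) (f * g).
Proof.
move=> hf hg; elim/weight_ge_ind: hf => [|c u f' su IH].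
  by rewrite mul0r; apply: weight_ge0.
rewrite mulrDl; apply: weight_geD IH; rewrite -scalerAl; apply: weight_geZ.
elim/weight_ge_ind: hg => [|d v g' tv IH]; first by rewrite mulr0; apply: weight_ge0.
rewrite mulrDr; apply: weight_geD IH; rewrite -scalerAr; apply: weight_geZ.
by rewrite -gaXD; apply: weight_geX; rewrite wtD lerD.
Qed.

Lemma weight_partM s t f g : weight_ge s f -> weight_ge t g ->
  weight_part (s + t) (f * g) = weight_part s f * weight_part t g.
Proof.
move=> hf hg; elim/weight_ge_ind: hf => [|c u f' su IH].
  by rewrite mul0r !weight_part_0 mul0r.
rewrite mulrDl weight_partD IH weight_partD weight_partZ mulrDl; congr (_ + _).
rewrite -!scalerAl weight_partZ; congr (_ *: _) => {IH f'}.
elim/weight_ge_ind: hg => [|d v g' tv IH]; first by rewrite mulr0 !weight_part_0 mulr0.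
rewrite mulrDr weight_partD IH weight_partD weight_partZ mulrDr; congr (_ + _).
rewrite -!scalerAr weight_partZ; congr (_ *: _).
rewrite -gaXD !weight_partX wtD.
have [->|us] := eqVneq (wt u) s.
  by rewrite (inj_eq (addrI _)); case: eqP => // _; rewrite ?gaXD ?mulr0.
rewrite mul0r; case: eqP => // e; move: us; rewrite eq_le su andbT => /negP[].
by rewrite -(lerD2r t) -e lerD2l.
Qed.

Lemma weight_ge_der (delta : M -> k) t f : weight_ge t f ->
  weight_ge t (gader delta f).
Proof.
move=> hf; elim/weight_ge_ind: hf => [|c u f' su IH].
  by rewrite gader0; apply: weight_ge0.
rewrite gaderD gaderZ; apply: weight_geD IH; apply: weight_geZ; rewrite gaderX.
exact/weight_geZ/weight_geX.
Qed.

Lemma weight_part_der (delta : M -> k) t f :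
  weight_part t (gader delta f) = gader delta (weight_part t f).
Proof.
apply/malgP => u; rewrite mcoeff_weight_part !mcoeff_gader mcoeff_weight_part.
by case: ifP; rewrite ?mulr0.
Qed.

Lemma weight_ge_sum t (I : Type) (r : seq I) (F : I -> A) :
  (forall i, weight_ge t (F i)) -> weight_ge t (\sum_(i <- r) F i).
Proof.
move=> h; elim: r => [|i r IH]; first by rewrite big_nil; apply: weight_ge0.
by rewrite big_cons; apply: weight_geD.
Qed.

(* In weights [>= 0], taking the weight-[0] part is a ring homomorphism. *)
Lemma weight_part0_prod (I : Type) (r : seq I) (F : I -> A) :
  wt 0 = 0 -> (forall i, weight_ge 0 (F i)) ->
  weight_ge 0 (\prod_(i <- r) F i) /\
  weight_part 0 (\prod_(i <- r) F i) = \prod_(i <- r) weight_part 0 (F i).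
Proof.
move=> wt0 h; elim: r => [|i r [IH1 IH2]].
  by rewrite !big_nil -gaX0 weight_partX wt0 eqxx; split=> //; apply: weight_geX; rewrite wt0.
rewrite !big_cons -IH2 -[in weight_part 0 (_ * _)](addr0 0) weight_partM //; split=> //.
by rewrite -(addr0 0); apply: weight_geM.
Qed.

Lemma weight_part0_det n (J : 'M[A]_n) : wt 0 = 0 ->
  (forall i j, weight_ge 0 (J i j)) ->
  weight_ge 0 (\det J) /\
  weight_part 0 (\det J) = \det (map_mx (weight_part 0) J).
Proof.
move=> wt0 h; rewrite /determinant; split.
  apply: weight_ge_sum => s; rewrite mulr_sign -scaler_sign.
  exact/weight_geZ/(weight_part0_prod _ wt0 _).1.
rewrite weight_part_sum; apply: eq_bigr => s _.
rewrite !mulr_sign -!scaler_sign weight_partZ.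
rewrite (weight_part0_prod _ wt0 _).2 //; congr (_ *: _).
by apply: eq_bigr => i _; rewrite mxE.
Qed.

End Weights.

Section Uncountable.
Variable R : realType.

Lemma avoid_interval (s : seq R) (a b : R) : a < b ->
  exists a' b', [/\ a' < b', a <= a', b' <= b &
    forall c, c \in s -> ~ (a' <= c /\ c <= b')].
Proof.
move=> ab; elim: s => [|c s [a' [b' [ab' aa bb h]]]]; first by exists a, b.
have [cm|cm] := lerP c ((a' + b') / 2).
  exists ((a' + 3 * b') / 4), b'; split; [lra|lra|lra|] => d.
  rewrite inE => /orP[/eqP->|/h H]; first lra.
  by move=> [? ?]; apply: H; split; lra.
exists a', ((a' + b') / 2); split; [lra|lra|lra|] => d.
rewrite inE => /orP[/eqP->|/h H]; first lra.
by move=> [? ?]; apply: H; split; lra.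
Qed.

(** Uncountability of the reals. If all sublevel sets of [n] were finite, nested intervals could
    avoid them one after another, yet the supremum of the left ends lies in all the intervals and
    has some level. *)
Lemma infinite_fiber (n : R -> nat) : exists N, forall m, exists s : seq R,
  [/\ uniq s, size s = m & forall c, c \in s -> (n c <= N)%N].
Proof.
apply: contrapT => H.
have fin N : {s : seq R | forall c, (n c <= N)%N -> c \in s}.
  apply/cid; apply: contrapT => H'; apply: H; exists N; elim=> [|m [s [us sm sN]]].
    by exists [::].
  have [c cN cs] : exists2 c, (n c <= N)%N & c \notin s.
    apply: contrapT => H; apply: H'; exists s => c cN; apply: contrapT => /negP cs.
    by apply: H; exists c.
  exists (c :: s); split=> //=; [by rewrite cs|by rewrite sm|].
  by move=> d; rewrite inE => /orP[/eqP->//|/sN].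
pose Q := {p : R * R | p.1 < p.2}.
have step N (q : Q) : {q' : Q | [/\ (sval q).1 <= (sval q').1,
    (sval q').2 <= (sval q).2 &
    forall c, (n c <= N)%N -> ~ ((sval q').1 <= c /\ c <= (sval q').2)]}.
  apply/cid; case: q => -[a b] /= ab; have [s sN] := fin N.
  have [a' [b' [ab' aa bb h]]] := avoid_interval s ab.
  by exists (exist _ (a', b') ab'); split=> // c /sN; apply: h.
have q0 : Q by exists (0, 1); apply: ltr01.
pose c := fix c m := if m is m'.+1 then sval (step m' (c m')) else q0.
have cS m : [/\ (sval (c m)).1 <= (sval (c m.+1)).1,
    (sval (c m.+1)).2 <= (sval (c m)).2 &
    forall d, (n d <= m)%N -> ~ ((sval (c m.+1)).1 <= d /\ d <= (sval (c m.+1)).2)].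
  exact: (svalP (step m (c m))).
have mono m k : (sval (c m)).1 <= (sval (c (k + m)%N)).1 /\
    (sval (c (k + m)%N)).2 <= (sval (c m)).2.
  elim: k => [|k [h1 h2]]; first by [].
  by have [h3 h4 _] := cS (k + m)%N; split; [apply: le_trans h3|apply: le_trans h2].
have ab m k : (sval (c m)).1 <= (sval (c k)).2.
  have lt p : (sval (c p)).1 < (sval (c p)).2 by exact: (svalP (c p)).
  have [mk|/ltnW km] := leqP m k.
    have [h _] := mono m (k - m)%N; rewrite subnK // in h.
    exact: le_trans h (ltW (lt k)).
  have [_ h] := mono k (m - k)%N; rewrite subnK // in h.
  exact: le_trans (ltW (lt m)) h.
pose A := [set (sval (c m)).1 | m in [set: nat]].
have Aub k : ubound A (sval (c k)).2 by move=> _ [m _ <-]; apply: ab.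
have A0 : A !=set0 by exists (sval (c 0%N)).1; exists 0%N.
have hA : has_sup A by split=> //; exists (sval (c 0%N)).2; apply: Aub.
have [_ _ /(_ (sup A) (leqnn _))] := cS (n (sup A)); apply; split.
  by apply: sup_upper_bound => //; exists (n (sup A)).+1.
by apply: ge_sup => //; apply: Aub.
Qed.

End Uncountable.

Section TorusAlgebra.
Variables (L : finType) (R : realType).
Local Notation C := (complex R).
Local Notation M := (character L).
Local Notation CM := (grpalg C M).
Implicit Types (w : L -> R) (f g h : CM) (z : L -> C).

Lemma char_add (u v : M) i : (u + v) i = u i + v i.
Proof. by rewrite -[LHS]/(\val (u + v) i) GRing.valD ffunE. Qed.

Lemma char_opp (u : M) i : (- u) i = - u i.
Proof. by rewrite -[LHS]/(\val (- u) i) GRing.valN ffunE. Qed.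

Lemma char_zero i : (0 : M) i = 0.
Proof. by rewrite -[LHS]/(\val (0 : M) i) GRing.val0 ffunE. Qed.

Lemma char_sum (u : M) : \sum_i u i = 0.
Proof. exact/eqP/(valP u). Qed.

Lemma pairingD w (u v : M) : pairing (u + v) w = pairing u w + pairing v w.
Proof.
rewrite /pairing -big_split; apply: eq_bigr => i _.
by rewrite char_add rmorphD mulrDl.
Qed.

Lemma pairing0 w : pairing (0 : M) w = 0.
Proof. by rewrite /pairing big1 // => i _; rewrite char_zero mul0r. Qed.

Local Notation wpart w := (weight_part (fun u : M => pairing u w)).
Local Notation wge w := (weight_ge (fun u : M => pairing u w)).

Lemma init_form_part w f t : wge w t f -> f != 0 ->
  wpart w t f = 0 \/ init_form w f = wpart w t f.
Proof.
move=> ft f0.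
have [[u uf ut]|H] := pselect (exists2 u, u \in msupp f & pairing u w = t).
  right; apply/malgP => v; rewrite mcoeff_weight_part /init_form mcoeffE.
  rewrite inE; case: (boolP (v \in msupp f)) => [vf|/mcoeff_outdom ->]; last first.
    by rewrite !if_same.
  congr (if _ then _ else _); rewrite inE [X in X && _]vf; apply/idP/eqP => [/allP/(_ u uf)|vt].
    by rewrite ut => vt; apply/eqP; rewrite eq_le vt ft // mcoeff_neq0.
  by apply/allP => y yf; rewrite vt; apply: ft; rewrite mcoeff_neq0.
left; apply/malgP => v; rewrite mcoeff_weight_part mcoeff0.
case: eqP => // vt; apply/eqP; apply: contraT; rewrite mcoeff_neq0 => vf.
by case: H; exists v.
Qed.

Lemma weight_min w f : f != 0 -> exists2 t, wge w t f & init_form w f = wpart w t f.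
Proof.
move=> f0.
have [u0 u0f] : exists u0, u0 \in msupp f.
  apply/fset0Pn; apply: contraNneq f0 => e; apply/eqP.
  by rewrite [f]gaXE e big_seq_fset0.
have [u uf um] : exists2 u, u \in msupp f &
    forall v, v \in msupp f -> pairing u w <= pairing v w.
  have : forall s : seq M, s != [::] -> exists2 u, u \in s &
      forall v, v \in s -> pairing u w <= pairing v w.
    elim=> // a s IH _; have [->|/IH [u us h]] := eqVneq s [::].
      by exists a => [|v]; rewrite inE // => /eqP->.
    have [au|/ltW ua] := lerP (pairing a w) (pairing u w).
      exists a => [|v]; rewrite inE ?eqxx // => /orP[/eqP->//|/h].
      exact: le_trans.
    exists u => [|v]; rewrite inE ?us ?orbT // => /orP[/eqP->//|]; exact: h.
  move/(_ (enum_fset (msupp f))); apply.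
  by apply: contraTneq u0f => e; rewrite -[_ \in _]/(u0 \in enum_fset (msupp f)) e.
have ft : wge w (pairing u w) f by move=> v; rewrite mcoeff_neq0; apply: um.
exists (pairing u w) => //; case: (init_form_part ft f0) => // e.
have := congr1 (mcoeff u) e; rewrite mcoeff_weight_part eqxx mcoeff0 => /eqP.
by rewrite mcoeff_eq0 uf.
Qed.

Lemma wpart_init_ideal w (I : set CM) f t : I f -> wge w t f ->
  init_ideal w I (wpart w t f).
Proof.
move=> If ft; have [->|f0] := eqVneq f 0.
  by rewrite weight_part_0; apply: ideal_gen0.
case: (init_form_part ft f0) => [->|<-]; first exact: ideal_gen0.
by apply: ideal_gen_id; exists f.
Qed.

Section Point.
Variable z : L -> C.
Hypothesis z0 : forall i, z i != 0.

Definition char_at (u : M) : C := \prod_i z i ^ u i.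

Lemma char_at0 : char_at 0 = 1.
Proof. by rewrite /char_at big1 // => i _; rewrite char_zero expr0z. Qed.

Lemma char_atD u v : char_at (u + v) = char_at u * char_at v.
Proof.
rewrite /char_at -big_split; apply: eq_bigr => i _.
by rewrite char_add expfzDr.
Qed.

Lemma char_at_neq0 u : char_at u != 0.
Proof. by apply/prodf_neq0 => i _; rewrite expfz_neq0. Qed.

Lemma evalTE f : evalT f z = gaev idfun char_at f. Proof. by []. Qed.

Lemma evalTX u : evalT (gaX C u) z = char_at u.
Proof. by rewrite evalTE gaevX. Qed.

Lemma evalT0 : evalT (0 : CM) z = 0. Proof. by rewrite evalTE gaev0. Qed.
Lemma evalT1 : evalT (1 : CM) z = 1. Proof. by rewrite evalTE gaev1 // char_at0. Qed.
Lemma evalTD f g : evalT (f + g) z = evalT f z + evalT g z.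
Proof. by rewrite !evalTE gaevD. Qed.
Lemma evalTN f : evalT (- f) z = - evalT f z. Proof. by rewrite !evalTE gaevN. Qed.
Lemma evalTB f g : evalT (f - g) z = evalT f z - evalT g z.
Proof. by rewrite !evalTE gaevB. Qed.
Lemma evalTZ c f : evalT (c *: f) z = c * evalT f z. Proof. by rewrite !evalTE gaevZ. Qed.
Lemma evalTM f g : evalT (f * g) z = evalT f z * evalT g z.
Proof. by rewrite !evalTE gaevM //; apply: char_atD. Qed.

Lemma evalT_sum (J : Type) (r : seq J) (F : J -> CM) :
  evalT (\sum_(i <- r) F i) z = \sum_(i <- r) evalT (F i) z.
Proof. exact: (big_morph (fun f => evalT f z) evalTD evalT0). Qed.

Lemma evalT_prod (J : Type) (r : seq J) (F : J -> CM) :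
  evalT (\prod_(i <- r) F i) z = \prod_(i <- r) evalT (F i) z.
Proof. exact: (big_morph (fun f => evalT f z) evalTM evalT1). Qed.

Lemma evalT_det n (J : 'M[CM]_n) :
  evalT (\det J) z = \det (\matrix_(i, j) evalT (J i j) z).
Proof.
rewrite /determinant evalT_sum; apply: eq_bigr => s _.
have e : evalT (\prod_i J i (s i)) z = \prod_i (\matrix_(i, j) evalT (J i j) z) i (s i).
  by rewrite evalT_prod; apply: eq_bigr => i _; rewrite mxE.
by rewrite !mulr_sign; case: (odd_perm s); rewrite ?evalTN e.
Qed.

Lemma point_ideal : is_ideal [set f : CM | evalT f z = 0].
Proof.
split=> [|a f g /= f0 g0]; first exact: evalT0.
by rewrite evalTD evalTM f0 g0 mulr0 addr0.
Qed.

End Point.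

Section Coordinates.
Variable l0 : L.

(** Exponent vector of [z_l / z_l0], which is zero for [l = l0]. By [char_coord] these characters
    generate the lattice, so the coordinates of an exponent vector serve as coefficients. *)
Definition coord_fun (l : L) : {ffun L -> int} :=
  [ffun i => (i == l)%:R - (i == l0)%:R].

Lemma coord_fun0 l : coord_fun l \in deg0 (L := L).
Proof.
rewrite unfold_in; apply/eqP; under eq_bigr do rewrite ffunE.
rewrite sumrB; have e m : \sum_(i : L) (i == m)%:R = 1 :> int.
  rewrite (bigD1 m) //= eqxx big1 ?addr0 // => i /negPf -> //.
by rewrite !e subrr.
Qed.

Definition coord (l : L) : M := Character (coord_fun0 l).

Lemma coordE l i : coord l i = (i == l)%:R - (i == l0)%:R.
Proof. by rewrite /= ffunE. Qed.

Lemma char_coord (u : M) : u = \sum_l coord l *~ u l.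
Proof.
apply/val_inj/ffunP => i; rewrite raddf_sum sum_ffunE.
under eq_bigr => l _.
  rewrite raddfMz /= ffunMzE ffunE mulrzBl.
  over.
rewrite sumrB -[in X in _ - X]mulrz_sumr char_sum mulr0z subr0.
rewrite (bigD1 i) //= eqxx mulr1n intz big1 ?addr0 //.
by move=> l li; rewrite eq_sym (negPf li) mul0rz.
Qed.

End Coordinates.

End TorusAlgebra.

Lemma zmorph_exp (M : zmodType) (F : fieldType) (chi : M -> F) :
  chi 0 = 1 -> (forall u v, chi (u + v) = chi u * chi v) ->
  (forall u, chi u != 0) -> forall u (m : int), chi (u *~ m) = chi u ^ m.
Proof.
move=> chi0 chiD nz u m.
have nat v (k : nat) : chi (v *+ k) = chi v ^+ k.
  by elim: k => [|k IH]; [rewrite mulr0n chi0 expr0 | rewrite mulrS chiD IH exprS].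
have neg v : chi (- v) = (chi v)^-1.
  by rewrite -[LHS](mulfK (nz v)) -chiD addNr chi0 mul1r.
case: m => k; first exact: nat.
by rewrite NegzE mulrNz neg -pmulrn nat -exprnN.
Qed.

(** * The Nullstellensatz on the torus, by uncountability of the field *)

Section Nullstellensatz.
Variables (L : finType) (R : realType) (l0 : L).
Local Notation C := (complex R).
Local Notation M := (character L).
Local Notation CM := (grpalg C M).

Definition maximal_ideal (A : comNzRingType) (J : set A) : Prop :=
  [/\ is_ideal J, ~ J 1 &
      forall J', is_ideal J' -> ~ J' 1 -> J `<=` J' -> J' = J].

Lemma idealZ (J : set CM) c f : is_ideal J -> J f -> J (c *: f).
Proof. by move=> iJ Jf; rewrite -[c *: f]mulr_algl; apply: idealM. Qed.

Lemma maximal_ideal_inv (A : comNzRingType) (J : set A) a :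
  maximal_ideal J -> ~ J a -> exists b, J (b * a - 1).
Proof.
move=> [iJ J1 mJ] Ja; pose J' := [set x | exists b, J (b * a - x)].
have iJ' : is_ideal J'.
  split; first by exists 0; rewrite mul0r subr0; apply: ideal0.
  move=> c f g [b Jf] [d Jg]; exists (c * b + d).
  have -> : (c * b + d) * a - (c * f + g) = c * (b * a - f) + (d * a - g) by ring.
  exact: idealMD.
apply: contrapT => H; apply: Ja.
have -> : J = J'.
  have J'1 : ~ J' 1 by move=> -[b Jb]; apply: H; exists b.
  apply/esym; apply: (mJ J' iJ' J'1).
  by move=> x Jx; exists 0; rewrite mul0r sub0r; apply: idealN.
by exists 1; rewrite mul1r subrr; apply: ideal0.
Qed.

Lemma maximal_ideal_prime (A : comNzRingType) (J : set A) a b :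
  maximal_ideal J -> J (a * b) -> J a \/ J b.
Proof.
move=> mJ Jab; have [Ja|Ja] := pselect (J a); [by left|right].
have [c Jc] := maximal_ideal_inv mJ Ja; have [iJ _ _] := mJ.
have -> : b = c * (a * b) - (b * (c * a - 1)) by ring.
by apply: idealB => //; apply: idealM.
Qed.

(** If [f] is congruent to no constant, each [f - r] with [r] real is invertible modulo [J].
    Monomials are countable, so [N.+2] of these inverses can be found in the span of the at most
    [N.+1] monomials of index at most [N]. A linear relation between them, cleared of denominators,
    is a nonzero polynomial in [f] lying in the prime ideal [J], and it splits into linear
    factors. *)
Lemma uncountable_dependence (f : CM) (J : set CM) : maximal_ideal J ->
  (forall c : C, ~ J (f - c%:A)) -> False.
Proof.
move=> mJ Jf; have [iJ J1 _] := mJ.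
have /choice[g gP] : forall r, exists h, J (h * (f - (real_complex R r)%:A) - 1).
  by move=> r; apply: maximal_ideal_inv.
pose idx (u : M) := choice.pickle (\val u : {ffun L -> int}).
pose n r := \max_(u <- msupp (g r)) idx u.
have nP r u : u \in msupp (g r) -> (idx u <= n r)%N.
  by move=> ur; rewrite /n; apply: leq_bigmax_seq.
have [N /(_ N.+2)[s [us ss sN]]] := infinite_fiber n.
pose S (i : 'I_N.+2) : C := real_complex R (nth 0 s i).
have Sinj i j : S i = S j -> i = j.
  move=> /complexI e; apply/val_inj/eqP => /=; rewrite -(nth_uniq 0 _ _ us) ?ss //.
  exact/eqP.
pose G (i : 'I_N.+2) := g (nth 0 s i).
pose ch (k : nat) : option M := if choice.unpickle k is Some v then insub v else None.
have chK u : ch (idx u) = Some u by rewrite /ch /idx choice.pickleK valK.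
pose A := \matrix_(i < N.+2, k < N.+1) (if ch k is Some u then (G i)@_u else 0).
have [a a0 aA] : exists2 a : 'rV[C]_N.+2, a != 0 & a *m A = 0.
  have /rowV0Pn[a /sub_kermxP aA a0] : kermx A != 0.
    by rewrite kermx_eq0 /row_free neq_ltn (leq_ltn_trans (rank_leq_col A)).
  by exists a.
have sumG : \sum_i a 0 i *: G i = 0.
  apply/malgP => u; rewrite mcoeff0 raddf_sum /=.
  under eq_bigr do rewrite mcoeffZ.
  have [uN|Nu] := leqP (idx u) N.
    have := congr1 (fun B : 'rV_N.+1 => B 0 (Ordinal (uN : (idx u < N.+1)%N))) aA.
    rewrite !mxE => e; rewrite -[RHS]e; apply: eq_bigr => i _.
    by rewrite mxE /= chK.
  apply: big1 => i _; rewrite mcoeff_outdom ?mulr0 //.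
  apply: contraL Nu => /nP uG; rewrite -leqNgt; apply: leq_trans uG _.
  by apply: sN; rewrite mem_nth // ss.
pose p : {poly C} := \sum_i a 0 i *: \prod_(j | j != i) ('X - (S j)%:P).
(* At [S i] only the summand of index [i] survives, and its coefficient is nonzero for some [i]. *)
have p0 : p != 0.
  have [i ai] : exists i, a 0 i != 0.
    apply: contrapT => H; move/negP: a0; apply; apply/eqP/rowP => i; rewrite mxE.
    by apply/eqP; apply: contrapT => /negP ai; apply: H; exists i.
  apply: contraNneq ai => pE; have := congr1 (horner^~ (S i)) pE.
  rewrite horner0 /p horner_sum (bigD1 i) //= [X in _ + X]big1 => [|k ki]; last first.
    rewrite hornerZ horner_prod (bigD1 i) 1?eq_sym //=.
    by rewrite hornerXsubC subrr mul0r mulr0.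
  rewrite addr0 hornerZ horner_prod => /eqP; rewrite mulf_eq0 => /orP[//|/prodf_eq0[j ji]].
  by rewrite hornerXsubC subr_eq0 => /eqP /Sinj e; rewrite e eqxx in ji.
have JpE : J (horner_alg f p).
  have -> : horner_alg f p = - \sum_i a 0 i *:
      ((G i * (f - (S i)%:A) - 1) * \prod_(j | j != i) (f - (S j)%:A)).
    have -> : horner_alg f p = \sum_i a 0 i *: \prod_(j | j != i) (f - (S j)%:A).
      rewrite raddf_sum; apply: eq_bigr => i _; rewrite /= linearZ /= mulr_algl; congr (_ *: _).
      by rewrite rmorph_prod; apply: eq_bigr => j _; rewrite rmorphB /= horner_algX horner_algC.
    apply/eqP; rewrite -addr_eq0 -big_split /=.
    under eq_bigr => i _.
      rewrite -scalerDr mulrBl mul1r addrC subrK -mulrA.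
      rewrite -(bigD1 (P := xpredT) i) //=.
      over.
    under eq_bigr do rewrite scalerAl.
    by rewrite -mulr_suml sumG mul0r.
  apply: idealN => //; apply: ideal_sum => // i _.
  apply: (idealZ _ iJ); rewrite mulrC; apply: (idealM _ iJ).
  exact: gP.
have [r pr] := closed_field_poly_normal p.
have lp : J (\prod_(z <- r) (f - z%:A)).
  have -> : \prod_(z <- r) (f - z%:A) = (lead_coef p)^-1 *: horner_alg f p.
    rewrite [in horner_alg f p]pr linearZ /= mulr_algl scalerA mulVf ?lead_coef_eq0 // scale1r.
    by rewrite rmorph_prod; apply: eq_bigr => j _; rewrite rmorphB /= horner_algX horner_algC.
  by apply: (idealZ _ iJ).
elim: r lp {pr} => [|c r IH]; first by rewrite big_nil.
by rewrite big_cons => /(maximal_ideal_prime mJ)[/Jf|/IH].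
Qed.

(** Residues modulo [J] are constants by [uncountable_dependence]. The residue map is then a
    morphism to the field, hence evaluation at the residues of the coordinates. *)
Lemma nullstellensatz (J : set CM) : maximal_ideal J ->
  exists2 z : L -> C, (forall i, z i != 0) & J = [set f | evalT f z = 0].
Proof.
move=> mJ; have [iJ J1 _] := mJ.
have /choice[phi phiP] : forall f, exists c : C, J (f - c%:A).
  move=> f; apply: contrapT => H.
  by apply: (uncountable_dependence mJ (f := f)) => c Jc; apply: H; exists c.
have uniq f c : J (f - c%:A) -> phi f = c.
  move=> Jc; apply/eqP; rewrite -subr_eq0; apply: contrapT => /negP nz; apply: J1.
  suff <- : (phi f - c)^-1 *: ((f - c%:A) - (f - (phi f)%:A)) = 1.
    exact: (idealZ _ iJ (idealB iJ Jc (phiP f))).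
  have -> : f - c%:A - (f - (phi f)%:A) = (phi f - c)%:A.
    by rewrite opprB addrC addrA subrK scalerBl.
  by rewrite scalerA mulVf // scale1r.
have phiD f g : phi (f + g) = phi f + phi g.
  apply: uniq; rewrite scalerDl.
  have -> : f + g - ((phi f)%:A + (phi g)%:A) = (f - (phi f)%:A) + (g - (phi g)%:A).
    by rewrite opprD addrACA.
  exact: (idealD iJ (phiP f) (phiP g)).
have phiM f g : phi (f * g) = phi f * phi g.
  apply: uniq.
  have -> : f * g - (phi f * phi g)%:A = g * (f - (phi f)%:A) + (phi f)%:A * (g - (phi g)%:A).
    rewrite -scalerA -[phi f *: _]mulr_algl.
    by move: (phi f)%:A (phi g)%:A => a b; ring.
  exact: (idealMD iJ g (phiP f) (idealM _ iJ (phiP g))).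
have phi1 : phi 1 = 1 by apply: uniq; rewrite scale1r subrr; apply: ideal0.
have phiC c f : phi (c *: f) = c * phi f.
  rewrite -mulr_algl phiM; congr (_ * _); apply: uniq; rewrite subrr; exact: ideal0.
have phi0 : phi 0 = 0 by rewrite -(scale0r 0) phiC mul0r.
pose z l := phi (gaX C (coord l0 l)).
have phiX u : phi (gaX C u) != 0.
  apply/negP => /eqP e; have := phi1; rewrite -(gaXN C u) phiM e mulr0 => /eqP.
  by rewrite eq_sym oner_eq0.
have phiXD u v : phi (gaX C (u + v)) = phi (gaX C u) * phi (gaX C v) by rewrite gaXD.
have phiX0 : phi (gaX C 0) = 1 by rewrite gaX0.
have phiXz u (m : int) : phi (gaX C (u *~ m)) = phi (gaX C u) ^ m.
  exact: (zmorph_exp (chi := fun v => phi (gaX C v)) phiX0 phiXD phiX).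
have phiXE u : phi (gaX C u) = char_at z u.
  rewrite {1}(char_coord l0 u) /char_at.
  rewrite (big_morph (fun v => phi (gaX C v)) phiXD phiX0).
  by apply: eq_bigr => l _; rewrite phiXz.
have z0 i : z i != 0 by apply: phiX.
have phiE f : phi f = evalT f z.
  elim/ga_ind: f => [|c u f IH]; first by rewrite phi0 evalT0.
  by rewrite phiD phiC IH evalTD evalTZ evalTX phiXE.
exists z => //; apply/seteqP; split=> f /=.
  by move=> Jf; rewrite -phiE; apply: uniq; rewrite scale0r subr0.
by rewrite -phiE => e; have := phiP f; rewrite e scale0r subr0.
Qed.

End Nullstellensatz.

(** * Powers of ideals and Krull's intersection theorem *)

Section Krull.
Variables (A : comNzRingType).
Implicit Types (J m : set A).

Fixpoint ideal_pow m n : set A :=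
  if n is n'.+1 then ideal_gen [set x | exists2 a, m a & exists2 b, ideal_pow m n' b & x = a * b]
  else setT.

Lemma ideal_pow_ideal m n : is_ideal (ideal_pow m n).
Proof. by case: n => [//|n]; apply: ideal_gen_ideal. Qed.

Lemma ideal_powS m n a b : m a -> ideal_pow m n b -> ideal_pow m n.+1 (a * b).
Proof. by move=> ma mb; apply: ideal_gen_id; exists a => //; exists b. Qed.

Lemma ideal_pow1 m a : is_ideal m -> ideal_pow m 1 a <-> m a.
Proof.
move=> im; split; last by move=> ma; rewrite -[a]mulr1; apply: ideal_powS.
apply: ideal_gen_min => // x [b mb [c _ ->]]; rewrite mulrC; exact: idealM.
Qed.

Lemma ideal_pow_mul m i j a b : is_ideal m ->
  ideal_pow m i a -> ideal_pow m j b -> ideal_pow m (i + j) (a * b).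
Proof.
move=> im; elim: i a => [|i IH] a ai bj.
  by apply: idealM => //; apply: ideal_pow_ideal.
have iJ : is_ideal [set x | ideal_pow m (i.+1 + j) (x * b)].
  have ip := ideal_pow_ideal m (i.+1 + j).
  split=> [|c f g /= fI gI]; first by rewrite /= mul0r; apply: ideal0.
  by rewrite mulrDl -mulrA; apply: idealMD.
move: a ai; apply: (ideal_gen_min iJ) => x [c mc [d di ->]] /=.
by rewrite -mulrA; apply: (@ideal_powS m (i + j)) => //; apply: IH.
Qed.

Definition ideal_add J J' : set A := [set x | exists2 a, J a & exists2 b, J' b & x = a + b].

Lemma ideal_add_ideal J J' : is_ideal J -> is_ideal J' -> is_ideal (ideal_add J J').
Proof.
move=> iJ iJ'; split.
  by exists 0; [exact: ideal0|exists 0; [exact: ideal0|rewrite addr0]].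
move=> c _ _ [a Ja [b Jb ->]] [d Jd [e Je ->]].
exists (c * a + d); first exact: idealMD.
by exists (c * b + e); [exact: idealMD|ring].
Qed.

Lemma ideal_addl J J' : is_ideal J' -> J `<=` ideal_add J J'.
Proof. by move=> iJ' a Ja; exists a => //; exists 0; rewrite ?addr0 //; apply: ideal0. Qed.

Lemma ideal_addr J J' : is_ideal J -> J' `<=` ideal_add J J'.
Proof. by move=> iJ a Ja; exists 0; [exact: ideal0|exists a; rewrite ?add0r]. Qed.

(** Pigeonhole: in a long product either [a] occurs [n] times, or enough factors remain in [s]. *)
Lemma prod_pow_mem (s : seq A) J : is_ideal J ->
  (forall a, a \in s -> exists n, J (a ^+ n)) ->
  exists N, forall t : seq A, {subset t <= s} -> (N <= size t)%N -> J (\prod_(a <- t) a).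
Proof.
move=> iJ; elim: s => [|a s IH] h.
  exists 1%N => -[//|b t] /(_ b); rewrite mem_head => /(_ isT).
  by rewrite in_nil.
have [N hN] : exists N, forall t : seq A, {subset t <= s} -> (N <= size t)%N ->
    J (\prod_(a <- t) a).
  by apply: IH => b bs; apply: h; rewrite inE bs orbT.
have [n an] := h a (mem_head _ _); exists (n + N)%N => t ts le.
rewrite (bigID (pred1 a)) /= -[X in _ * X]big_filter.
have [nc|cn] := leqP n (count_mem a t).
  rewrite mulrC; apply: idealM => //.
  have -> : \prod_(i <- t | i == a) i = a ^+ count_mem a t.
    rewrite (eq_bigr (fun=> a)) => [|i /eqP//].
    by rewrite big_const_seq iter_mulr_1.
  by rewrite -(subnK nc) exprD; apply: idealM.
apply: idealM => //; apply: hN => [b|].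
  by rewrite mem_filter => /andP[ba /ts]; rewrite inE (negPf ba).
rewrite size_filter -(leq_add2l n); apply: leq_trans le _.
by rewrite -(count_predC (pred1 a) t) leq_add2r ltnW.
Qed.

Lemma ideal_pow_prod_sub (s : seq A) J n : is_ideal J ->
  (forall t : seq A, {subset t <= s} -> size t = n -> J (\prod_(a <- t) a)) ->
  ideal_pow (ideal_gen [set a | a \in s]) n `<=` J.
Proof.
elim: n J => [|n IH] J iJ h.
  move=> x _; rewrite -[x]mulr1; apply: idealM => //.
  have e : \prod_(a <- [::]) a = 1 :> A by rewrite big_nil.
  by rewrite -e; apply: h.
apply: ideal_gen_min => // x [a sa [b bn ->]].
have iJb : is_ideal [set y | J (y * b)].
  split=> [|c f g /= fI gI]; first by rewrite /= mul0r; apply: ideal0.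
  by rewrite mulrDl -mulrA; apply: idealMD.
move: a sa {x}; apply: (ideal_gen_min iJb) => a /= sa.
have iJa : is_ideal [set y | J (a * y)].
  split=> [|c f g /= fI gI]; first by rewrite /= mulr0; apply: ideal0.
  by rewrite mulrDr mulrCA; apply: idealMD.
apply: (IH _ iJa) bn => t ts st /=.
rewrite -[a * _](big_cons _ _ a t xpredT) /=.
by apply: h => [y|]; rewrite /= ?st // inE => /orP[/eqP->|/ts].
Qed.

(* Krull's intersection theorem: an ideal [b] maximal among those meeting
   [J + (h)] in [J + m h] contains a power of [m]. *)
Lemma krull_intersection m J h : noetherian A -> is_ideal m -> is_ideal J ->
  (forall n, ideal_add J (ideal_pow m n) h) ->
  exists2 c, m c & J (h - c * h).
Proof.
move=> nA im iJ hn.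
pose J1 := [set x | exists2 c, m c & J (x - c * h)].
have iJ1 : is_ideal J1.
  split; first by exists 0; [exact: ideal0|rewrite mul0r subr0; exact: ideal0].
  move=> a x y [c mc Jx] [d md Jy]; exists (a * c + d); first exact: idealMD.
  have -> : a * x + y - (a * c + d) * h = a * (x - c * h) + (y - d * h) by ring.
  exact: idealMD.
pose Jh x := exists c, J (x - c * h).
pose P (b : set A) := J1 `<=` b /\ forall x, b x -> Jh x -> J1 x.
have PJ1 : P J1 by split.
have [b [ib [J1b bP] _ bmax]] := noetherian_maximal nA iJ1 PJ1.
have powb a : m a -> exists n, b (a ^+ n).
  move=> ma; pose col n := [set x | b (x * a ^+ n)].
  have icol n : is_ideal (col n).
    split=> [|c x y bx by_]; first by rewrite /col /= mul0r; apply: ideal0.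
    by rewrite /col /= mulrDl -mulrA; apply: idealMD.
  (* The colon ideals of [b] by [a ^+ n] increase; [n] is taken where they become stationary.
     Adjoining [a ^+ n] to [b] then preserves [P], and maximality of [b] puts it in [b]. *)
  have [K [_ [n eK] _ Kmax]] := noetherian_maximal nA (P := fun K => exists n, K = col n)
     (icol 0%N) (ex_intro _ 0%N erefl).
  have colS : col n.+1 = col n.
    rewrite -eK; apply: Kmax; [exact: icol|by exists n.+1|].
    by rewrite eK => x bx; rewrite /col /= exprS mulrCA; apply: idealM.
  exists n.
  have ib' : is_ideal (ideal_add b [set x | exists c, x = c * a ^+ n]).
    apply: ideal_add_ideal => //; split; first by exists 0; rewrite mul0r.
    by move=> c _ _ [d ->] [e ->]; exists (c * d + e); ring.
  have Pb' : P (ideal_add b [set x | exists c, x = c * a ^+ n]).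
    split; first by move=> x /J1b bx; exists x => //; exists 0; rewrite ?addr0 //; exists 0; rewrite mul0r.
    move=> _ [x bx [_ [c ->] ->]] [d Jd]; apply: bP; last by exists d.
    have : b (a * (x + c * a ^+ n)).
      apply: J1b; exists (a * d); first by rewrite mulrC; apply: idealM.
      by rewrite -mulrA -mulrBr; apply: idealM.
    rewrite mulrDr => bb; have : col n.+1 c.
      rewrite /col /= exprS; have -> : c * (a * a ^+ n) = (a * x + a * (c * a ^+ n)) - a * x by ring.
      by apply: idealB => //; apply: idealM.
    by rewrite colS /col /= => bc; apply: idealD.
  rewrite -(bmax _ ib' Pb'); last first.
    by move=> x bx; exists x => //; exists 0; rewrite ?addr0 //; exists 0; rewrite mul0r.
  by exists 0; [exact: ideal0|exists (a ^+ n); rewrite ?add0r //; exists 1; rewrite mul1r].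
have [s sm ms] := nA m im.
have em : m = ideal_gen [set a | a \in s].
  by apply/seteqP; split=> //; apply: ideal_gen_min.
have [N hN] := prod_pow_mem ib (fun a (as_ : a \in s) => powb a (sm a as_)).
have mN : ideal_pow m N `<=` b.
  by rewrite em; apply: ideal_pow_prod_sub => // t ts st; apply: hN; rewrite ?st.
suff : J1 h by [].
apply: bP; last by exists 1; rewrite mul1r subrr; apply: ideal0.
have [x Jx [y my ->]] := hn N; apply: idealD => //; last exact: mN.
by apply: J1b; exists 0; [exact: ideal0|rewrite mul0r subr0].
Qed.

End Krull.

(** * Initial ideals near a closed point *)

Lemma cofactor_scale (k : comNzRingType) (A : comAlgType k) n (M : 'M[A]_n) i j :
  cofactor M i j = (-1) ^+ odd (i + j) *: \det (row' i (col' j M)).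
Proof. by rewrite /cofactor -signr_odd mulr_sign scaler_sign. Qed.

(** * Bordered determinants as derivations *)

Section BorderedDeterminant.
Variables (A : comNzRingType) (L : Type) (d : L -> A -> A).
Hypothesis dD : forall l f g, d l (f + g) = d l f + d l g.
Hypothesis dM : forall l f g, d l (f * g) = d l f * g + f * d l g.
Variables (r : nat) (F : 'I_r -> A) (cols : 'I_r -> L).
Implicit Types (f g : A).

Definition border_row g (i : 'I_r.+1) : A := oapp F g (unlift ord_max i).
Definition border_col (e : L) (j : 'I_r.+1) : L := oapp cols e (unlift ord_max j).
Definition border_mx e g : 'M[A]_r.+1 :=
  \matrix_(i, j) d (border_col e j) (border_row g i).
Definition jac_mx : 'M[A]_r := \matrix_(i, j) d (cols j) (F i).

(* The derivation [g |-> det (dF, dg)] with columns [cols] and [e]; it kills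
   the [F i]. *)
Definition border_det e g : A := \det (border_mx e g).

Lemma border_rowE : border_row^~ ord_max =1 id.
Proof. by move=> g; rewrite /border_row unlift_none. Qed.

Lemma border_row_lift g i : border_row g (lift ord_max i) = F i.
Proof. by rewrite /border_row liftK. Qed.

Lemma border_col_max e : border_col e ord_max = e.
Proof. by rewrite /border_col unlift_none. Qed.

Lemma border_col_lift e j : border_col e (lift ord_max j) = cols j.
Proof. by rewrite /border_col liftK. Qed.

Lemma border_cofactor_row e g j :
  cofactor (border_mx e g) ord_max j = cofactor (border_mx e 0) ord_max j.
Proof.
have e1 : row' ord_max (col' j (border_mx e g)) = row' ord_max (col' j (border_mx e 0)).
  by apply/matrixP => a b; rewrite !mxE !border_row_lift.
by rewrite /cofactor e1.
Qed.

Lemma border_det_row e g : border_det e g =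
  \sum_j d (border_col e j) g * cofactor (border_mx e 0) ord_max j.
Proof.
rewrite /border_det (expand_det_row _ ord_max); apply: eq_bigr => j _.
by rewrite border_cofactor_row mxE border_rowE.
Qed.

Lemma border_cofactor_col e e' g i :
  cofactor (border_mx e g) i ord_max = cofactor (border_mx e' g) i ord_max.
Proof.
have e1 : row' i (col' ord_max (border_mx e g)) = row' i (col' ord_max (border_mx e' g)).
  by apply/matrixP => a b; rewrite !mxE !border_col_lift.
by rewrite /cofactor e1.
Qed.

Lemma border_det_col e e' g : border_det e g =
  \sum_i d e (border_row g i) * cofactor (border_mx e' g) i ord_max.
Proof.
rewrite /border_det (expand_det_col _ ord_max); apply: eq_bigr => i _.
by rewrite (border_cofactor_col e e') mxE border_col_max.
Qed.

Lemma border_cofactor_max e g : cofactor (border_mx e g) ord_max ord_max = \det jac_mx.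
Proof.
have e1 : row' ord_max (col' ord_max (border_mx e g)) = jac_mx.
  by apply/matrixP => a b; rewrite !mxE border_row_lift border_col_lift.
by rewrite /cofactor e1 -signr_odd addnn odd_double mul1r.
Qed.

Lemma border_detD e f g : border_det e (f + g) = border_det e f + border_det e g.
Proof.
rewrite !border_det_row -big_split; apply: eq_bigr => j _.
by rewrite dD mulrDl.
Qed.

Lemma border_detM e f g :
  border_det e (f * g) = border_det e f * g + f * border_det e g.
Proof.
rewrite !border_det_row mulr_suml mulr_sumr -big_split; apply: eq_bigr => j _.
by rewrite dM /=; ring.
Qed.

Lemma border_det0 e : border_det e 0 = 0.
Proof. by apply: (addrI (border_det e 0)); rewrite -border_detD !addr0. Qed.

Lemma border_detF e i : border_det e (F i) = 0.
Proof.
apply: (determinant_alternate (neq_lift ord_max i)) => j.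
by rewrite !mxE border_rowE border_row_lift.
Qed.

End BorderedDeterminant.

Section BorderedWeight.
Variables (k : comNzRingType) (M : zmodType) (R : realDomainType) (wt : M -> R).
Hypothesis wtD : forall u v, wt (u + v) = wt u + wt v.
Hypothesis wt0 : wt 0 = 0.
Local Notation A := (grpalg k M).

Lemma weight_part0_cofactor n (J : 'M[A]_n) i j :
  (forall i j, weight_ge wt 0 (J i j)) ->
  weight_ge wt 0 (cofactor J i j) /\
  weight_part wt 0 (cofactor J i j) = cofactor (map_mx (weight_part wt 0) J) i j.
Proof.
move=> J0; have J'0 a b : weight_ge wt 0 ((row' i (col' j J)) a b) by rewrite !mxE.
have [h1 h2] := weight_part0_det wtD wt0 J'0.
rewrite !cofactor_scale; split; first exact: weight_geZ.
by rewrite weight_partZ h2 map_row' map_col'.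
Qed.

Variables (L : Type) (delta : L -> M -> k).
Local Notation d := (fun l => gader (delta l)).

(** The expansion along the last row separates [g] from cofactors that involve only the [F i]. The
    latter have weight at least zero, where taking parts commutes with determinants. *)
Lemma border_der_weight r (F : 'I_r -> A) (cols : 'I_r -> L) e g t :
  (forall i, weight_ge wt 0 (F i)) -> weight_ge wt t g ->
  weight_ge wt t (border_det d F cols e g) /\
  weight_part wt t (border_det d F cols e g) =
    border_det d (fun i => weight_part wt 0 (F i)) cols e (weight_part wt t g).
Proof.
move=> F0 gt.
have B0 i j : weight_ge wt 0 (border_mx d F cols e 0 i j).
  rewrite mxE; apply: weight_ge_der; rewrite /border_row; case: unliftP => [i' _|_] /=.
    exact: F0.
  exact: weight_ge0.
have cof j := weight_part0_cofactor ord_max j B0.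
have e1 : map_mx (weight_part wt 0) (border_mx d F cols e 0) =
    border_mx d (fun i => weight_part wt 0 (F i)) cols e 0.
  apply/matrixP => a b; rewrite !mxE weight_part_der /border_row.
  by case: unliftP => //= _; rewrite weight_part_0.
rewrite (border_det_row d) (border_det_row d); split.
  apply: weight_ge_sum => j; rewrite -[t]addr0; apply: weight_geM => //.
    exact: weight_ge_der.
  exact: (cof j).1.
rewrite weight_part_sum; apply: eq_bigr => j _.
have h := weight_partM wtD (weight_ge_der (delta := delta (border_col cols e j)) gt) (cof j).1.
by rewrite addr0 in h; rewrite h (cof j).2 e1 weight_part_der.
Qed.

End BorderedWeight.

Section BorderedDerivation.
Variables (L : finType) (R : realType).
Local Notation C := (complex R).
Local Notation M := (character L).
Local Notation CM := (grpalg C M).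
Implicit Types (f g h : CM).

(* The logarithmic derivation [z_l * d/dz_l]. *)
Definition dlog (l : L) : CM -> CM := gader (fun u : M => (u l)%:~R : C).

Lemma dlogD l f g : dlog l (f + g) = dlog l f + dlog l g. Proof. exact: gaderD. Qed.
Lemma dlogZ l c f : dlog l (c *: f) = c *: dlog l f. Proof. exact: gaderZ. Qed.
Lemma dlog0 l : dlog l 0 = 0. Proof. exact: gader0. Qed.
Lemma dlogM l f g : dlog l (f * g) = dlog l f * g + f * dlog l g.
Proof. by apply: gaderM => u v; rewrite char_add rmorphD. Qed.
Lemma dlogX l u : dlog l (gaX C u) = (u l)%:~R *: gaX C u. Proof. exact: gaderX. Qed.

Local Notation wpart w := (weight_part (fun u : M => pairing u w)).
Local Notation wge w := (weight_ge (fun u : M => pairing u w)).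

Lemma border_det_weight (w : L -> R) r (F : 'I_r -> CM) cols e g t :
  (forall i, wge w 0 (F i)) -> wge w t g ->
  wge w t (border_det dlog F cols e g) /\
  wpart w t (border_det dlog F cols e g) =
    border_det dlog (fun i => wpart w 0 (F i)) cols e (wpart w t g).
Proof.
exact: (border_der_weight (@pairingD _ _ w) (@pairing0 _ _ w)).
Qed.

(** A derivation preserves an ideal as soon as it maps generators into it. On [init_form w g], with
    [g] in [I], it gives a weight part of the bordered determinant of [g], which lies in [I] as
    well. *)
Lemma border_det_init_ideal (w : L -> R) (I : set CM) r (F : 'I_r -> CM) cols e :
  (forall i, wge w 0 (F i)) -> (forall g, I g -> I (border_det dlog F cols e g)) ->
  forall h, init_ideal w I h ->
    init_ideal w I (border_det dlog (fun i => wpart w 0 (F i)) cols e h).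
Proof.
move=> F0 DI; set D := border_det _ _ _ e.
have D0 : D 0 = 0 by exact: (border_det0 dlogD).
have DD f g : D (f + g) = D f + D g by exact: (border_detD dlogD).
have DM f g : D (f * g) = D f * g + f * D g by exact: (border_detM dlogM).
pose J := [set h | init_ideal w I h /\ init_ideal w I (D h)].
have iI : is_ideal (init_ideal w I) by apply: ideal_gen_ideal.
have iJ : is_ideal J.
  split; first by split; [|rewrite D0]; apply: ideal0.
  move=> a f g [fI DfI] [gI DgI]; split; first exact: idealMD.
  rewrite DD DM; apply: (idealD iI _ DgI).
  rewrite addrC; apply: (idealMD iI a DfI); exact: (idealM (D a) iI fI).
suff h : init_ideal w I `<=` J by move=> g /h[].
apply: (ideal_gen_min iJ) => _ [g Ig <-].
have [->|g0] := eqVneq g 0.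
  have -> : init_form w (0 : CM) = 0.
    apply/malgP => v; rewrite /init_form mcoeffE mcoeff0.
    by case: ifP => //; rewrite mcoeff0.
  exact: ideal0.
have [t gt ->] := weight_min w g0; split; first exact: wpart_init_ideal.
have [Dt DE] := border_det_weight cols e F0 gt; rewrite -[D _]DE.
by apply: wpart_init_ideal => //; apply: DI.
Qed.

End BorderedDerivation.

Arguments dlog {L R} l f.

(** * Comparing an ideal with the chosen elements, to all orders at a point *)

Section BorderedFiltration.
Variables (A : comNzRingType) (L : finType) (e0 : L) (d : L -> A -> A).
Hypothesis dD : forall l f g, d l (f + g) = d l f + d l g.
Hypothesis dM : forall l f g, d l (f * g) = d l f * g + f * d l g.
Variables (m J : set A) (Y : L -> A).
Hypotheses (im : is_ideal m) (iJ : is_ideal J) (Jm : J `<=` m).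
Hypothesis Ym : forall e, m (Y e).
Hypothesis euler : forall a, m a -> ideal_pow m 2 (\sum_e Y e * d e a - a).
Hypothesis natV : forall n, exists c : A, c * n.+1%:R = 1.
Variables (r : nat) (F : 'I_r -> A) (cols : 'I_r -> L).
Hypothesis FJ : forall i, J (F i).
Hypothesis DJ : forall e h, J h -> J (border_det d F cols e h).
Hypothesis detV : exists c, m (1 - c * \det (jac_mx d F cols)).

Local Notation D := (border_det d F cols).
Local Notation delta := (\det (jac_mx d F cols)).
Local Notation eps := (fun a => \sum_e Y e * D e a).
Local Notation IF := (ideal_gen (range F)).
Local Notation IFm n := (ideal_add IF (ideal_pow m n)).

Let iF : is_ideal IF. Proof. exact: ideal_gen_ideal. Qed.
Let ip n : is_ideal (ideal_pow m n). Proof. exact: ideal_pow_ideal. Qed.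
Let iFm n : is_ideal (IFm n). Proof. exact: ideal_add_ideal. Qed.

Let epsD a b : eps (a + b) = eps a + eps b.
Proof. by rewrite -big_split; apply: eq_bigr => e _; rewrite border_detD // mulrDr. Qed.

Let epsM a b : eps (a * b) = eps a * b + a * eps b.
Proof.
rewrite mulr_suml mulr_sumr -big_split; apply: eq_bigr => e _ /=.
by rewrite border_detM //; ring.
Qed.

Let eps0 : eps 0 = 0.
Proof. by apply: (addrI (eps 0)); rewrite -epsD !addr0. Qed.

Let eps_m a : m (eps a).
Proof. by apply: ideal_sum => // e _; rewrite mulrC; apply: idealM. Qed.

Let IFm_mul i j a b : ideal_pow m j a -> IFm i b -> IFm (j + i) (a * b).
Proof.
move=> ja [f Ff [q mq ->]]; rewrite mulrDr; apply: idealD => //.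
  by apply: ideal_addl => //; apply: idealM.
by apply: ideal_addr => //; apply: ideal_pow_mul.
Qed.

Let m1 a : m a -> ideal_pow m 1 a. Proof. by move=> ma; apply/ideal_pow1. Qed.

Let eps_F a : IF a -> IF (eps a).
Proof.
move=> Fa; suff h : IF `<=` [set a | IF a /\ IF (eps a)] by case: (h _ Fa).
apply: ideal_gen_min => [|_ [i _ <-]].
  split; first by split; rewrite ?eps0; apply: ideal0.
  move=> c f g [Ff Fef] [Fg Feg]; split; first exact: idealMD.
  rewrite epsD epsM; apply: idealD => //; apply: idealD => //; last exact: idealM.
  exact: idealM.
split; first by apply: ideal_gen_id; exists i.
rewrite big1; first exact: ideal0.
by move=> e _; rewrite border_detF mulr0.
Qed.

(** In the expansion along the column of [e], the sum over [e] against [Y e] turns every entry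
    [d e g] into [g] modulo the square of [m]. The entries of the [F i] fall into the ideal, and the
    last one contributes [delta * a]. *)
Let eps1 a : m a -> IFm 2 (eps a - delta * a).
Proof.
move=> ma; pose cof i := cofactor (border_mx d F cols e0 a) (lift ord_max i) ord_max.
have -> : eps a = \sum_i (\sum_e Y e * d e (F i)) * cof i + (\sum_e Y e * d e a) * delta.
  have eE e : Y e * D e a = \sum_i Y e * d e (F i) * cof i + Y e * d e a * delta.
    rewrite (border_det_col d F cols e e0 a) big_ord_recr /= border_rowE border_cofactor_max.
    rewrite mulrDr mulrA mulr_sumr; congr (_ + _); apply: eq_bigr => i _.
    have -> : widen_ord (leqnSn r) i = lift ord_max i by apply/val_inj; rewrite /= /bump leqNgt ltn_ord.
    by rewrite border_row_lift mulrA.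
  rewrite (eq_bigr _ (fun e _ => eE e)) big_split exchange_big mulr_suml /=.
  by congr (_ + _); apply: eq_bigr => i _; rewrite mulr_suml.
have -> x y : x + y * delta - delta * a = x + delta * (y - a) by ring.
apply: idealD => //; last by apply: idealM => //; apply: ideal_addr => //; apply: euler.
apply: ideal_sum => // i _; rewrite mulrC; apply: idealM => //.
rewrite -[X in IFm 2 X](subrK (F i)); apply: idealD => //.
  by apply: ideal_addr => //; apply/euler/Jm.
by apply: ideal_addl => //; apply: ideal_gen_id; exists i.
Qed.

Let eps_pow n q : ideal_pow m n q -> IFm n.+1 (eps q - n%:R * delta * q).
Proof.
elim: n q => [|n IH] q.
  move=> _; rewrite !mul0r subr0; apply: ideal_addr => //; exact: m1.
pose K := [set q | ideal_pow m n.+1 q /\ IFm n.+2 (eps q - n.+1%:R * delta * q)].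
suff h : ideal_pow m n.+1 `<=` K by case/h.
have iK : is_ideal K.
  split; first by split; [exact: ideal0|rewrite eps0 mulr0 subr0; exact: ideal0].
  move=> c f g [mf hf] [mg hg]; split; first exact: idealMD.
  have -> : eps (c * f + g) - n.+1%:R * delta * (c * f + g) = eps c * f +
      (c * (eps f - n.+1%:R * delta * f) + (eps g - n.+1%:R * delta * g)).
    by rewrite epsD epsM; ring.
  apply: idealD => //; last exact: idealMD.
  apply: ideal_addr => //; apply: (@ideal_pow_mul _ m 1 n.+1) => //; exact: m1.
apply: (ideal_gen_min iK) => _ [a ma [b mb ->]]; split.
  exact: ideal_powS.
have -> : eps (a * b) - n.+1%:R * delta * (a * b) =
    b * (eps a - delta * a) + a * (eps b - n%:R * delta * b).
  by rewrite epsM -natr1; ring.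
apply: idealD => //.
  by rewrite -addn2; apply: IFm_mul => //; apply: eps1.
by apply: (@IFm_mul n.+1 1) => //; [exact: m1|exact: IH].
Qed.

Lemma border_filtration n : J `<=` IFm n.
Proof.
elim: n => [|n IH] h Jh; first by apply: ideal_addr.
(* Order one is the hypothesis [Jm]. It cannot come from the induction, since [eps] acts on the
   [n]-th power as [n * delta], which is zero for [n = 0]. *)
case: n IH => [_|n IH]; first by apply: ideal_addr => //; apply/m1/Jm.
have [f Ff [q mq hE]] := IH h Jh.
have epsh : IFm n.+2 (eps h).
  apply: ideal_sum => // e _; apply: (@IFm_mul n.+1 1); first exact: m1.
  exact/IH/DJ.
have dq : IFm n.+2 (n.+1%:R * delta * q).
  have -> : n.+1%:R * delta * q = eps h - eps f - (eps q - n.+1%:R * delta * q).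
    by rewrite hE epsD; ring.
  apply: idealB => //; last exact: eps_pow.
  by apply: idealB => //; apply: ideal_addl => //; apply: eps_F.
have [c cE] := natV n; have [b bm] := detV.
rewrite hE; apply: idealD => //; first by apply: ideal_addl.
have -> : q = (1 - b * delta) * q + b * (c * (n.+1%:R * delta * q)).
  have -> : b * (c * (n.+1%:R * delta * q)) = (c * n.+1%:R) * (b * delta * q) by ring.
  by rewrite cE; ring.
apply: idealD => //; last by do 2!apply: idealM => //.
by apply: ideal_addr => //; apply: (@ideal_pow_mul _ m 1 n.+1) => //; exact: m1.
Qed.

(** Krull's theorem supplies a factor [1 - c] for each [h]; the product of the factors of finitely
    many generators serves for all of [J]. *)
Lemma border_localization : noetherian A ->
  exists2 s, m (1 - s) & forall h, J h -> IF (s * h).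
Proof.
move=> nA; have loc h : J h -> exists2 c, m c & IF (h - c * h).
  move=> Jh; apply: (krull_intersection nA im iF) => n; exact: border_filtration.
have [t tJ Jt] := nA J iJ.
have [s sm st] : exists2 s, m (1 - s) & forall h, h \in t -> IF (s * h).
  elim: t tJ {Jt} => [|h t IH] tJ; first by exists 1; rewrite ?subrr //; exact: ideal0.
  have [|s sm st] := IH; first by move=> f ft; apply: tJ; rewrite inE ft orbT.
  have [c cm ch] := loc h (tJ h (mem_head _ _)).
  exists (s * (1 - c)).
    have -> : 1 - s * (1 - c) = (1 - s) + s * c by ring.
    by apply: idealD => //; apply: idealM.
  move=> f; rewrite inE => /predU1P[->|ft].
    by rewrite -mulrA mulrBl mul1r; apply: idealM.
  by rewrite mulrAC mulrC; apply: idealM => //; apply: st.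
exists s => // h Jh; have iK : is_ideal [set h | IF (s * h)].
  split; first by rewrite /= mulr0; apply: ideal0.
  move=> a f g /= hf hg; rewrite mulrDr mulrCA; exact: idealMD.
apply: (ideal_gen_min iK _ (Jt _ Jh)) => f /=; exact: st.
Qed.

End BorderedFiltration.

Section Generation.
Variables (L : finType) (l0 : L).
Local Notation M := (character L).

Lemma char_ind (P : M -> Prop) : P 0 -> (forall u v, P u -> P v -> P (u + v)) ->
  (forall l, P (coord l0 l)) -> (forall l, P (- coord l0 l)) -> forall u, P u.
Proof.
move=> P0 PD Pc PNc u; rewrite [u](char_coord l0).
have Pn v n : P v -> P (v *+ n).
  by move=> Pv; elim: n => [|n IH]; rewrite ?mulr0n // mulrS; apply: PD.
elim/big_ind: _ => // l _; case: (u l) => n; first exact: Pn.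
by rewrite NegzE mulrNz -mulNrz; apply: (Pn _ n.+1).
Qed.

Variable k : comNzRingType.

Lemma grpalg_ind (P : grpalg k M -> Prop) :
  (forall f g, P f -> P g -> P (f + g)) -> (forall f g, P f -> P g -> P (f * g)) ->
  (forall c, P c%:A) -> (forall l, P (gaX k (coord l0 l))) ->
  (forall l, P (gaX k (- coord l0 l))) -> forall f, P f.
Proof.
move=> PD PM Pc PX PNX f; have P1 : P 1 by rewrite -[1]scale1r.
elim/ga_ind: f => [|c u f IH]; first by rewrite -(scale0r 1).
suff Pu : P (gaX k u).
  by apply: PD IH; have -> := esym (mulr_algl c (gaX k u)); apply: PM.
move: u; apply: (@char_ind (fun u => P (gaX k u)) P1 _ PX PNX) => u v Pu Pv.
by rewrite gaXD; apply: PM.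
Qed.

End Generation.

Section Presentation.
Variables (k : fieldType) (A : comAlgType k).

Definition mpoly_eval n (g : 'I_n -> A) : mpoly.mpoly n k -> A :=
  mpoly.mmap (in_alg A) g.

HB.instance Definition _ n (g : 'I_n -> A) :=
  GRing.RMorphism.on (mpoly_eval g).

Lemma mpoly_evalZ n (g : 'I_n -> A) : scalable (mpoly_eval g).
Proof. by move=> c f; rewrite /mpoly_eval mpoly.mmapZ mulr_algl. Qed.

HB.instance Definition _ n (g : 'I_n -> A) :=
  GRing.isScalable.Build k (mpoly.mpoly n k) A *:%R (mpoly_eval g) (mpoly_evalZ g).

Lemma mpoly_evalX n (g : 'I_n -> A) i :
  mpoly_eval g (mpoly.mpolyX k (mpoly.mnm1 i)) = g i.
Proof. by rewrite /mpoly_eval mpoly.mmapX mpoly.mmap1U. Qed.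

Lemma finitely_presented_surj n (p : {lrmorphism mpoly.mpoly n k -> A}) :
  (forall y, exists x, p x = y) -> finitely_presented A.
Proof.
move=> surj; exists n, p; split=> //; apply: noetherian_range.
  exact: noetherian_mpoly.
split; first by rewrite /= rmorph0.
by move=> a f g /= pf pg; rewrite linearD rmorphM /= pf pg mulr0 addr0.
Qed.

End Presentation.

Section GroupAlgebraPresentation.
Variables (L : finType) (l0 : L) (k : fieldType).
Local Notation CM := (grpalg k (character L)).

Lemma grpalg_quotient_surj (A : comAlgType k) (h : {rmorphism CM -> A}) :
  (forall c, h c%:A = c%:A) -> (forall y, exists x, h x = y) ->
  exists n (p : {lrmorphism mpoly.mpoly n k -> A}), forall y, exists x, p x = y.
Proof.
move=> hc surj; exists #|{: L * bool}|.
pose g (i : 'I_#|{: L * bool}|) : CM :=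
  let e := enum_val i in gaX k (if e.2 then coord l0 e.1 else - coord l0 e.1).
pose p : {lrmorphism mpoly.mpoly _ k -> A} := mpoly_eval (fun i => h (g i)).
have pX i : p (mpoly.mpolyX k (mpoly.mnm1 i)) = h (g i) by exact: mpoly_evalX.
exists p => y; have [f <-] := surj y; move: f {y}; apply: (@grpalg_ind _ l0 _ (fun f => exists x, p x = h f)).
- by move=> f g' [a ha] [b hb]; exists (a + b); rewrite !rmorphD /= ha hb.
- by move=> f g' [a ha] [b hb]; exists (a * b); rewrite !rmorphM /= ha hb.
- by move=> c; exists c%:A; rewrite hc linearZ /= rmorph1.
- move=> l; exists (mpoly.mpolyX k (mpoly.mnm1 (enum_rank (l, true)))).
  by rewrite pX /g enum_rankK.
- move=> l; exists (mpoly.mpolyX k (mpoly.mnm1 (enum_rank (l, false)))).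
  by rewrite pX /g enum_rankK.
Qed.

Lemma finitely_presented_quotient (I : idealr CM) : finitely_presented {ideal_quot I}.
Proof.
pose h : {rmorphism CM -> {ideal_quot I}} := \pi_{ideal_quot I}%qT.
have hc c : h c%:A = c%:A by rewrite -[RHS]/(h (c%:A) * 1) mulr1.
have hs y : exists x, h x = y by exists (repr y); apply: reprK.
have [n [p surj]] := grpalg_quotient_surj hc hs.
exact: (finitely_presented_surj surj).
Qed.

Lemma noetherian_grpalg : noetherian CM.
Proof.
have [y|n [p surj]] := @grpalg_quotient_surj CM idfun (fun _ => erefl); first by exists y.
exact: (noetherian_surj (h := p) surj (@noetherian_mpoly k n)).
Qed.

End GroupAlgebraPresentation.

Section FirstOrder.
Variables (L : finType) (l0 : L) (A : comNzRingType) (E : character L -> A).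
Hypothesis E0 : E 0 = 1.
Hypothesis ED : forall u v, E (u + v) = E u * E v.
Variable m : set A.
Hypotheses (im : is_ideal m) (mE : forall u, m (E u - 1)).

(** The defect [G] is additive up to products of two elements of [m], and it vanishes on the
    generators [coord l0 l]. *)
Lemma char_first_order u :
  ideal_pow m 2 (E u - 1 - \sum_e (E (coord l0 e) - 1) *~ u e).
Proof.
pose G u := E u - 1 - \sum_e (E (coord l0 e) - 1) *~ u e.
have ip : is_ideal (ideal_pow m 2) by exact: ideal_pow_ideal.
have GD v v' : G (v + v') = (E v - 1) * (E v' - 1) + (G v + G v').
  have e1 : \sum_e (E (coord l0 e) - 1) *~ (v + v') e =
      \sum_e (E (coord l0 e) - 1) *~ v e + \sum_e (E (coord l0 e) - 1) *~ v' e.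
    by rewrite -big_split; apply: eq_bigr => e _; rewrite char_add mulrzDr.
  by rewrite /G e1 ED; ring.
have mm v v' : ideal_pow m 2 ((E v - 1) * (E v' - 1)).
  by apply: ideal_powS => //; apply/ideal_pow1.
have G0 : G 0 = 0.
  by rewrite /G E0 subrr big1 ?subr0 // => e _; rewrite char_zero mulr0z.
have Gc l : G (coord l0 l) = 0.
  rewrite /G; under eq_bigr do rewrite coordE.
  have c0 : coord l0 l0 = 0.
    by apply/val_inj/ffunP => i; rewrite ffunE subrr ffunE.
  have e2 x : \sum_e (E (coord l0 e) - 1) *~ ((e == x)%:R : int) = E (coord l0 x) - 1.
    rewrite (bigD1 x) //= eqxx mulr1z big1 ?addr0 // => e /negPf->.
    by rewrite mulr0z.
  under eq_bigr do rewrite mulrzBr.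
  by rewrite sumrB !e2 c0 E0 subrr subr0 subrr.
rewrite -/(G u); move: u; apply: (@char_ind _ l0) => [|u v Gu Gv|l|l].
- by rewrite G0; apply: ideal0.
- by rewrite GD; apply: idealD => //; apply: idealD.
- by rewrite Gc; apply: ideal0.
have -> : G (- coord l0 l) = - ((E (coord l0 l) - 1) * (E (- coord l0 l) - 1)).
  have := GD (coord l0 l) (- coord l0 l); rewrite subrr G0 Gc add0r => /esym/eqP.
  by rewrite addrC addr_eq0 => /eqP.
exact: idealN.
Qed.

End FirstOrder.

Section AlgebraIdentities.
Variables (k : comNzRingType) (A : comAlgType k).
Implicit Types (a b c d : A) (t s : k).

Lemma mul_scale_int a b d t (n : int) :
  a * (t *: (b *~ n) + d) = t *: (b * (a *~ n)) + a * d.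
Proof. by rewrite mulrDr -scalerAr mulrzAr mulrzAr mulrC. Qed.

Lemma scale_sub_regroup a b c d e t s :
  t *: (a * b) + c - (t *: a + d - ((t * s)%:A + e)) =
  t *: (a * b - (a - s%:A)) + (c - (d - e)).
Proof.
rewrite !scalerBr scalerA; move: (t *: (a * b)) (t *: a) ((t * s) *: 1) => x y z.
ring.
Qed.

Lemma scale_square_regroup a b t :
  t *: a * b - (t *: a - t%:A) = t *: ((a - 1) * (a - 1) - a * (a - 1 - b)).
Proof. by rewrite -scalerAl -!scalerBr; congr (_ *: _); ring. Qed.

End AlgebraIdentities.

Section Localization.
Variables (L : finType) (R : realType) (l0 : L).
Local Notation C := (complex R).
Local Notation M := (character L).
Local Notation CM := (grpalg C M).
Variable x : L -> C.
Hypothesis x0 : forall i, x i != 0.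
Local Notation m := [set f : CM | evalT f x = 0].

Definition norm_char (u : M) : CM := (char_at x u)^-1 *: gaX C u.

Lemma norm_char0 : norm_char 0 = 1.
Proof. by rewrite /norm_char char_at0 invr1 scale1r gaX0. Qed.

Lemma norm_charD u v : norm_char (u + v) = norm_char u * norm_char v.
Proof.
by rewrite /norm_char char_atD // gaXD invfM -scalerAl -scalerAr scalerA.
Qed.

Lemma norm_char_ideal u : m (norm_char u - 1).
Proof.
by rewrite /= evalTB evalT1 evalTZ evalTX mulVf ?subrr // char_at_neq0.
Qed.

(** First-order Taylor expansion at [x] in the parameters [norm_char (coord l0 e) - 1]. On a
    monomial it follows from [char_first_order]; linearity requires carrying the constant term
    along. *)
Lemma euler_dlog f :
  m f -> ideal_pow m 2 (\sum_e (norm_char (coord l0 e) - 1) * dlog e f - f).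
Proof.
have im := point_ideal x0; have ip : is_ideal (ideal_pow m 2) by exact: ideal_pow_ideal.
pose Y e := norm_char (coord l0 e) - 1.
suff h : ideal_pow m 2 (\sum_e Y e * dlog e f - (f - (evalT f x)%:A)).
  by move=> fx; move: h; rewrite (fx : evalT f x = 0) scale0r subr0.
elim/ga_ind: f => [|c u f IH].
  rewrite evalT0 scale0r !subr0 big1; first exact: ideal0.
  by move=> e _; rewrite dlog0 mulr0.
have -> : \sum_e Y e * dlog e (c *: gaX C u + f) =
    c *: (gaX C u * \sum_e Y e *~ u e) + \sum_e Y e * dlog e f.
  rewrite mulr_sumr scaler_sumr -big_split; apply: eq_bigr => e _ /=.
  have -> : dlog e (c *: gaX C u + f) = c *: (gaX C u *~ u e) + dlog e f.
    by rewrite dlogD dlogZ dlogX scaler_int.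
  exact: mul_scale_int.
rewrite evalTD evalTZ evalTX scalerDl.
set S := \sum_e Y e *~ _; set T := \sum_e Y e * _; set f1 := (evalT f x)%:A.
have -> : c *: (gaX C u * S) + T - (c *: gaX C u + f - ((c * char_at x u)%:A + f1)) =
    c *: (gaX C u * S - (gaX C u - (char_at x u)%:A)) + (T - (f - f1)).
  exact: scale_sub_regroup.
apply: idealD IH => //; apply: idealZ => //.
have XE : gaX C u = char_at x u *: norm_char u.
  by rewrite /norm_char scalerA mulfV ?scale1r // char_at_neq0.
have -> : gaX C u * S - (gaX C u - (char_at x u)%:A) =
    char_at x u *: ((norm_char u - 1) * (norm_char u - 1) -
      norm_char u * (norm_char u - 1 - S)).
  by rewrite {}XE; apply: scale_square_regroup.
apply: idealZ => //; apply: idealB => //.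
  by apply: ideal_powS; [|apply/ideal_pow1 => //]; apply: norm_char_ideal.
have h := char_first_order l0 norm_char0 norm_charD im norm_char_ideal u.
exact: (idealM (norm_char u) ip h).
Qed.

Lemma init_ideal_local (w : L -> R) (I : set CM) r (F : 'I_r -> CM) (cols : 'I_r -> L) :
  let f i := weight_part (fun u : M => pairing u w) 0 (F i) in
  init_ideal w I `<=` m ->
  (forall i, weight_ge (fun u : M => pairing u w) 0 (F i)) -> (forall i, I (F i)) ->
  (forall e g, I g -> I (border_det dlog F cols e g)) ->
  evalT (\det (jac_mx dlog f cols)) x != 0 ->
  exists2 s, evalT s x != 0 & forall h, init_ideal w I h -> ideal_gen (range f) (s * h).
Proof.
move=> f Im F0 FI DI det0.
have im := point_ideal x0.
have iJ : is_ideal (init_ideal w I) := @ideal_gen_ideal _ _.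
have natV n : exists c : CM, c * n.+1%:R = 1.
  exists (n.+1%:R^-1)%:A; rewrite mulr_natr -scaler_nat scalerA.
  by rewrite mulfV ?scale1r // pnatr_eq0.
have fI i : init_ideal w I (f i) by apply: wpart_init_ideal.
have DJ e := border_det_init_ideal F0 (DI e).
have detV : exists c, m (1 - c * \det (jac_mx dlog f cols)).
  exists ((evalT (\det (jac_mx dlog f cols)) x)^-1)%:A => /=.
  by rewrite evalTB evalT1 mulr_algl evalTZ mulVf // subrr.
have [s ms sI] := border_localization l0 (@dlogD _ _) (@dlogM _ _) im iJ Im
  (fun e => norm_char_ideal (coord l0 e)) euler_dlog natV fI DJ detV (@noetherian_grpalg _ l0 C).
exists s => //; move: ms; rewrite /= evalTB evalT1 // => /eqP.
by rewrite subr_eq0 => /eqP <-; rewrite oner_eq0.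
Qed.

End Localization.

(** * Infinitesimal lifting *)

Section QuotientLift.
Local Open Scope quotient_scope.
Variables (k : comNzRingType) (A : comAlgType k) (I : idealr A) (B : comAlgType k).
Variable phi : A -> B.
Hypothesis phiD : forall a b, phi (a + b) = phi a + phi b.
Hypothesis phiM : forall a b, phi (a * b) = phi a * phi b.
Hypothesis phi1 : phi 1 = 1.
Hypothesis phiZ : forall c a, phi (c *: a) = c *: phi a.
Hypothesis phiI : forall a, a \in I -> phi a = 0.
Local Notation Q := {ideal_quot I}.

Definition quot_fun (q : Q) : B := phi (repr q).

Let phi0 : phi 0 = 0.
Proof. by apply: (addrI (phi 0)); rewrite -phiD !addr0. Qed.

Lemma quot_fun_pi a : quot_fun (\pi_Q a) = phi a.
Proof.
have : a - repr (\pi_Q a) \in I by rewrite Quotient.idealrBE reprK.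
move=> /phiI aI; rewrite /quot_fun -[in RHS](subrK (repr (\pi_Q a)) a) phiD aI.
by rewrite add0r.
Qed.

Lemma quot_fun_nmod : nmod_morphism quot_fun.
Proof.
split=> [|p q]; first by rewrite -(rmorph0 \pi_Q) /= quot_fun_pi phi0.
by rewrite -[p]reprK -[q]reprK -rmorphD /= !quot_fun_pi phiD.
Qed.

Lemma quot_fun_monoid : monoid_morphism quot_fun.
Proof.
split=> [|p q]; first by rewrite -(rmorph1 \pi_Q) /= quot_fun_pi.
by rewrite -[p]reprK -[q]reprK -rmorphM /= !quot_fun_pi phiM.
Qed.

Lemma quot_fun_scale : scalable quot_fun.
Proof.
move=> c q; rewrite -[q]reprK.
have -> : c *: \pi_Q (repr q) = \pi_Q (c *: repr q).
  by rewrite -[LHS]/(\pi_Q (c%:A) * _) -rmorphM /= mulr_algl.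
by rewrite !quot_fun_pi phiZ.
Qed.

HB.instance Definition _ := GRing.isNmodMorphism.Build Q B quot_fun quot_fun_nmod.
HB.instance Definition _ := GRing.isMonoidMorphism.Build Q B quot_fun quot_fun_monoid.
HB.instance Definition _ := GRing.isScalable.Build k Q B *:%R quot_fun quot_fun_scale.

Lemma quot_lift : exists g : {lrmorphism Q -> B}, forall a, g (\pi_Q a) = phi a.
Proof. by exists quot_fun; apply: quot_fun_pi. Qed.

End QuotientLift.

Section InversePowers.
Variable B : comNzRingType.
Implicit Types (b c : B) (n : int).

(** Integer power of a unit [b] given together with its inverse [c]. *)
Definition zpow b c n : B := if n is Negz m then c ^+ m.+1 else b ^+ `|n|%N.

Lemma zpowS b c n : b * c = 1 -> zpow b c (n + 1) = zpow b c n * b.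
Proof.
move=> bc; case: n => n; first by rewrite -PoszD addn1 /= exprSr.
rewrite NegzE; case: n => [|n]; first by rewrite addNr /= expr1 mulrC bc.
have -> : - n.+2%:Z + 1 = Negz n by rewrite NegzE; lia.
by rewrite -NegzE /= [in RHS]exprSr -mulrA (mulrC c) bc mulr1.
Qed.

Lemma zpowP b c n : b * c = 1 -> zpow b c (n - 1) = zpow b c n * c.
Proof.
by move=> bc; rewrite -[in RHS](subrK 1 n) (zpowS _ bc) -mulrA bc mulr1.
Qed.

Lemma zpowD b c m n : b * c = 1 -> zpow b c (m + n) = zpow b c m * zpow b c n.
Proof.
move=> bc; elim/int_rect: n => [|n IH|n IH]; first by rewrite addr0 mulr1.
  by rewrite -addn1 PoszD addrA !zpowS // IH mulrA.
by rewrite -addn1 PoszD opprD addrA !zpowP // IH mulrA.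
Qed.

End InversePowers.

Section JacobianLift.
Variables (A B : comNzRingType) (L : finType) (d : L -> A -> A) (ev : A -> B).
Hypothesis dD : forall l f g, d l (f + g) = d l f + d l g.
Hypothesis dM : forall l f g, d l (f * g) = d l f * g + f * d l g.
Hypothesis evD : forall f g, ev (f + g) = ev f + ev g.
Hypothesis evM : forall f g, ev (f * g) = ev f * ev g.
Variables (J : set A) (K : set B).
Hypotheses (iK : is_ideal K) (K2 : forall x y, K x -> K y -> x * y = 0).
Hypothesis evJ : forall h, J h -> K (ev h).

Lemma first_orderM (n : L -> B) a b : (forall l, K (n l)) ->
  ev (a * b) + \sum_l ev (d l (a * b)) * n l =
  (ev a + \sum_l ev (d l a) * n l) * (ev b + \sum_l ev (d l b) * n l).
Proof.
move=> Kn; pose T c := \sum_l ev (d l c) * n l.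
have KT c : K (T c) by apply: ideal_sum => // l _; apply: idealM.
have TM : T (a * b) = T a * ev b + ev a * T b.
  rewrite mulr_suml mulr_sumr -big_split; apply: eq_bigr => l _ /=.
  by rewrite dM evD !evM; ring.
rewrite -/(T a) -/(T b) -/(T (a * b)) TM evM mulrDl !mulrDr (K2 (KT a) (KT b)).
by rewrite addr0 -addrA; congr (_ + _); rewrite addrC.
Qed.

(** The multiples of the lifting obstruction that a first-order correction [n] can cancel. If [1]
    belongs to it, [ev] can be corrected so as to kill [J]; being an ideal, it can be tested at
    closed points one at a time. *)
Definition lift_ideal : set A := [set a | exists2 n : L -> B, (forall l, K (n l)) &
  forall h, J h -> ev a * ev h + \sum_l ev (d l h) * n l = 0].

Let ev0 : ev 0 = 0.
Proof. by apply: (addrI (ev 0)); rewrite -evD !addr0. Qed.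

Let ev_sum (I : Type) (r : seq I) (P : pred I) (G : I -> A) :
  ev (\sum_(i <- r | P i) G i) = \sum_(i <- r | P i) ev (G i).
Proof. exact: (big_morph ev evD ev0). Qed.

Let d0 l : d l 0 = 0.
Proof. by apply: (addrI (d l 0)); rewrite -dD !addr0. Qed.

Let d_sum l (I : Type) (r : seq I) (P : pred I) (G : I -> A) :
  d l (\sum_(i <- r | P i) G i) = \sum_(i <- r | P i) d l (G i).
Proof. exact: (big_morph (d l) (dD l) (d0 l)). Qed.

Lemma lift_ideal_ideal : is_ideal lift_ideal.
Proof.
split=> [|a f g [n Kn hn] [n' Kn' hn']].
  exists (fun=> 0) => [l|h Jh]; first exact: ideal0.
  by rewrite ev0 mul0r big1 ?addr0 // => l _; rewrite mulr0.
exists (fun l => ev a * n l + n' l) => [l|h Jh]; first exact: idealMD.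
under eq_bigr do rewrite mulrDr mulrCA.
rewrite big_split /= -mulr_sumr evD evM.
have e (x y z u v t : B) : (x * y + z) * t + (x * u + v) = x * (y * t + u) + (z * t + v) by ring.
by rewrite e hn // hn' // mulr0 addr0.
Qed.

Lemma lift_ideal_sub : J `<=` lift_ideal.
Proof.
move=> a Ja; exists (fun=> 0) => [l|h Jh]; first exact: ideal0.
by rewrite K2 ?add0r; [rewrite big1 // => l _; rewrite mulr0|exact: evJ|exact: evJ].
Qed.

(** One Newton step: by Cramer's rule the correction [- \adj D * f] cancels the [f i] multiplied by
    the determinant. The other elements of [J] follow after multiplication by [s], which brings them
    into the ideal of the [f i]. *)
Lemma lift_ideal_jac r (f : 'I_r -> A) (cols : 'I_r -> L) s :
  (forall i, J (f i)) -> (forall h, J h -> ideal_gen (range f) (s * h)) ->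
  lift_ideal (s * \det (jac_mx d f cols)).
Proof.
move=> fJ sJ; set D := jac_mx d f cols.
pose t j := - \sum_k ev (\adj D j k) * ev (f k).
have Kt j : K (t j).
  by apply: idealN => //; apply: ideal_sum => // k _; apply: idealM => //; apply: evJ.
exists (fun l => ev s * \sum_(j | cols j == l) t j) => [l|h Jh].
  by apply: idealM => //; apply: ideal_sum.
have regroup : \sum_l ev (d l h) * (ev s * \sum_(j | cols j == l) t j) =
    \sum_j ev s * ev (d (cols j) h) * t j.
  under eq_bigr do rewrite mulrA [_ * ev s]mulrC mulr_sumr.
  rewrite (exchange_big_dep xpredT) //=; apply: eq_bigr => j _.
  by rewrite (big_pred1 (cols j)) // => l; rewrite eq_sym.
have [a shE] : exists a : 'I_r -> A, s * h = \sum_i a i * f i.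
  have : [set g | exists a : 'I_r -> A, g = \sum_i a i * f i] (s * h).
    apply: (ideal_gen_min _ _ (sJ h Jh)) => [|_ [i _ <-]].
      split; first by exists (fun=> 0); rewrite big1 // => i _; rewrite mul0r.
      move=> c _ _ [a1 ->] [a2 ->]; exists (fun i => c * a1 i + a2 i).
      rewrite mulr_sumr -big_split; apply: eq_bigr => i _ /=.
      by rewrite mulrA mulrDl.
    exists (fun j => (j == i)%:R); rewrite (bigD1 i) //= eqxx mul1r big1 ?addr0 //.
    by move=> j /negPf->; rewrite mul0r.
  by case=> a; exists a.
(* This is the derivative of [shE]. The terms where [s] or [a i] is differentiated keep a factor [h]
   or [f i], whose image in [K] dies against [t']. *)
have key l t' : K t' -> ev s * ev (d l h) * t' = \sum_i ev (a i) * ev (d l (f i)) * t'.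
  move=> Kt'; have := congr1 (fun x => ev (d l x) * t') shE.
  rewrite /= dM evD !evM mulrDl.
  have -> : ev (d l s) * ev h * t' = 0 by rewrite -mulrA (K2 (evJ Jh) Kt') mulr0.
  rewrite add0r => ->; rewrite d_sum ev_sum mulr_suml; apply: eq_bigr => i _.
  rewrite dM evD !evM mulrDl.
  have -> : ev (d l (a i)) * ev (f i) * t' = 0.
    by rewrite -mulrA (K2 (evJ (fJ i)) Kt') mulr0.
  by rewrite add0r.
rewrite regroup (eq_bigr _ (fun j _ => key (cols j) (t j) (Kt j))) exchange_big /=.
have adj i : \sum_j ev (a i) * ev (d (cols j) (f i)) * t j =
    - (ev (a i) * ev (\det D) * ev (f i)).
  have -> : \sum_j ev (a i) * ev (d (cols j) (f i)) * t j =
      - (ev (a i) * \sum_k ev ((D *m \adj D) i k) * ev (f k)).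
    rewrite -mulrN -sumrN mulr_sumr.
    have e1 k : ev ((D *m \adj D) i k) = \sum_j ev (d (cols j) (f i)) * ev (\adj D j k).
      by rewrite mxE ev_sum; apply: eq_bigr => j _; rewrite evM mxE.
    under [RHS]eq_bigr do rewrite e1 mulr_suml -sumrN mulr_sumr.
    rewrite exchange_big; apply: eq_bigr => j _ /=; rewrite /t mulrN mulr_sumr -sumrN.
    by apply: eq_bigr => k _; ring.
  rewrite mul_mx_adj (bigD1 i) //= big1 ?addr0 => [|k ki].
    by rewrite mxE eqxx mulr1n mulrA.
  by rewrite mxE eq_sym (negPf ki) mulr0n ev0 mul0r.
rewrite (eq_bigr _ (fun i _ => adj i)) sumrN.
have -> : \sum_i ev (a i) * ev (\det D) * ev (f i) = ev (\det D) * ev (s * h).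
  rewrite shE; move: (\det D) => Delta; rewrite ev_sum mulr_sumr.
  by apply: eq_bigr => i _; rewrite evM; ring.
by rewrite !evM; ring.
Qed.

End JacobianLift.

Section TorusLift.
Variables (L : finType) (l0 : L) (k : comNzRingType).
Local Notation M := (character L).
Local Notation CM := (grpalg k M).
Variables (B B' : comAlgType k) (p : {lrmorphism B -> B'}).
Hypothesis surj : forall y, exists x, p x = y.
Hypothesis sqz : forall x y, p x = 0 -> p y = 0 -> x * y = 0.

Lemma lift_unit y y' : y * y' = 1 -> exists bc : B * B,
  [/\ p bc.1 = y, p bc.2 = y' & bc.1 * bc.2 = 1].
Proof.
move=> yy; have [b pb] := surj y; have [c pc] := surj y'.
pose n := b * c - 1; have pn : p n = 0 by rewrite linearB rmorphM /= pb pc yy rmorph1 subrr.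
have p1n : p (1 - n) = 1 by rewrite (rmorphB p 1 n : _ = p 1 - p n) pn rmorph1 subr0.
(* [b * c = 1 + n] with [n] in the kernel, so [1 - n] is the inverse of [1 + n]. *)
exists (b, c * (1 - n)); split=> //=; first by rewrite (rmorphM p c (1 - n) : p (c * (1 - n)) = p c * p (1 - n)) pc p1n mulr1.
have -> : b * (c * (1 - n)) = 1 - n * n by rewrite /n; ring.
by rewrite sqz // subr0.
Qed.

Variable chi : M -> B'.
Hypothesis chi0 : chi 0 = 1.
Hypothesis chiD : forall u v, chi (u + v) = chi u * chi v.

Lemma lift_char : exists chi' : M -> B, [/\ chi' 0 = 1,
  forall u v, chi' (u + v) = chi' u * chi' v & forall u, p (chi' u) = chi u].
Proof.
have /choice[bc bcP] : forall l, exists bc : B * B, [/\ p bc.1 = chi (coord l0 l),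
    p bc.2 = chi (- coord l0 l) & bc.1 * bc.2 = 1].
  by move=> l; apply: lift_unit; rewrite -chiD subrr.
exists (fun u => \prod_l zpow (bc l).1 (bc l).2 (u l)); split=> [|u v|u].
- by rewrite big1 // => l _; rewrite char_zero.
- rewrite -big_split; apply: eq_bigr => l _; rewrite char_add zpowD //.
  by case: (bcP l).
rewrite rmorph_prod [u in RHS](char_coord l0) (big_morph chi chiD chi0).
apply: eq_bigr => l _; have [p1 p2 _] := bcP l.
have chiX v n : chi (v *+ n) = chi v ^+ n.
  by elim: n => [|n IH]; rewrite ?mulr0n // mulrS chiD IH exprS.
case: (u l) => n; first by rewrite /= rmorphXn /= p1 -chiX.
by rewrite NegzE mulrNz -mulNrz /= rmorphXn /= p2 -chiX.
Qed.

End TorusLift.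

Section FormalSmoothness.
Variables (L : finType) (R : realType) (l0 : L).
Local Notation C := (complex R).
Local Notation M := (character L).
Local Notation CM := (grpalg C M).
Variables (S : set CM) (S1 : ideal_gen S <> ideal_gen [set 1]).
Local Notation J := (ideal_gen S).
Local Notation Q := {ideal_quot (ideal_of S1)}.

Hypothesis jac : forall x : L -> C, (forall l, x l != 0) -> (forall h, J h -> evalT h x = 0) ->
  exists r (f : 'I_r -> CM) (cols : 'I_r -> L), exists s, [/\ forall i, J (f i),
    evalT s x != 0, evalT (\det (jac_mx dlog f cols)) x != 0 &
    forall h, J h -> ideal_gen (range f) (s * h)].

(** Otherwise [lift_ideal] lies in the ideal of some closed point [x]. It contains [J], so [x] is a
    zero of [J], and there [jac] provides an element [s * det] of [lift_ideal] that does not vanish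
    at [x]. *)
Lemma lift_derivation (B : comAlgType C) (chi : M -> B) (K : set B) :
  chi 0 = 1 -> (forall u v, chi (u + v) = chi u * chi v) ->
  is_ideal K -> (forall x y, K x -> K y -> x * y = 0) ->
  (forall h, J h -> K (gaev (in_alg B) chi h)) ->
  exists2 n : L -> B, (forall l, K (n l)) & forall h, J h ->
    gaev (in_alg B) chi h + \sum_l gaev (in_alg B) chi (dlog l h) * n l = 0.
Proof.
move=> chi0 chiD iK K2 evJ; pose ev := gaev (in_alg B) chi.
have evD := gaevD (in_alg B) chi; have evM := gaevM (in_alg B) chiD.
have iA := lift_ideal_ideal dlog evD evM J iK.
suff [n Kn hn] : lift_ideal dlog ev J K 1.
  by exists n => // h Jh; have := hn h Jh; rewrite /ev gaev1 // mul1r.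
apply: contrapT => A1.
have [J1 [iJ1 J11 AJ1 J1max]] :=
  noetherian_maximal (@noetherian_grpalg _ l0 C) (P := fun J => ~ J 1) iA A1.
have [x x0 J1E] : exists2 z : L -> C, (forall i, z i != 0) & J1 = [set f | evalT f z = 0].
  by apply: (nullstellensatz l0).
have Jx h : J h -> evalT h x = 0.
  move=> Jh; have : J1 h by apply/AJ1/(lift_ideal_sub dlog iK K2 evJ).
  by rewrite J1E.
have [r [f [cols [s [fJ s0 D0 sJ]]]]] := jac x0 Jx.
have : J1 (s * \det (jac_mx dlog f cols)).
  by apply: AJ1; apply: (lift_ideal_jac (@dlogD _ _) (@dlogM _ _) evD evM iK K2 evJ).
by rewrite J1E /= evalTM // => /eqP; rewrite mulf_eq0 (negPf s0) (negPf D0).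
Qed.

Lemma mem_ideal_of h : (h \in ideal_of S1) <-> J h.
Proof. by split=> /asboolP. Qed.

Lemma quotient_formally_smooth : formally_smooth (Q : comAlgType C).
Proof.
move=> B B' p surj sqz f.
have piZ c a : \pi_Q%qT (c *: a) = c *: \pi_Q%qT a.
  by rewrite -[RHS]/(\pi_Q%qT (c%:A) * _) -rmorphM /= mulr_algl.
pose chi1 u := f (\pi_Q%qT (gaX C u)).
have chi10 : chi1 0 = 1 by rewrite /chi1 gaX0 !rmorph1.
have chi1D u v : chi1 (u + v) = chi1 u * chi1 v by rewrite /chi1 gaXD !rmorphM.
have [chi [chi0 chiD chiE]] := lift_char l0 surj sqz chi10 chi1D.
pose ev := gaev (in_alg B) chi.
have evD a b : ev (a + b) = ev a + ev b by exact: gaevD.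
have evM a b : ev (a * b) = ev a * ev b by exact: gaevM.
have ev1 : ev 1 = 1 by exact: gaev1.
have evZ c a : ev (c *: a) = c *: ev a by rewrite /ev gaevZ mulr_algl.
have evX u : ev (gaX C u) = chi u by exact: gaevX.
have ev0 : ev 0 = 0 by exact: gaev0.
have pD a b : p (a + b) = p a + p b by exact: linearD.
have pZ c a : p (c *: a) = c *: p a by exact: linearZ.
have p0 : p 0 = 0 by exact: linear0.
have f0 : f 0 = 0 by exact: linear0.
have pi0 : \pi_Q%qT 0 = 0 by exact: rmorph0.
have fD a b : f (a + b) = f a + f b by exact: linearD.
have fZ c a : f (c *: a) = c *: f a by exact: linearZ.
have piD a b : \pi_Q%qT (a + b) = \pi_Q%qT a + \pi_Q%qT b by exact: rmorphD.
have pE a : p (ev a) = f (\pi_Q%qT a).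
  elim/ga_ind: a => [|c u a IH]; first by rewrite ev0 pi0 p0 f0.
  by rewrite evD evZ pD pZ IH evX chiE piD piZ fD fZ.
have piJ h : J h -> \pi_Q%qT h = 0.
  move=> /mem_ideal_of Jh; rewrite -pi0; apply/eqP.
  by rewrite -Quotient.idealrBE subr0.
have iK : is_ideal [set b | p b = 0].
  split=> [|a b c]; rewrite /= ?p0 // => b0 c0.
  by rewrite pD rmorphM /= b0 c0 mulr0 addr0.
have [n Kn hn] : exists2 n : L -> B, (forall l, p (n l) = 0) & forall h, J h ->
    ev h + \sum_l ev (dlog l h) * n l = 0.
  apply: (lift_derivation chi0 chiD iK sqz) => h Jh.
  by rewrite /= -/(ev h) pE piJ.
clearbody ev.
pose phi a := ev a + \sum_l ev (dlog l a) * n l.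
have phiE a : p (phi a) = f (\pi_Q%qT a).
  rewrite /phi pD pE linear_sum big1 ?addr0 // => l _.
  by rewrite rmorphM /= Kn mulr0.
have phiD a b : phi (a + b) = phi a + phi b.
  rewrite /phi evD addrACA -big_split; congr (_ + _); apply: eq_bigr => l _.
  by rewrite dlogD evD mulrDl.
have phiM a b : phi (a * b) = phi a * phi b.
  exact: (first_orderM (@dlogM _ _) evD evM iK sqz a b Kn).
have phi1 : phi 1 = 1.
  rewrite /phi ev1 big1 ?addr0 // => l _.
  by rewrite -gaX0 dlogX char_zero scale0r ev0 mul0r.
have phiZ c a : phi (c *: a) = c *: phi a.
  rewrite /phi evZ scalerDr scaler_sumr; congr (_ + _); apply: eq_bigr => l _.
  by rewrite dlogZ evZ scalerAl.
have phiI a : a \in ideal_of S1 -> phi a = 0 by move=> /mem_ideal_of; apply: hn.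
have [g gE] := quot_lift phiD phiM phi1 phiZ phiI.
by exists g => q; rewrite -[q]reprK gE phiE.
Qed.

Lemma quotient_smooth : smooth (Q : comAlgType C).
Proof.
split; last exact: quotient_formally_smooth.
exact: finitely_presented_quotient.
Qed.

End FormalSmoothness.

(** * Pluecker coordinates of triples *)

Section PluckerTriples.
Variables (n : nat).
Local Notation L := (rsubset 3 n).
Variable l0 : L.
Implicit Types (a b c d i : 'I_n).

Lemma triple_card a b c : uniq [:: a; b; c] -> #|[set a; b; c]%SET| == 3%N.
Proof.
move=> /card_uniqP /= U; rewrite -U; apply/eqP/eq_card => e.
by rewrite !inE orbA.
Qed.

(** On repeated indices the default [l0] does no harm, because [tri_sign] vanishes there. *)
Definition triple a b c : L := insubd l0 [set a; b; c]%SET.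

Lemma tripleE a b c : uniq [:: a; b; c] -> val (triple a b c) = [set a; b; c]%SET.
Proof. by move=> U; rewrite val_insubd triple_card. Qed.

Lemma tripleC12 a b c : triple b a c = triple a b c.
Proof. by congr insubd; apply/setP => e; rewrite !inE [(e == b) || _]orbC. Qed.

Lemma tripleC23 a b c : triple a c b = triple a b c.
Proof. by congr insubd; apply/setP => e; rewrite !inE orbAC. Qed.

Lemma triple_surj (S : L) : exists a b c, uniq [:: a; b; c] /\ S = triple a b c.
Proof.
have := enum_uniq (val S); have := mem_enum (val S).
have : size (enum (val S)) = 3%N by rewrite -cardE; apply/eqP/(valP S).
case: (enum (val S)) => [|a [|b [|c [|//]]]] //= _ mE U.
exists a, b, c; split=> //; apply/val_inj; rewrite tripleE //.
by apply/setP => e; rewrite -mE !inE orbA.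
Qed.

Lemma enum_triple a b c : (a < b)%N -> (b < c)%N ->
  enum [set a; b; c]%SET = [:: a; b; c].
Proof.
move=> ab bc; apply: (inj_map val_inj).
apply: (irr_sorted_eq ltn_trans ltnn).
- rewrite -[enum _](eq_filter (mem_enum _)).
  rewrite -(eq_filter (mem_map val_inj _)) -filter_map.
  by rewrite (sorted_filter ltn_trans) // unlock val_ord_enum iota_ltn_sorted.
- by rewrite /= ab bc.
move=> e; apply/mapP/mapP => -[f fI ->]; exists f => //; move: fI;
  by rewrite mem_enum !inE orbA.
Qed.

Variable k : numFieldType.
Implicit Types (A : 'M[k]_(3, n)) (z : L -> k).

(** Sign of the Vandermonde product of the three positions, which is the sign of the permutation
    sorting them, or zero on a repetition. *)
Definition tri_sign a b c : k :=
  (Num.sg ((b%:Z - a%:Z) * (c%:Z - a%:Z) * (c%:Z - b%:Z)))%:~R.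

Lemma tri_sign12 a b c : tri_sign b a c = - tri_sign a b c.
Proof. by rewrite /tri_sign -rmorphN -sgrN; do 2 congr (_ _); ring. Qed.

Lemma tri_sign23 a b c : tri_sign a c b = - tri_sign a b c.
Proof. by rewrite /tri_sign -rmorphN -sgrN; do 2 congr (_ _); ring. Qed.

Lemma tri_sign_sorted a b c : (a < b)%N -> (b < c)%N -> tri_sign a b c = 1.
Proof.
move=> ab bc; rewrite /tri_sign gtr0_sg // !mulr_gt0 // subr_gt0 ltz_nat //.
exact: ltn_trans bc.
Qed.

Lemma tri_sign_eq0 a b c : (tri_sign a b c == 0) = ~~ uniq [:: a; b; c].
Proof.
rewrite /tri_sign intr_eq0 sgr_eq0 !mulf_eq0 !subr_eq0 !eqz_nat /= !inE andbT.
by rewrite -negb_or negbK (eq_sym a b) (eq_sym a c) (eq_sym b c).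
Qed.

Lemma tri_sign_sqr a b c : uniq [:: a; b; c] -> tri_sign a b c * tri_sign a b c = 1.
Proof.
move=> U; have : tri_sign a b c != 0 by rewrite tri_sign_eq0 negbK.
rewrite /tri_sign intr_eq0 sgr_eq0 => s0.
by rewrite -intrM -expr2 sqr_sg s0.
Qed.

(* Alternating extension of homogeneous coordinates to ordered triples. *)
Definition alt z a b c : k := tri_sign a b c * z (triple a b c).

Lemma alt12 z a b c : alt z b a c = - alt z a b c.
Proof. by rewrite /alt tri_sign12 tripleC12 mulNr. Qed.

Lemma alt23 z a b c : alt z a c b = - alt z a b c.
Proof. by rewrite /alt tri_sign23 tripleC23 mulNr. Qed.

Lemma alt_neq0 z a b c : (forall S, z S != 0) -> uniq [:: a; b; c] -> alt z a b c != 0.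
Proof. by move=> z0 U; rewrite mulf_neq0 // tri_sign_eq0 negbK. Qed.

Definition minor3 A a b c : k :=
  A 0 a * (A 1 b * A 2%:R c - A 1 c * A 2%:R b)
  - A 0 b * (A 1 a * A 2%:R c - A 1 c * A 2%:R a)
  + A 0 c * (A 1 a * A 2%:R b - A 1 b * A 2%:R a).

Lemma det3 (B : 'M[k]_3) : \det B =
  B 0 0 * (B 1 1 * B 2%:R 2%:R - B 1 2%:R * B 2%:R 1)
  - B 0 1 * (B 1 0 * B 2%:R 2%:R - B 1 2%:R * B 2%:R 0)
  + B 0 2%:R * (B 1 0 * B 2%:R 1 - B 1 1 * B 2%:R 0).
Proof.
have det2 (D : 'M[k]_2) : \det D = D 0 0 * D 1 1 - D 0 1 * D 1 0.
  rewrite (expand_det_row _ 0) !big_ord_recl big_ord0 addr0 /cofactor !det_mx11 !mxE.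
  have -> : lift 0 0 = 1 :> 'I_2 by apply/val_inj.
  have -> : lift 1 0 = 0 :> 'I_2 by apply/val_inj.
  by rewrite /=; ring.
rewrite (expand_det_row _ 0) !big_ord_recl big_ord0 addr0 /cofactor !det2 !mxE.
have -> : lift 0 0 = 1 :> 'I_3 by apply/val_inj.
have -> : lift 0 0 = 1 :> 'I_2 by apply/val_inj.
have -> : lift 0 1 = 2%:R :> 'I_3 by apply/val_inj.
have -> : lift 1 0 = 0 :> 'I_3 by apply/val_inj.
have -> : lift 1 1 = 2%:R :> 'I_3 by apply/val_inj.
have -> : lift 2%:R 0 = 0 :> 'I_3 by apply/val_inj.
have -> : lift 2%:R 1 = 1 :> 'I_3 by apply/val_inj.
rewrite /= /bump /=; ring.
Qed.

Lemma rsubset_nthE (S : L) x0 j : rsubset_nth S j = nth x0 (enum (val S)) j.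
Proof. by rewrite /rsubset_nth (enum_val_nth x0). Qed.

Lemma plucker_minor3 A (S : L) :
  plucker A S = minor3 A (rsubset_nth S 0) (rsubset_nth S 1) (rsubset_nth S 2%:R).
Proof. by rewrite /plucker det3 !mxE. Qed.

(** Both sides alternate, so transpositions reduce to an increasing triple or a repeated index. *)
Lemma alt_plucker A a b c : alt (plucker A) a b c = minor3 A a b c.
Proof.
pose P a b c := alt (plucker A) a b c = minor3 A a b c.
have P12 x y t : P x y t -> P y x t by rewrite /P => h; rewrite alt12 h /minor3; ring.
have P23 x y t : P x y t -> P x t y by rewrite /P => h; rewrite alt23 h /minor3; ring.
have sorted (x y t : 'I_n) : (x < y)%N -> (y < t)%N -> P x y t.
  move=> xy yt; rewrite /P /alt tri_sign_sorted // mul1r plucker_minor3.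
  rewrite !(rsubset_nthE _ x) tripleE ?enum_triple //= !inE negb_or -!val_eqE /=.
  by rewrite !ltn_eqF // (ltn_trans xy).
have rep x y : P x x y.
  rewrite /P /minor3 /alt; have /eqP-> : tri_sign x x y == 0 by rewrite tri_sign_eq0 /= inE eqxx.
  by rewrite mul0r; ring.
rewrite -/(P a b c).
case: (ltngtP a b) => [ab|ba|/val_inj<-]; last exact: rep.
  case: (ltngtP b c) => [bc|cb|/val_inj<-]; [exact: sorted| |exact/P12/P23/rep].
  case: (ltngtP a c) => [ac|ca|/val_inj<-]; [exact/P23/sorted| |exact/P23/rep].
  by apply/P23/P12/sorted.
case: (ltngtP a c) => [ac|ca|/val_inj<-]; [exact/P12/sorted| |exact/P23/rep].
case: (ltngtP b c) => [bc|cb|/val_inj<-]; [exact/P12/P23/sorted| |exact/P12/P23/rep].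
by apply/P12/P23/P12/sorted.
Qed.

Lemma minor3_relation A i a b c d :
  minor3 A i a b * minor3 A i c d + minor3 A i a c * minor3 A i d b +
  minor3 A i a d * minor3 A i b c = 0.
Proof. by rewrite /minor3; ring. Qed.

End PluckerTriples.

Lemma char_atN (L : finType) (R : realType) (z : L -> complex R) u :
  (forall l, z l != 0) -> char_at z (- u) = (char_at z u)^-1.
Proof.
move=> z0; apply: (mulIf (char_at_neq0 z0 u)).
by rewrite mulVf ?char_at_neq0 // -char_atD // addNr char_at0.
Qed.

Section ThreeTermPoly.
Variables (L : finType) (R : realType) (l0 : L).
Local Notation C := (complex R).
Local Notation M := (character L).
Local Notation CM := (grpalg C M).
Implicit Types (z : L -> C) (w : L -> R) (a b c d e f : L).

(** Exponent of [z_c z_d / (z_a z_b)]. Dividing a quadratic relation by one of its monomials makes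
    it a function on the torus. *)
Definition pair_char a b c d : M := (coord l0 c + coord l0 d) - (coord l0 a + coord l0 b).

Definition gaterm (t : C) (u : M) : CM := t *: gaX C u.

Definition three_term t1 t2 t3 a b c d e f : CM :=
  gaterm t1 0 + gaterm t2 (pair_char a b c d) + gaterm t3 (pair_char a b e f).

Lemma evalT_term z t u : evalT (gaterm t u) z = t * char_at z u.
Proof. by rewrite evalTZ evalTX. Qed.

Lemma dlog_term l t u : dlog l (gaterm t u) = gaterm (t * (u l)%:~R) u.
Proof. by rewrite /gaterm dlogZ dlogX scalerA. Qed.

Lemma sum_coord (A : comNzRingType) (v : L -> A) a :
  \sum_l (coord l0 a l)%:~R * v l = v a - v l0.
Proof.
have e b : \sum_l ((l == b)%:R : int)%:~R * v l = v b.
  by rewrite (bigD1 b) //= eqxx mul1r big1 ?addr0 // => l /negPf->; rewrite mul0r.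
under eq_bigr do rewrite coordE rmorphB mulrBl /=.
by rewrite sumrB !e.
Qed.

Lemma char_at_coord z a : (forall l, z l != 0) -> char_at z (coord l0 a) = z a / z l0.
Proof.
move=> z0; rewrite /char_at.
have e b : \prod_i z i ^ ((i == b)%:R : int) = z b.
  by rewrite (bigD1 b) //= eqxx expr1z big1 ?mulr1 // => j /negPf->.
under eq_bigr do rewrite coordE expfzDr //.
rewrite big_split /= e; congr (_ * _); rewrite -[in RHS](e l0) -prodfV.
by apply: eq_bigr => j _; rewrite invr_expz.
Qed.

Lemma char_at_pair z a b c d : (forall l, z l != 0) ->
  z a * z b * char_at z (pair_char a b c d) = z c * z d.
Proof.
move=> z0; rewrite char_atD // char_atN // !char_atD // !char_at_coord //.
by field; rewrite !z0.
Qed.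

Lemma three_term_eval z t1 t2 t3 a b c d e f : (forall l, z l != 0) ->
  z a * z b * evalT (three_term t1 t2 t3 a b c d e f) z =
  t1 * (z a * z b) + t2 * (z c * z d) + t3 * (z e * z f).
Proof.
move=> z0; have -> : evalT (three_term t1 t2 t3 a b c d e f) z =
    t1 + t2 * char_at z (pair_char a b c d) + t3 * char_at z (pair_char a b e f).
  rewrite /three_term 2!evalTD; congr (_ + _ + _); rewrite evalT_term //.
  by rewrite char_at0 mulr1.
rewrite -(char_at_pair a b c d z0) -(char_at_pair a b e f z0).
by ring.
Qed.

Lemma sum_pair_char (A : comNzRingType) (v : L -> A) a b c d :
  \sum_l (pair_char a b c d l)%:~R * v l = v c + v d - v a - v b.
Proof.
under eq_bigr do rewrite char_add char_opp !char_add rmorphB !rmorphD /= mulrBl !mulrDl.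
by rewrite sumrB !big_split /= !sum_coord; ring.
Qed.

Lemma pairing_pair_char w a b c d :
  pairing (pair_char a b c d) w = w c + w d - (w a + w b).
Proof. by rewrite /pairing sum_pair_char opprD addrA. Qed.

Lemma three_term_dlog z t1 t2 t3 a b c d e f (v : L -> C) : (forall l, z l != 0) ->
  z a * z b * (\sum_l v l * evalT (dlog l (three_term t1 t2 t3 a b c d e f)) z) =
  t2 * (z c * z d) * (v c + v d - v a - v b) + t3 * (z e * z f) * (v e + v f - v a - v b).
Proof.
move=> z0; pose X u := char_at z u.
have e1 l : evalT (dlog l (three_term t1 t2 t3 a b c d e f)) z =
    t2 * ((pair_char a b c d l)%:~R * X (pair_char a b c d)) +
    t3 * ((pair_char a b e f l)%:~R * X (pair_char a b e f)).
  rewrite /three_term 2!dlogD 2!evalTD -[RHS]add0r addrA.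
  by congr (_ + _ + _); rewrite dlog_term evalT_term ?mulrA // char_zero mulr0 mul0r.
under eq_bigr do rewrite e1.
set p2 := pair_char a b c d; set p3 := pair_char a b e f.
have -> : \sum_l v l * (t2 * ((p2 l)%:~R * X p2) + t3 * ((p3 l)%:~R * X p3)) =
    t2 * X p2 * (\sum_l (p2 l)%:~R * v l) + t3 * X p3 * (\sum_l (p3 l)%:~R * v l).
  by rewrite !mulr_sumr -big_split; apply: eq_bigr => l _ /=; ring.
rewrite /p2 /p3 !sum_pair_char -(char_at_pair a b c d z0).
by rewrite -(char_at_pair a b e f z0) /X; ring.
Qed.

Local Notation wt w := (fun u : M => pairing u w).

Lemma three_term_weight w t1 t2 t3 a b c d e f :
  w a + w b <= w c + w d -> w a + w b <= w e + w f ->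
  weight_ge (wt w) 0 (three_term t1 t2 t3 a b c d e f) /\
  weight_part (wt w) 0 (three_term t1 t2 t3 a b c d e f) =
  three_term t1 (if w c + w d == w a + w b then t2 else 0)
    (if w e + w f == w a + w b then t3 else 0) a b c d e f.
Proof.
move=> h2 h3; rewrite /three_term.
have ge t u : 0 <= pairing u w -> weight_ge (wt w) 0 (gaterm t u).
  by move=> u0; apply/weight_geZ/weight_geX.
have pt t u : weight_part (wt w) 0 (gaterm t u) =
    gaterm (if pairing u w == 0 then t else 0) u.
  by rewrite /gaterm weight_partZ weight_partX; case: ifP => _; rewrite ?scaler0 ?scale0r.
split.
  apply: weight_geD; first apply: weight_geD; apply: ge.
  - by rewrite pairing0.
  - by rewrite pairing_pair_char subr_ge0.
  - by rewrite pairing_pair_char subr_ge0.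
have D3 (f1 f2 f3 g1 g2 g3 : CM) : weight_part (wt w) 0 f1 = g1 ->
    weight_part (wt w) 0 f2 = g2 -> weight_part (wt w) 0 f3 = g3 ->
    weight_part (wt w) 0 (f1 + f2 + f3) = g1 + g2 + g3.
  by move=> <- <- <-; rewrite 2!weight_partD.
apply: D3; first by rewrite pt pairing0 eqxx.
  by rewrite pt pairing_pair_char subr_eq0.
by rewrite pt pairing_pair_char subr_eq0.
Qed.

Lemma three_term_init (w : L -> R) (z : L -> C) t1 t2 t3 a b c d e f :
  (forall l, z l != 0) -> w a + w b <= w c + w d -> w a + w b <= w e + w f ->
  let p := weight_part (wt w) 0 (three_term t1 t2 t3 a b c d e f) in
  let u2 := (if w c + w d == w a + w b then t2 else 0) * (z c * z d) in
  let u3 := (if w e + w f == w a + w b then t3 else 0) * (z e * z f) in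
  [/\ weight_ge (wt w) 0 (three_term t1 t2 t3 a b c d e f),
    z a * z b * evalT p z = t1 * (z a * z b) + u2 + u3 &
    forall v : L -> C, z a * z b * (\sum_l v l * evalT (dlog l p) z) =
      u2 * (v c + v d - v a - v b) + u3 * (v e + v f - v a - v b)].
Proof.
move=> z0 h2 h3 p u2 u3; have [G0 GE] := three_term_weight t1 t2 t3 h2 h3.
split=> // [|v]; rewrite /p GE; first exact: three_term_eval.
exact: three_term_dlog.
Qed.

End ThreeTermPoly.

(** * The Jacobian criterion for initial degenerations *)

Section JacobianCriterion.
Variables (L : finType) (R : realType) (l0 : L).
Local Notation C := (complex R).
Local Notation M := (character L).
Local Notation CM := (grpalg C M).
Local Notation wt w := (fun u : M => pairing u w).
Variables (X : set (L -> C)) (w : L -> R) (Xw : Trop X w) (dim : nat).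
Local Notation I := (vanishing_ideal X).
Hypothesis X0 : forall z, X z -> forall l, z l != 0.

Definition log_tangent z (v : L -> C) : Prop :=
  forall g, I g -> \sum_l evalT (dlog l g) z * v l = 0.

Hypothesis tangent_dim : forall z, X z -> exists2 T : 'M[C]_(dim, #|L|), row_free T &
  forall t, log_tangent z (fun l => T t (enum_rank l)).

(** At a point of [X] the logarithmic gradients of all elements of [I] annihilate [dim] independent
    vectors. Any [r.+1] of them thus have rank at most [#|L| - dim], hence at most [r]. *)
Lemma border_det_vanishing r (F : 'I_r -> CM) (cols : 'I_r -> L) :
  (#|L| <= r + dim)%N -> (forall i, I (F i)) ->
  forall e g, I g -> I (border_det dlog F cols e g).
Proof.
move=> rd FI e g Ig z Xz; have [T Tfree Tz] := tangent_dim Xz.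
pose G : 'M[C]_(r.+1, #|L|) :=
  \matrix_(i, l) evalT (dlog (enum_val l) (border_row F g i)) z.
have GT : G *m T^T = 0.
  apply/matrixP => i t; rewrite !mxE.
  have Ii : I (border_row F g i) by rewrite /border_row; case: (unlift ord_max i).
  rewrite -[RHS](Tz t _ Ii) (reindex (@enum_rank L)) /=; last first.
    by apply: onW_bij; apply: enum_rank_bij.
  by apply: eq_bigr => l _; rewrite !mxE enum_rankK.
have rG : (\rank G < r.+1)%N.
  have := mulmx0_rank_max GT; rewrite mxrank_tr (eqP Tfree); lia.
rewrite /border_det evalT_det; last exact: X0.
have -> : \matrix_(i, j) evalT (border_mx dlog F cols e g i j) z =
    colsub (fun j => enum_rank (border_col cols e j)) G.
  by apply/matrixP => i j; rewrite !mxE enum_rankK.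
apply: contraTeq rG => det0; rewrite -leqNgt.
set N := colsub _ G in det0; have /mxrank_unit rN : N \in unitmx.
  by rewrite unitmxE unitfE.
have NE : N = G *m colsub (fun j => enum_rank (border_col cols e j)) 1%:M.
  by rewrite mulmx_colsub mulmx1.
by rewrite -[X in (X <= _)%N]rN NE mxrankM_maxl.
Qed.

Hypothesis initial_forms : forall x : L -> C, (forall l, x l != 0) ->
  (forall h, init_ideal w I h -> evalT h x = 0) ->
  exists N (G : 'I_N -> CM) (E : seq L), [/\ forall k, I (G k),
    forall k, weight_ge (wt w) 0 (G k), (size E <= dim)%N &
    forall v : L -> C,
      (forall k, \sum_l v l * evalT (dlog l (weight_part (wt w) 0 (G k))) x = 0) ->
      (forall l, l \in E -> v l = 0) -> forall l, v l = 0].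

(** The columns of the minor are the coordinates outside [E]. Setting those in [E] to zero leaves
    only the zero solution, so the Jacobian has full column rank on the others and suitable rows
    give a nonzero minor. *)
Theorem smooth_of_initial_forms : smooth (init_degen Xw).
Proof.
apply: (quotient_smooth l0) => x x0 Jx.
have [N [G [E [GI G0 Ed Gx]]]] := initial_forms x0 Jx.
pose f k := weight_part (wt w) 0 (G k).
pose K := [set l | l \notin E]%SET; pose r := #|K|.
have rd : (#|L| <= r + dim)%N.
  rewrite -(cardsC K) leq_add2l; apply: leq_trans Ed; apply: leq_trans (card_size E).
  by apply/subset_leq_card/fintype.subsetP => l; rewrite !inE negbK.
pose cols (j : 'I_r) : L := enum_val j.
pose A : 'M[C]_(N, r) := \matrix_(k, j) evalT (dlog (cols j) (f k)) x.
have Afull : row_full A.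
  rewrite /row_full -mxrank_tr -/(row_free A^T); apply: inj_row_free => u uA.
  pose v l := \sum_(j | cols j == l) u 0 j.
  have vE j : v (cols j) = u 0 j.
    by rewrite /v (big_pred1 j) // => j'; rewrite (inj_eq enum_val_inj).
  have v0 : forall l, v l = 0.
    have vN l : l \notin K -> v l = 0.
      move=> lK; rewrite /v big1 // => j /eqP jl.
      by have := enum_valP j; rewrite -/(cols j) jl (negPf lK).
    apply: Gx => [k|l lE]; last by apply: vN; rewrite inE negbK.
    transitivity ((u *m A^T) 0 k); last by rewrite uA mxE.
    rewrite mxE [RHS](eq_bigr (fun j => v (cols j) * evalT (dlog (cols j) (f k)) x)).
      rewrite [LHS](bigID (mem K)) /= [X in _ + X]big1 ?addr0; first exact: big_enum_val.
      by move=> l lK; rewrite vN ?mul0r.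
    by move=> j _; rewrite vE !mxE.
  by apply/rowP => j; rewrite mxE -vE v0.
pose F i := G (fullrankfun Afull i).
have det0 : evalT (\det (jac_mx dlog (fun i => f (fullrankfun Afull i)) cols)) x != 0.
  rewrite evalT_det //; have := fullrowsub_unit Afull; rewrite unitmxE unitfE.
  by congr (\det _ != 0); apply/matrixP => i j; rewrite !mxE.
have [s s0 sJ] := init_ideal_local l0 x0 Jx (fun i => G0 _) (fun i => GI _)
  (border_det_vanishing (F := F) cols rd (fun i => GI _)) det0.
exists r, (fun i => f (fullrankfun Afull i)), cols, s; split=> // i.
exact: wpart_init_ideal.
Qed.

End JacobianCriterion.

(** * Logarithmic tangent vectors obtained from lines *)

Section CurveTangent.
Variables (L : finType) (R : realType).
Local Notation C := (complex R).
Local Notation M := (character L).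
Local Notation CM := (grpalg C M).
Implicit Types (H : {poly C}) (z q : L -> C) (g : CM).

(** The logarithmic derivative at zero, written without division so that it is additive under
    products even when [H] vanishes at zero. *)
Definition log_deriv H t : Prop := H^`().[0] = t * H.[0].

Lemma log_derivM H1 H2 t1 t2 :
  log_deriv H1 t1 -> log_deriv H2 t2 -> log_deriv (H1 * H2) (t1 + t2).
Proof. by rewrite /log_deriv derivM hornerD !hornerM => -> ->; ring. Qed.

Lemma log_deriv1 : log_deriv 1 0.
Proof. by rewrite /log_deriv derivC horner0 mul0r. Qed.

Lemma log_derivX H t n : log_deriv H t -> log_deriv (H ^+ n) (n%:R * t).
Proof.
move=> Ht; elim: n => [|n IH]; first by rewrite expr0 mul0r; apply: log_deriv1.
by rewrite exprS -natr1 mulrDl mul1r addrC; apply: log_derivM.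
Qed.

Lemma log_deriv_prod (H : L -> {poly C}) (t : L -> C) (n : L -> nat) :
  (forall l, log_deriv (H l) (t l)) ->
  log_deriv (\prod_l H l ^+ n l) (\sum_l (n l)%:R * t l).
Proof.
move=> Ht; elim/big_rec2: _ => [|l y1 y2 _ IH]; first exact: log_deriv1.
by apply: log_derivM IH; apply: log_derivX.
Qed.

Variables (z q : L -> C).
Hypothesis z0 : forall l, z l != 0.
Local Notation P l := ((z l)%:P + q l *: 'X : {poly C}).
Local Notation pt s := (fun l => z l + s * q l).
Local Notation t l := (q l / z l).

Let P_eval s l : (P l).[s] = z l + s * q l.
Proof. by rewrite hornerD hornerC hornerZ hornerX mulrC. Qed.

Let P_log l : log_deriv (P l) (t l).
Proof.
rewrite /log_deriv P_eval mul0r addr0 derivD derivC derivZ derivX add0r.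
by rewrite hornerZ hornerC mulr1 divfK.
Qed.

Lemma evalT_dlogD (y : L -> C) l c u g : evalT (dlog l (c *: gaX C u + g)) y =
  c * (u l)%:~R * char_at y u + evalT (dlog l g) y.
Proof.
rewrite dlogD evalTD; congr (_ + _).
by rewrite dlogZ dlogX evalTZ evalTZ evalTX mulrA.
Qed.

Let mul_term (x n k c e y : C) : x = c * n * k + e -> x * y = c * k * (n * y) + e * y.
Proof. by move=> ->; ring. Qed.

(* After clearing denominators, the restriction of a Laurent polynomial to the
   line [z + s q] is a polynomial in [s]. *)
Lemma clear_denominators g : exists N0 : nat, forall N, (N0 <= N)%N ->
  exists H : {poly C},
   (forall s, (forall l, z l + s * q l != 0) ->
      H.[s] = (\prod_l (z l + s * q l)) ^+ N * evalT g (pt s)) /\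
   H^`().[0] = (\prod_l z l) ^+ N *
     (\sum_l evalT (dlog l g) z * t l + N%:R * (\sum_l t l) * evalT g z).
Proof.
elim/ga_ind: g => [|c u g [N1 IH]].
  exists 0%N => N _; exists 0; split=> [s _|]; first by rewrite horner0 evalT0 mulr0.
  rewrite deriv0 horner0 evalT0 mulr0 addr0 [X in _ * X]big1 ?mulr0 // => l _.
  by rewrite dlog0 evalT0 mul0r.
exists (N1 + \sum_l `|u l|)%N => N hN.
have [|H [H1 H2]] := IH N; first by apply: leq_trans hN; rewrite leq_addr.
have uN l : (0 : int) <= u l + N%:Z.
  have : (`|u l| <= N)%N.
    by apply: leq_trans hN; apply: leq_trans (leq_addl _ _); rewrite (bigD1 l) //= leq_addr.
  by lia.
pose n l := `|(u l + N%:Z)%R|%N.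
have nE l : (n l)%:Z = u l + N%:Z by rewrite /n gez0_abs.
pose Q := \prod_l P l ^+ n l.
have QE s : (forall l, z l + s * q l != 0) ->
    Q.[s] = (\prod_l (z l + s * q l)) ^+ N * char_at (pt s) u.
  move=> s0; rewrite horner_prod -prodrXl -big_split; apply: eq_bigr => l _ /=.
  by rewrite horner_exp P_eval (exprnP _ (n l)) (exprnP _ N) nE expfzDr // mulrC.
have zE : pt 0 = z by apply/funext => l; rewrite mul0r addr0.
have Q0 : Q.[0] = (\prod_l z l) ^+ N * char_at z u.
  rewrite QE ?zE; last by move=> l; rewrite mul0r addr0.
  by congr (_ ^+ _ * _); apply: eq_bigr => l _; rewrite mul0r addr0.
have Q1 : log_deriv Q (\sum_l (u l)%:~R * t l + N%:R * \sum_l t l).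
  have := log_deriv_prod n P_log; congr log_deriv.
  rewrite mulr_sumr -big_split; apply: eq_bigr => l _ /=.
  by rewrite -mulrDl pmulrn nE rmorphD.
have eT y : evalT (c *: gaX C u + g) y = c * char_at y u + evalT g y.
  by rewrite evalTD; congr (_ + _); rewrite evalTZ evalTX.
have eS : \sum_l evalT (dlog l (c *: gaX C u + g)) z * t l =
    c * char_at z u * (\sum_l (u l)%:~R * t l) + \sum_l evalT (dlog l g) z * t l.
  rewrite mulr_sumr -big_split; apply: eq_bigr => l _ /=.
  exact: mul_term (evalT_dlogD z l c u g).
have fin S' E' : S' = c * char_at z u * (\sum_l (u l)%:~R * t l) +
      \sum_l evalT (dlog l g) z * t l -> E' = c * char_at z u + evalT g z ->
    (c *: Q + H)^`().[0] = (\prod_l z l) ^+ N * (S' + N%:R * (\sum_l t l) * E').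
  by move=> -> ->; rewrite derivD derivZ hornerD hornerZ H2 Q1 Q0; ring.
exists (c *: Q + H); split=> [s s0|]; last exact: fin eS (eT z).
by rewrite (eT (pt s)) hornerD hornerZ H1 // QE //; ring.
Qed.

(** After clearing denominators, the restriction of [g] to the line has infinitely many zeros, hence
    is zero. As [g] vanishes at [z], the derivative at zero leaves only the tangent term. *)
Lemma curve_tangent (X : set (L -> C)) :
  (forall s, (forall l, z l + s * q l != 0) -> X (pt s)) ->
  log_tangent X z (fun l => t l).
Proof.
move=> Xs g Xg; have [N0 /(_ N0 (leqnn _))[H [H1 H2]]] := clear_denominators g.
have zE : pt 0 = z by apply/funext => l; rewrite mul0r addr0.
have Xz : X z by rewrite -zE; apply: Xs => l; rewrite mul0r addr0.
have H0 : H = 0.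
  (* The factor [Q] takes care of the parameters at which the line leaves the torus. *)
  pose Q := \prod_l P l.
  have Qs s : Q.[s] = \prod_l (z l + s * q l).
    by rewrite horner_prod; apply: eq_bigr => l _; rewrite P_eval.
  have Q0 : Q != 0.
    apply: contraTneq (oner_neq0 C) => Q0; have := Qs 0; rewrite Q0 horner0 => /esym/eqP.
    by rewrite prodf_seq_eq0 => /hasP[l _]; rewrite mul0r addr0 (negPf (z0 l)).
  have HQ s : (H * Q).[s] = 0.
    rewrite hornerM; have [Q1|Q1] := eqVneq Q.[s] 0; first by rewrite Q1 mulr0.
    have s0 l : z l + s * q l != 0.
      by apply: contra_neq Q1 => e; rewrite Qs (bigD1 l) //= e mul0r.
    by rewrite H1 // (Xg _ (Xs s s0)) mulr0 mul0r.
  have : H * Q == 0.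
    apply: contraT => HQ0.
    pose rs := [seq i%:R : C | i <- iota 0 (size (H * Q))].
    have := @max_poly_roots _ (H * Q) rs HQ0; rewrite size_map size_iota ltnn; apply.
      by apply/allP => s _; apply/rootP/HQ.
    by rewrite map_inj_uniq ?iota_uniq // => i j /eqP; rewrite eqr_nat => /eqP.
  by rewrite mulf_eq0 (negPf Q0) orbF => /eqP.
have := H2; rewrite H0 deriv0 horner0 (Xg z Xz) mulr0 addr0 => /esym/eqP.
rewrite mulf_eq0 expf_eq0 => /orP[/andP[_]|/eqP //].
by rewrite prodf_seq_eq0 => /hasP[l _]; rewrite (negPf (z0 l)).
Qed.

(** Euler's relation: the exponents of a character sum to zero. *)
Lemma scaling_tangent (X : set (L -> C)) : log_tangent X z (fun=> 1).
Proof.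
move=> g _; elim/ga_ind: g => [|c u g IH].
  by rewrite big1 // => l _; rewrite dlog0 evalT0 mul0r.
transitivity (c * char_at z u * (\sum_l (u l)%:~R * 1) + \sum_l evalT (dlog l g) z * 1).
  rewrite mulr_sumr -big_split; apply: eq_bigr => l _ /=.
  exact: mul_term (evalT_dlogD z l c u g).
by rewrite IH -mulr_suml -rmorph_sum char_sum mul0r mulr0 addr0.
Qed.

End CurveTangent.

(** * The open Grassmannian *)

Section ShearTangent.
Variables (n : nat) (R : realType).
Local Notation C := (complex R).
Local Notation L := (rsubset 3 n).
Variable l0 : L.
Implicit Types (A : 'M[C]_(3, n)) (i j : 'I_n) (S : L).

Lemma plucker_row_free A S : plucker A S != 0 -> row_free A.
Proof.
rewrite -unitfE -unitmxE => /mxrank_unit rS.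
rewrite /row_free eqn_leq rank_leq_row -[X in (X <= _)%N]rS.
have -> : colsub (rsubset_nth S) A = A *m colsub (rsubset_nth S) 1%:M.
  by rewrite mulmx_colsub mulmx1.
exact: mxrankM_maxl.
Qed.

Lemma plucker_triple A a b c : uniq [:: a; b; c] ->
  plucker A (triple l0 a b c) = tri_sign C a b c * minor3 A a b c.
Proof.
by move=> U; rewrite -(alt_plucker l0) /alt mulrA tri_sign_sqr // mul1r.
Qed.

Definition repl (j i e : 'I_n) : 'I_n := if e == j then i else e.

(** Adds [s] times column [i] to column [j]. A minor uses column [j] at most once, so every Pluecker
    coordinate is affine in [s] and moves along a line. *)
Definition shear A j i s : 'M[C]_(3, n) :=
  \matrix_(r, e) (A r e + if e == j then s * A r i else 0).

Definition shear_dir A j i S : C :=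
  if j \in val S then plucker (colsub (repl j i) A) S else 0.

Lemma plucker_shear A j i s S :
  plucker (shear A j i s) S = plucker A S + s * shear_dir A j i S.
Proof.
have [a [b [c [U ->]]]] := triple_surj l0 S.
have jS : (j \in val (triple l0 a b c)) = [|| a == j, b == j | c == j].
  by rewrite tripleE // !inE !(eq_sym j) orbA.
rewrite /shear_dir jS !plucker_triple // /minor3 !mxE /repl.
move: U; rewrite /= !inE negb_or => /and3P[/andP[ab ac] bc _].
have [<-|aj] := eqVneq a j.
  by rewrite [b == a]eq_sym [c == a]eq_sym (negPf ab) (negPf ac) /=; ring.
have [<-|bj] := eqVneq b j; first by rewrite [c == b]eq_sym (negPf bc) /=; ring.
by have [_|cj] := eqVneq c j; rewrite /=; ring.
Qed.

Lemma Gr0_shear A c j i s : c != 0 ->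
  (forall S, c * plucker A S + s * (c * shear_dir A j i S) != 0) ->
  Gr0 (fun S => c * plucker A S + s * (c * shear_dir A j i S)).
Proof.
move=> c0 nz; split=> //; exists (shear A j i s).
  apply: (@plucker_row_free _ l0); rewrite plucker_shear.
  by have := nz l0; apply: contraNneq; rewrite mulrCA -mulrDr => ->; rewrite mulr0.
by exists c => //; apply/funext => S; rewrite plucker_shear mulrDr mulrCA.
Qed.

Lemma shear_dir_triple A j i a b : uniq [:: a; b; j] ->
  shear_dir A j i (triple l0 a b j) = tri_sign C a b j * minor3 A a b i.
Proof.
move=> U; rewrite /shear_dir tripleE // !inE eqxx orbT plucker_triple //.
move: U; rewrite /= !inE negb_or => /and3P[/andP[ab aj] bj _].
by rewrite /minor3 !mxE /repl eqxx (negPf aj) (negPf bj).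
Qed.

End ShearTangent.

Section GrassmannTangent.
Variables (m : nat) (R : realType).
Local Notation C := (complex R).
Local Notation n := (3 + m)%N.
Local Notation L := (rsubset 3 n).
Variable l0 : L.
Local Notation dir := (option ('I_m * 'I_3)).

Definition chart_base : L := triple l0 (lshift m 0) (lshift m 1) (lshift m 2%:R).

(* The coordinates of the affine chart around the base triple, together with
   the base triple itself. *)
Definition chart_triple (o : dir) : L :=
  if o is Some (k, i) then
    triple l0 (lshift m (lift i 0)) (lshift m (lift i 1)) (rshift 3 k)
  else chart_base.

(** Logarithmic directions of the shears that add a base column to one of the other [m] columns;
    [None] stands for scaling. This makes [3 * m + 1] directions. *)
Definition chart_dir (z : L -> C) (A : 'M[C]_(3, n)) c (o : dir) S : C :=
  if o is Some (k, i) then c * shear_dir A (rshift 3 k) (lshift m i) S / z S else 1.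

Lemma chart_uniq k (i : 'I_3) :
  uniq [:: lshift m (lift i 0); lshift m (lift i 1); rshift 3 k].
Proof. by rewrite /= !inE eq_lshift !eq_lrshift (inj_eq lift_inj). Qed.

Lemma base_uniq : uniq [:: lshift m (0 : 'I_3); lshift m 1; lshift m 2%:R].
Proof. by []. Qed.

Lemma chart_dir_base z A c k i : chart_dir z A c (Some (k, i)) chart_base = 0.
Proof.
rewrite /chart_dir /shear_dir tripleE ?base_uniq // !inE !eq_rlshift /=.
by rewrite mulr0 mul0r.
Qed.

Lemma chart_dir_off z A c k i k' i' : (k', i') != (k, i) ->
  chart_dir z A c (Some (k', i')) (chart_triple (Some (k, i))) = 0.
Proof.
rewrite /chart_dir /chart_triple; have [<-|kk] := eqVneq k' k.
  rewrite xpair_eqE eqxx /= => ii; rewrite shear_dir_triple ?chart_uniq //.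
  have [j ->] : exists j : 'I_2, i' = lift i j.
    by case: (unliftP i i') ii => [j ->|->]; [exists j|rewrite eqxx].
  have : j = 0 \/ j = 1.
    by case: j => -[|[|//]] h; [left|right]; apply/val_inj.
  move=> j01; have -> : minor3 A (lshift m (lift i 0)) (lshift m (lift i 1))
      (lshift m (lift i j)) = 0 by case: j01 => ->; rewrite /minor3; ring.
  by rewrite !mulr0 mul0r.
move=> _; rewrite /shear_dir tripleE ?chart_uniq // !inE !eq_rlshift /=.
by rewrite eq_rshift (negPf kk) mulr0 mul0r.
Qed.

Lemma chart_dir_neq0 z A c o : c != 0 -> (forall S, z S = c * plucker A S) ->
  (forall S, z S != 0) -> chart_dir z A c o (chart_triple o) != 0.
Proof.
move=> c0 zE z0; case: o => [[k i]|]; last exact: oner_neq0.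
rewrite /chart_dir /chart_triple shear_dir_triple ?chart_uniq //.
rewrite !mulf_neq0 ?invr_neq0 // ?tri_sign_eq0 ?chart_uniq //.
rewrite -(alt_plucker l0) alt_neq0 // => [S|].
  by have := z0 S; rewrite zE; apply: contraNneq => ->; rewrite mulr0.
by rewrite /= !inE !eq_lshift (inj_eq lift_inj) ![lift i _ == i]eq_sym !(negPf (neq_lift _ _)).
Qed.

(** Independence is read off on the chart triples, where the matrix is triangular: the base triple
    sees only scaling, and the triple attached to [(k, i)] sees only scaling and its own shear, with
    a nonzero entry. *)
Lemma Gr0_tangent (z : L -> C) : Gr0 z ->
  exists2 T : 'M[C]_(#|{: dir}|, #|{: L}|), row_free T &
  forall t, log_tangent (@Gr0 3 n C) z (fun l => T t (enum_rank l)).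
Proof.
move=> [[A Afree [c c0 zE]] z0].
have zS S : z S = c * plucker A S by rewrite zE.
exists (\matrix_(t, l) chart_dir z A c (enum_val t) (enum_val l)).
  apply: inj_row_free => u uT.
  have uE S : \sum_o u 0 (enum_rank o) * chart_dir z A c o S = 0.
    transitivity ((u *m \matrix_(t, l) chart_dir z A c (enum_val t) (enum_val l)) 0 (enum_rank S)).
      rewrite mxE (reindex (@enum_rank dir)) /=; last exact/onW_bij/enum_rank_bij.
      by apply: eq_bigr => o _; rewrite !mxE !enum_rankK.
    by rewrite uT mxE.
  have uN : u 0 (enum_rank None) = 0.
    have := uE chart_base; rewrite (bigD1 None) //= mulr1 big1 ?addr0 //.
    by case=> [[k i]|//] _; rewrite chart_dir_base mulr0.
  have uO o : u 0 (enum_rank o) = 0.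
    case: o => [[k i]|//].
    pose F (o : dir) := u 0 (enum_rank o) * chart_dir z A c o (chart_triple (Some (k, i))).
    have : F (Some (k, i)) = 0.
      rewrite -[RHS](uE (chart_triple (Some (k, i)))) -/(\sum_o F o).
      rewrite (bigD1 (Some (k, i))) // big1 => [|[[k' i']|] ki]; first exact/esym/addr0.
        by rewrite /F chart_dir_off ?mulr0 //; move: ki; rewrite (inj_eq Some_inj).
      by rewrite /F uN mul0r.
    move/eqP; rewrite /F mulf_eq0.
    by rewrite (negPf (chart_dir_neq0 (Some (k, i)) c0 zS z0)) orbF => /eqP.
  by apply/rowP => t; rewrite mxE -(enum_valK t) uO.
move=> t; have -> : (fun l => (\matrix_(t, l) chart_dir z A c (enum_val t) (enum_val l)) t (enum_rank l))
    = chart_dir z A c (enum_val t).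
  by apply/funext => l; rewrite mxE enum_rankK.
case: (enum_val t) => [[k i]|]; last exact: scaling_tangent.
apply: (curve_tangent z0) => s; rewrite zE => nz.
exact: Gr0_shear.
Qed.

End GrassmannTangent.

Section GrassmannInitialForms.
Variables (n : nat) (R : realType).
Local Notation C := (complex R).
Local Notation L := (rsubset 3 n).
Variable l0 : L.
Local Notation tri := (triple l0).
Local Notation sg := (tri_sign C).
Local Notation CM := (grpalg C (character L)).
Local Notation I := (vanishing_ideal (@Gr0 3 n C)).
Variable w : L -> R.
Local Notation wt := (fun u : character L => pairing u w).
Local Notation w3 := (fun a b c => w (tri a b c)).

(* The three-term relation, divided by its first term. *)
Definition plucker_rel (i a b c d : 'I_n) : CM :=
  three_term l0 (sg i a b * sg i c d) (sg i a c * sg i d b) (sg i a d * sg i b c)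
    (tri i a b) (tri i c d) (tri i a c) (tri i d b) (tri i a d) (tri i b c).

Lemma plucker_rel_vanishing i a b c d : I (plucker_rel i a b c d).
Proof.
move=> z [[A _ [k k0 zE]] z0].
have zz0 : z (tri i a b) * z (tri i c d) != 0 by rewrite mulf_neq0.
apply: (mulfI zz0); rewrite mulr0 three_term_eval //.
have e e1 e2 f1 f2 : sg i e1 f1 * sg i e2 f2 * (z (tri i e1 f1) * z (tri i e2 f2)) =
    k * k * (minor3 A i e1 f1 * minor3 A i e2 f2).
  by rewrite -!(alt_plucker l0) /alt zE; ring.
by rewrite !e -!mulrDr minor3_relation mulr0.
Qed.

Lemma min_term_rot i a b c d : min_term w3 i a b c d ->
  min_term w3 i a c d b = (w3 i a c + w3 i d b == w3 i a b + w3 i c d) /\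
  min_term w3 i a d b c = (w3 i a d + w3 i b c == w3 i a b + w3 i c d).
Proof.
rewrite /min_term => /andP[h2 h3]; rewrite !eq_le h2 h3 !andbT.
by split; apply/andP/idP => [[]//|h]; split=> //; apply: le_trans h _.
Qed.

Lemma min_term_exists i a b c d :
  [|| min_term w3 i a b c d, min_term w3 i a c d b | min_term w3 i a d b c].
Proof.
rewrite /min_term; move: (w3 i a b + _) (w3 i a c + _) (w3 i a d + _) => p q r.
by case: (lerP p q); case: (lerP p r); case: (lerP q r); case: (lerP q p);
  case: (lerP r p); case: (lerP r q) => //=; lra.
Qed.

Variable x : L -> C.
Hypothesis x0 : forall l, x l != 0.
Hypothesis Jx : forall h, init_ideal w I h -> evalT h x = 0.
Local Notation q := (init_term (alt l0 x) w3).

Lemma plucker_rel_init i a b c d : min_term w3 i a b c d ->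
  [/\ weight_ge wt 0 (plucker_rel i a b c d),
    q i a b c d + q i a c d b + q i a d b c = 0 &
    forall v : L -> C,
      \sum_l v l * evalT (dlog l (weight_part wt 0 (plucker_rel i a b c d))) x = 0 ->
      q i a b c d * (v (tri i a b) + v (tri i c d)) +
      q i a c d b * (v (tri i a c) + v (tri i d b)) +
      q i a d b c * (v (tri i a d) + v (tri i b c)) = 0].
Proof.
move=> hm; have [m2 m3] := min_term_rot hm; have /andP[h2 h3] := hm.
have [G0 Gx Gd] := three_term_init l0 (sg i a b * sg i c d) (sg i a c * sg i d b)
  (sg i a d * sg i b c) x0 h2 h3.
have e1 : sg i a b * sg i c d * (x (tri i a b) * x (tri i c d)) = q i a b c d.
  by rewrite /init_term hm /alt; ring.
have e2 : (if w3 i a c + w3 i d b == w3 i a b + w3 i c d then sg i a c * sg i d b else 0) *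
    (x (tri i a c) * x (tri i d b)) = q i a c d b.
  by rewrite /init_term m2 /alt; case: ifP => _; ring.
have e3 : (if w3 i a d + w3 i b c == w3 i a b + w3 i c d then sg i a d * sg i b c else 0) *
    (x (tri i a d) * x (tri i b c)) = q i a d b c.
  by rewrite /init_term m3 /alt; case: ifP => _; ring.
rewrite e1 e2 e3 in Gx; rewrite e2 e3 in Gd.
have q0 : q i a b c d + q i a c d b + q i a d b c = 0.
  rewrite -Gx; have /Jx h := wpart_init_ideal (plucker_rel_vanishing i a b c d) G0.
  exact: (etrans (congr1 ( *%R _) h) (mulr0 _)).
split=> // v vG; have h := etrans (esym (Gd v)) (etrans (congr1 ( *%R _) vG) (mulr0 _)).
rewrite -h -[RHS]addr0 -[X in _ = _ + X](mul0r (v (tri i a b) + v (tri i c d))) -q0.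
by move: (init_term _ _) (v) => qq v'; ring.
Qed.

(** Cyclic rotation of [b, c, d] brings a minimal term to the front, where [plucker_rel] needs it,
    and leaves cyclic sums unchanged. *)
Lemma plucker_rel_exists i a b c d : exists p : 'I_n * 'I_n * 'I_n,
  let: (b', c', d') := p in min_term w3 i a b' c' d' /\
  forall F : 'I_n -> 'I_n -> 'I_n -> C,
    F b' c' d' + F c' d' b' + F d' b' c' = F b c d + F c d b + F d b c.
Proof.
have /or3P[h|h|h] := min_term_exists i a b c d.
- by exists (b, c, d).
- by exists (c, d, b); split=> // F; rewrite addrC addrA.
- by exists (d, b, c); split=> // F; rewrite [RHS]addrC addrA.
Qed.

Lemma init_plucker_alt : init_plucker (alt l0 x) w3.
Proof.
split=> [a b c|a b c|a b c|a b c|a b c|i a b c d _].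
- exact: alt12.
- exact: alt23.
- by rewrite tripleC12.
- by rewrite tripleC23.
- exact: alt_neq0.
have [[[b' c'] d'] [hm e]] := plucker_rel_exists i a b c d.
by rewrite -(e (fun b c d => q i a b c d)); have [] := plucker_rel_init hm.
Qed.

Local Notation K := ('I_n * 'I_n * 'I_n * 'I_n * 'I_n)%type.

(** Zero unless the leading term is minimal, so that weights are always at least zero. Some rotation
    of each relation is kept. *)
Definition min_plucker_rel (p : K) : CM :=
  let: (i, a, b, c, d) := p in
  if min_term w3 i a b c d then plucker_rel i a b c d else 0.

Lemma min_plucker_rel_tangent (v : L -> C) :
  (forall p : K, \sum_l v l * evalT (dlog l (weight_part wt 0 (min_plucker_rel p))) x = 0) ->
  plucker_tangent (alt l0 x) w3 [set: 'I_n] (fun a b c => v (tri a b c)).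
Proof.
move=> vG; split=> [a b c|a b c|i a b c d _ _].
- by rewrite tripleC12.
- by rewrite tripleC23.
have [[[b' c'] d'] [hm e]] := plucker_rel_exists i a b c d.
rewrite -(e (fun b c d => q i a b c d * (v (tri i a b) + v (tri i c d)))).
have [_ _] := plucker_rel_init hm; apply.
by have := vG (i, a, b', c', d'); rewrite /min_plucker_rel hm.
Qed.

End GrassmannInitialForms.

Theorem theorem1p1 (R : realType) : schon (@Gr0 3 8 (complex R)).
Proof.
move=> w Xw.
(* The form [3 + 5] matches the columns of the chart: three base columns and five others. *)
have l0 : rsubset 3 (3 + 5) by eexists; apply: (triple_card (base_uniq 5)).
(* Fifteen shears and the scaling. *)
have dim16 : #|{: option ('I_5 * 'I_3)}| = 16 by rewrite card_option card_prod !card_ord.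
apply: (@smooth_of_initial_forms _ R l0 _ w Xw #|{: option ('I_5 * 'I_3)}|).
- by move=> z [].
- exact: Gr0_tangent.
move=> x x0 Jx.
have [E E16 det] := plucker_tangent_determined (init_plucker_alt l0 x0 Jx) (card_ord 8).
pose T := ('I_8 * 'I_8 * 'I_8 * 'I_8 * 'I_8)%type.
exists #|{: T}|, (fun k => min_plucker_rel l0 w (enum_val k)),
  [seq triple l0 p.1.1 p.1.2 p.2 | p <- E]; split.
- move=> k; case: (enum_val k) => [[[[i a] b] c] d] /=; case: ifP => _.
    exact: plucker_rel_vanishing.
  by move=> z _; apply: evalT0.
- move=> k; case: (enum_val k) => [[[[i a] b] c] d] /=; case: ifP => [hm|_].
    by have [] := plucker_rel_init x0 Jx hm.
  exact: weight_ge0.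
- by rewrite size_map dim16.
move=> v vG vE S; have [a [b [c [U ->]]]] := triple_surj l0 S.
apply: (det (fun a b c => v (triple l0 a b c))); rewrite ?inE //.
  apply: (min_plucker_rel_tangent x0 Jx) => p.
  by have := vG (enum_rank p); rewrite enum_rankK.
by move=> a' b' c' E'; apply: vE; apply/mapP; exists (a', b', c').
Qed.
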